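(* Let $\mu \in M_c(0,\infty)$ be a nontrivial real measure such that $\int_0^\infty d\mu(t) = 0$, and let $(T(t))_{t>0}$ be a nontrivial strongly continuous quasinilpotent semigroup of bounded operators, with generator $A$, on a Banach space $\mathcal{X}$. Set $F(s)=\int_0^\infty e^{-s\xi}\,d\mu(\xi)$. Then there is an $\eta>0$ such that $$\|F(-sA)\| > \max_{x\ge 0}|F(x)| \qquad \text{for } 0<s\le \eta.$$
   Context: $M_c(0,\infty)$ is the space of (finite, in general complex) regular Borel measures having compact support contained in the open half-line $(0,\infty)$; nontrivial means nonzero. A semigroup $(T(t))_{t>0}$ on a Banach space $\mathcal{X}$ is a family of bounded operators with $T(s+t)=T(s)T(t)$ for $s,t>0$. It is strongly continuous if $t\mapsto T(t)x$ is continuous on $(0,\infty)$ for every $x\in\mathcal{X}$ (no continuity at $0$ is assumed). It is quasinilpotent if every $T(t)$, $t>0$, is quasinilpotent, and nontrivial if it is not identically zero. Functional calculus: for $s>0$ and $F$ the Laplace transform of $\mu\in M_c(0,\infty)$, the bounded operator $F(-sA)$ is defined by $$F(-sA)x=\int_0^\infty T(s\xi)x\,d\mu(\xi)\qquad (x\in\mathcal{X}),$$ a Bochner integral. *)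

(* Defs.v *)
From HB Require Import structures.
From mathcomp Require Import all_boot all_order all_algebra.
From mathcomp Require Import all_classical all_reals all_analysis.
From mathcomp Require Import complex.

Set Implicit Arguments.
Unset Strict Implicit.
Unset Printing Implicit Defensive.

Import Order.TTheory GRing.Theory Num.Theory.
Import numFieldNormedType.Exports.

Local Open Scope classical_set_scope.
Local Open Scope ring_scope.

(* Jordan decomposition of a finite signed measure, built on some Hahn
   decomposition; it does not depend on which one (Hahn_decomposition_uniq). *)
Section Jordan.
Context d (T : measurableType d) (R : realType).
Implicit Type nu : {charge set T -> \bar R}.

Definition hahn_pos nu : set T :=
  projT1 (cid (Hahn_decomposition nu)).

Definition hahn_neg nu : set T :=
  projT1 (cid (projT2 (cid (Hahn_decomposition nu)))).

Lemma hahn_posneg nu : hahn_decomposition nu (hahn_pos nu) (hahn_neg nu).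
Proof. exact: projT2 (cid (projT2 (cid (Hahn_decomposition nu)))). Qed.

Definition pos_part nu : {finite_measure set T -> \bar R} :=
  jordan_pos (hahn_posneg nu).

Definition neg_part nu : {finite_measure set T -> \bar R} :=
  jordan_neg (hahn_posneg nu).

Definition charge_integral nu (D : set T) (f : T -> R) : R :=
  Rintegral (pos_part nu) D f - Rintegral (neg_part nu) D f.

End Jordan.

Section Operators.
Context (R : realType) (X : normedModType R[i]).

(* The norm of X takes its values in R[i]; they are nonnegative reals, and
   taking the real part brings them back to R. *)
Definition rnorm (x : X) : R := complex.Re `|x|.

(* The supremum is meaningful for bounded operators only: sup is 0 on a set
   that is not bounded above. *)
Definition opnorm (B : X -> X) : R :=
  sup [set rnorm (B x) | x in [set x | rnorm x <= 1]].

Definition bounded_operator (B : X -> X) : Prop :=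
  exists M : R, forall x, rnorm (B x) <= M * rnorm x.

Definition quasinilpotent (B : X -> X) : Prop :=
  opnorm (iter n B) `^ (n%:R^-1) @[n --> \oo] --> (0 : R).

End Operators.

Section Bochner.
Context d (T : measurableType d) (R : realType) (X : normedModType R[i]).

Definition simple_function (g : {fimfun T >-> X}) : Prop :=
  forall y, measurable (g @^-1` [set y]).

Definition simple_integral (mu : {finite_measure set T -> \bar R})
    (D : set T) (g : {fimfun T >-> X}) : X :=
  \sum_(y \in range g) ((fine (mu (D `&` g @^-1` [set y])))%:C)%C *: y.

Definition is_bochner_integral (mu : {finite_measure set T -> \bar R})
    (D : set T) (f : T -> X) (v : X) : Prop :=
  exists g : nat -> {fimfun T >-> X},
    [/\ forall n, simple_function (g n),
        {ae mu, forall t, D t -> g n t @[n --> \oo] --> f t},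
        (\int[mu]_(t in D) (rnorm (f t - g n t))%:E)%E @[n --> \oo] --> 0%E &
        simple_integral mu D (g n) @[n --> \oo] --> v].

(* The value is 0 when f is not Bochner integrable. *)
Definition bochner_integral (mu : {finite_measure set T -> \bar R})
    (D : set T) (f : T -> X) : X :=
  xget 0 [set v | is_bochner_integral mu D f v].

Definition charge_bochner_integral (nu : {charge set T -> \bar R})
    (D : set T) (f : T -> X) : X :=
  bochner_integral (pos_part nu) D f - bochner_integral (neg_part nu) D f.

End Bochner.

Section HalfLine.
Context (R : realType).

(* A finite signed Borel measure on the line is automatically regular.
   Measures on the open half-line are viewed as measures on the line whose
   support lies in the half-line. *)
Implicit Type mu : {charge set (measurableTypeR R) -> \bar R}.

Definition half_line : set R := [set x | 0 < x].

(* A point is outside the support when some neighbourhood of it has zero total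
   variation, i.e. all its measurable subsets have zero measure. *)
Definition charge_support mu : set R :=
  [set x | forall U, nbhs x U ->
     exists A, [/\ measurable A, A `<=` U & mu A != 0%E]].

(* Real elements of M_c(0,oo). *)
Definition compact_support_measure mu : Prop :=
  compact (charge_support mu) /\ charge_support mu `<=` half_line.

Definition nontrivial_charge mu : Prop :=
  exists A, measurable A /\ mu A <> 0%E.

Definition laplace mu (x : R) : R :=
  charge_integral mu half_line (fun xi => expR (- (x * xi))).

Definition is_maximum (A : set R) (M : R) : Prop := A M /\ ubound A M.

End HalfLine.

Section Semigroups.
Context (R : realType) (X : normedModType R[i]).

(* Only the values T t with t > 0 matter. *)
Implicit Type T : R -> {linear X -> X}.

Definition operator_semigroup T : Prop :=
  (forall t, 0 < t -> bounded_operator (T t)) /\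
  (forall s t, 0 < s -> 0 < t -> forall x, T (s + t) x = T s (T t x)).

Definition strongly_continuous T : Prop :=
  forall x, {within (@half_line R), continuous (fun t => T t x)}.

Definition quasinilpotent_semigroup T : Prop :=
  forall t, 0 < t -> quasinilpotent (T t).

Definition nontrivial_semigroup T : Prop :=
  exists t x, 0 < t /\ T t x <> 0.

(* The operator F(-sA), F being the Laplace transform of mu and A the
   generator of T. *)
Definition functional_calculus T (mu : {charge set (measurableTypeR R) -> \bar R})
    (s : R) : X -> X :=
  fun x => charge_bochner_integral mu (@half_line R) (fun xi => T (s * xi) x).

End Semigroups.

(* Main.v *)
Require Import Defs.
From HB Require Import structures.
From mathcomp Require Import all_boot all_order all_algebra.
From mathcomp Require Import all_classical all_reals all_analysis.
From mathcomp Require Import complex measurable_realfun ring lra.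

(** Let F be the Laplace transform of mu. It is entire, real on the real axis,
    vanishes at 0 and decays exponentially in the right half-plane, so |F| reaches
    its maximum M over [0, oo[ at some x0 > 0, and M > 0 because mu is determined by
    F ([laplace_max]). Suppose that the norm of F(-sA) is at most M for arbitrarily
    small s, and let x = T(t0)y be nonzero; its orbit is bounded and uniformly
    continuous on [0, oo[.

    Quasinilpotence makes all orbits decay faster than any exponential, so
    Y(z), the integral of exp(zt) T(st)x over t > 0, is an entire function of z: it is
    the resolvent of sA at -z, applied to x. Up to an error controlled by the size of
    the orbit of x, T(st) multiplies Y(z) by exp(-zt) ([resolvent_sum_eigen]), so
    F(-sA) multiplies it by F(z). Where |F(z)| > M, this bounds Y(z) by the size
    of the orbit divided by |F(z)| - M; in a left half-plane the integral converges
    absolutely ([resolvent_bound]). The bounds do not depend on s. Applied to an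
    increment T(s xi)x - x, whose orbit is small when s is small, they show that
    zY(z) + x tends to 0 with s ([almost_inverse]): the entire function Y(z) is
    uniformly close to -x / z at all these points z. If such points fill a closed
    curve around 0, comparing residues gives x = 0, a contradiction
    ([monodromy_bound]).

    The curve starts at x0 and is symmetric about the real axis. Near x0, the
    function F - F(x0) vanishes to a finite order n, and |F| exceeds M in some complex
    direction ([contact_direction]); there |F| - M is only comparable to |z - x0|^n,
    so all estimates are made for (z - x0)^n Y(z), whose would-be residue
    -(-x0)^n x is still nonzero. From there the set where |F| > M leads to the left
    half-plane. Otherwise one could climb for ever on |F|^2, which is subharmonic,
    within the right half-plane; there |F| > M bounds the real part, and a factor
    exp(eps z^2) keeps the imaginary part bounded too ([ascent_absurd]). In the left
    half-plane an arc of circle leads to the negative axis ([winding_path]). The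
    path is drawn in the coordinate l = log z, where winding around 0 is a
    difference of 2 pi i.

    Integrals are replaced by finite sums throughout. Those against mu are limits of
    Riemann sums with fixed nodes ([bochner_converges]), to which every estimate
    applies. Those over t > 0 become finite sums of exponentials in z, which have
    explicit primitives, so that the mean value inequality along a polygonal line
    does the work of a contour integral. *)

Set Implicit Arguments.
Unset Strict Implicit.
Unset Printing Implicit Defensive.

Import Order.TTheory GRing.Theory Num.Theory.
Import numFieldNormedType.Exports.

Local Open Scope classical_set_scope.
Local Open Scope ring_scope.

(** * Norms over the complex numbers *)

Notation cabs z := (@rnorm _ (_[i])^o z).

Section Norm.
Context (R : realType) (X : normedModType R[i]).
Implicit Types (x y : X) (c : R[i]).

Lemma normE x : `|x| = ((rnorm x)%:C)%C.
Proof.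
have := normr_ge0 x; rewrite /rnorm; case: `|x| => a b.
by rewrite lecE /= => /andP[/eqP -> _].
Qed.

Lemma rnorm_ge0 x : 0 <= rnorm x.
Proof. by rewrite -ler0c -normE normr_ge0. Qed.

Lemma rnorm0 : rnorm (0 : X) = 0.
Proof. by rewrite /rnorm normr0. Qed.

Lemma rnorm_eq0 x : rnorm x = 0 -> x = 0.
Proof. by move=> h; apply/eqP; rewrite -normr_eq0 normE h. Qed.

Lemma rnorm_gt0 x : x <> 0 -> 0 < rnorm x.
Proof.
move=> h; rewrite lt_neqAle rnorm_ge0 andbT eq_sym.
by apply/eqP => /rnorm_eq0.
Qed.

Lemma rnormD x y : rnorm (x + y) <= rnorm x + rnorm y.
Proof. by rewrite -lecR rmorphD /= -!normE ler_normD. Qed.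

Lemma rnormN x : rnorm (- x) = rnorm x.
Proof. by rewrite /rnorm normrN. Qed.

Lemma rnormB x y : rnorm (x - y) <= rnorm x + rnorm y.
Proof. by rewrite -(rnormN y) rnormD. Qed.

Lemma rnorm_distC x y : rnorm (x - y) = rnorm (y - x).
Proof. by rewrite -rnormN opprB. Qed.

Lemma rnormZ c x : rnorm (c *: x) = cabs c * rnorm x.
Proof.
by apply: complexI; rewrite rmorphM /= -!normE normrZ.
Qed.

Lemma rnorm_sum (I : Type) (r : seq I) (P : pred I) (F : I -> X) :
  rnorm (\sum_(i <- r | P i) F i) <= \sum_(i <- r | P i) rnorm (F i).
Proof.
elim/big_rec2: _ => [|i y2 y1 _ h]; first by rewrite rnorm0.
by rewrite (le_trans (rnormD _ _))// lerD2l.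
Qed.

Lemma le_rnormD x y a b : rnorm x <= a -> rnorm y <= b -> rnorm (x + y) <= a + b.
Proof. by move=> h1 h2; rewrite (le_trans (rnormD _ _))// lerD. Qed.

Lemma rnorm_lerB x y : rnorm x - rnorm y <= rnorm (x - y).
Proof.
by rewrite lerBlDr (le_trans _ (rnormD _ _))// subrK.
Qed.

End Norm.

Lemma le_rnormZ (R : realType) (X : normedModType R[i]) (c : R[i]) (x : X) a b :
  cabs c <= a -> rnorm x <= b -> rnorm (c *: x) <= a * b.
Proof. by move=> h1 h2; rewrite rnormZ ler_pM// rnorm_ge0. Qed.

Section Cabs.
Context (R : realType).
Implicit Types (z w : R[i]) (a b : R).

Lemma cabsM z w : cabs (z * w) = cabs z * cabs w.
Proof. exact: (@rnormZ R (R[i])^o z w). Qed.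

Lemma cabs_def z : cabs z = Num.sqrt (complex.Re z ^+ 2 + complex.Im z ^+ 2).
Proof. by rewrite /rnorm normc_def. Qed.

Lemma cabs_sqr z : cabs z ^+ 2 = complex.Re z ^+ 2 + complex.Im z ^+ 2.
Proof. by rewrite cabs_def sqr_sqrtr// addr_ge0// sqr_ge0. Qed.

Lemma cabsR a : cabs (a%:C)%C = `|a|.
Proof. by rewrite cabs_def /= expr0n addr0 sqrtr_sqr. Qed.

Lemma cabs1 : cabs (1 : R[i]) = 1.
Proof. by rewrite (_ : 1 = (1%:C)%C)// cabsR normr1. Qed.

Lemma cabsX z n : cabs (z ^+ n) = cabs z ^+ n.
Proof. by elim: n => [|n IH]; rewrite ?expr0 ?cabs1// !exprS cabsM IH. Qed.

Lemma cabs_Re z : `|complex.Re z| <= cabs z.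
Proof. by rewrite cabs_def -sqrtr_sqr ler_wsqrtr// lerDl sqr_ge0. Qed.

Lemma cabs_Im z : `|complex.Im z| <= cabs z.
Proof. by rewrite cabs_def -sqrtr_sqr ler_wsqrtr// lerDr sqr_ge0. Qed.

Lemma cabs_le z : cabs z <= `|complex.Re z| + `|complex.Im z|.
Proof.
case: z => a b.
have -> : (a +i* b)%C = (a%:C)%C + (b%:C)%C * 'i%C by simpc.
apply: (le_trans (rnormD _ _)); rewrite cabsM !cabsR /=.
have -> : cabs ('i%C : R[i]) = 1.
  by rewrite cabs_def /= expr0n expr1n add0r sqrtr1.
by rewrite mulr1 /=; rewrite !(mulr0, mulr1, addr0, add0r, mul0r, subr0).
Qed.

Lemma cabsV z : cabs z^-1 = (cabs z)^-1.
Proof.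
have [->|z0] := eqVneq z 0; first by rewrite invr0 (@rnorm0 R (R[i])^o) invr0.
have cz : cabs z != 0 by apply/eqP => /(@rnorm_eq0 R (R[i])^o); apply/eqP.
by apply: (mulIf cz); rewrite -cabsM !mulVf// cabs1.
Qed.

Lemma cabsJ z : cabs (z^*)%C = cabs z.
Proof. by rewrite /rnorm normcJ. Qed.

Lemma cabs_gt0 z : z != 0 -> 0 < cabs z.
Proof. by move/eqP; exact: (@rnorm_gt0 R (R[i])^o). Qed.

End Cabs.

(** Linear identities between vectors are decided by comparing, atom by atom,
    the scalar coefficients of the two sides. *)
Section LinearIdentities.
Context (K : comNzRingType) (V : lmodType K).

Inductive lin_expr :=
| LAtom of nat
| LZero
| LAdd of lin_expr & lin_expr
| LOpp of lin_expr
| LScale of K & lin_expr.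

Fixpoint lin_eval (vs : seq V) (e : lin_expr) : V :=
  match e with
  | LAtom i => vs`_i
  | LZero => 0
  | LAdd e1 e2 => lin_eval vs e1 + lin_eval vs e2
  | LOpp e1 => - lin_eval vs e1
  | LScale c e1 => c *: lin_eval vs e1
  end.

Fixpoint lin_coef (i : nat) (e : lin_expr) : K :=
  match e with
  | LAtom j => if j == i then 1 else 0
  | LZero => 0
  | LAdd e1 e2 => lin_coef i e1 + lin_coef i e2
  | LOpp e1 => - lin_coef i e1
  | LScale c e1 => c * lin_coef i e1
  end.

Lemma lin_evalE vs e :
  lin_eval vs e = \sum_(i < size vs) lin_coef i e *: vs`_i.
Proof.
elim: e => [j||e1 IH1 e2 IH2|e IH|c e IH] /=.
- have [jn|nj] := ltnP j (size vs).
    rewrite (bigD1 (Ordinal jn))//= eqxx scale1r big1 ?addr0// => i ij.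
    case: eqVneq => [ji|]; last by rewrite scale0r.
    by move: ij; rewrite -val_eqE /= ji eqxx.
  rewrite nth_default// big1// => i _; rewrite gtn_eqF ?scale0r//.
  exact: leq_trans (ltn_ord i) nj.
- by rewrite big1// => i _; rewrite scale0r.
- by rewrite IH1 IH2 -big_split; apply: eq_bigr => i _; rewrite scalerDl.
- by rewrite IH -sumrN; apply: eq_bigr => i _; rewrite scaleNr.
- by rewrite IH scaler_sumr; apply: eq_bigr => i _; rewrite scalerA.
Qed.

Fixpoint lin_same (n : nat) (e1 e2 : lin_expr) : Prop :=
  if n is m.+1 then lin_coef m e1 = lin_coef m e2 /\ lin_same m e1 e2 else True.

Lemma lin_eval_eq vs e1 e2 :
  lin_same (size vs) e1 e2 -> lin_eval vs e1 = lin_eval vs e2.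
Proof.
move=> h; rewrite !lin_evalE; apply: eq_bigr => i _; congr (_ *: _).
elim: (size vs) h i => [_ []//|n IH [hn hs] i].
case: (ltngtP i n) => [ilt|igt|->//]; first exact: IH hs (Ordinal ilt).
by have := ltn_ord i; rewrite ltnS leqNgt igt.
Qed.

End LinearIdentities.

Ltac lin_index vs t :=
  lazymatch vs with
  | t :: _ => constr:(0%N)
  | _ :: ?r => let n := lin_index r t in constr:(S n)
  end.

Ltac lin_reify K vs t :=
  lazymatch t with
  | (?a + ?b)%R => let u := lin_reify K vs a in let v := lin_reify K vs b in
     constr:(LAdd u v)
  | (- ?a)%R => let u := lin_reify K vs a in constr:(LOpp u)
  | (?c *: ?a)%R => let u := lin_reify K vs a in constr:(@LScale K c u)
  | 0%R => constr:(@LZero K)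
  | _ => let n := lin_index vs t in constr:(@LAtom K n)
  end.

(** [lin_eq [:: v1; ...; vn]] proves an identity between linear combinations
    of the vectors [vi] of a complex vector space. *)
Ltac lin_eq vs :=
  match goal with
  | R : realType |- @eq _ ?a ?b =>
    let K := constr:((complex R : comNzRingType)) in
    let u := lin_reify K vs a in
    let v := lin_reify K vs b in
    apply: (@lin_eval_eq K _ vs u v);
    rewrite /=; do !split; rewrite /=; ring
  end.

(** * Differentiable functions of a complex variable *)

Section HasDeriv.
Context (R : realType).
Local Notation C := R[i].

(** The remainder is required to be quadratic, uniformly on every ball, which for
    entire functions costs nothing: sums, products and compositions then follow
    by plain estimates, and so does the mean value inequality, on any normed
    space of values. *)
Definition has_deriv (E : normedModType C) (f f1 : C -> E) :=
  forall r : R, exists2 K : R, 0 <= K & forall a b : C, cabs a <= r -> cabs b <= r ->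
    rnorm (f1 a) <= K /\
    rnorm (f b - f a - (b - a) *: f1 a) <= K * cabs (b - a) ^+ 2.

Lemma has_deriv_bound (E : normedModType C) (f f1 : C -> E) (r : R) :
  has_deriv f f1 ->
  exists2 K : R, 0 <= K & forall a b : C, cabs a <= r -> cabs b <= r ->
    [/\ rnorm (f1 a) <= K, rnorm (f a) <= K,
        rnorm (f b - f a) <= K * cabs (b - a) &
        rnorm (f b - f a - (b - a) *: f1 a) <= K * cabs (b - a) ^+ 2].
Proof.
move=> /(_ `|r|)[K K0 h].
have r0 : 0 <= `|r| by [].
pose L := K * (1 + 2 * `|r|).
have L0 : 0 <= L by rewrite mulr_ge0// addr_ge0// mulr_ge0.
have KL : K <= L by rewrite ler_peMr// lerDl mulr_ge0.
have lip a b : cabs a <= `|r| -> cabs b <= `|r| ->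
    rnorm (f b - f a) <= L * cabs (b - a).
  move=> ha hb; have [h1 h2] := h a b ha hb.
  rewrite -(subrK ((b - a) *: f1 a) (f b - f a)).
  rewrite (le_trans (rnormD _ _))// rnormZ /L mulrDr mulr1 mulrDl addrC lerD//.
    by rewrite mulrC ler_wpM2r// rnorm_ge0.
  apply: (le_trans h2); rewrite expr2 mulrA ler_wpM2r ?rnorm_ge0//.
  rewrite ler_wpM2l// (le_trans (rnormB _ _))//.
  by rewrite mulr2n mulrDl mul1r lerD.
exists (rnorm (f 0) + L * (1 + `|r|)) => [|a b ha hb].
  by rewrite addr_ge0 ?rnorm_ge0// mulr_ge0// addr_ge0.
have ha' : cabs a <= `|r| by rewrite (le_trans ha)// ler_norm.
have hb' : cabs b <= `|r| by rewrite (le_trans hb)// ler_norm.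
have [h1 h2] := h a b ha' hb'.
set M := (X in [/\ _ <= X, _, _ & _]).
have LM : L <= M.
  by rewrite /M mulrDr mulr1 addrCA lerDl addr_ge0 ?rnorm_ge0// mulr_ge0.
split.
- by rewrite (le_trans h1)// (le_trans KL).
- rewrite -(subrK (f 0) (f a)) addrC (le_trans (rnormD _ _))// /M lerD2l.
  have c0 : cabs (0 : C) <= `|r| by rewrite rnorm0.
  rewrite (le_trans (lip 0 a c0 ha'))// ler_wpM2l// subr0.
  by rewrite (le_trans ha')// lerDr.
- by rewrite (le_trans (lip a b _ _))// ler_wpM2r// rnorm_ge0.
- by rewrite (le_trans h2)// ler_wpM2r ?exprn_ge0 ?rnorm_ge0// (le_trans KL).
Qed.

Lemma has_deriv_eq (E : normedModType C) (f f1 g g1 : C -> E) :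
  f =1 g -> f1 =1 g1 -> has_deriv f f1 -> has_deriv g g1.
Proof. by move=> /funext -> /funext ->. Qed.

Lemma has_deriv_cst (E : normedModType C) (c : E) :
  has_deriv (fun=> c) (fun=> 0).
Proof.
move=> r; exists 0 => // a b _ _.
by rewrite rnorm0 scaler0 subr0 subrr rnorm0 mul0r.
Qed.

Lemma has_deriv_id : has_deriv (E := C^o) (fun z => z) (fun=> 1).
Proof.
move=> r; exists 1 => // a b _ _; split; first by rewrite cabs1.
rewrite (_ : b - a - (b - a) *: _ = 0) ?rnorm0 ?mul1r ?exprn_ge0 ?rnorm_ge0//.
by rewrite -[_ *: _]/((b - a) * 1) mulr1 subrr.
Qed.

Lemma has_derivD (E : normedModType C) (f f1 g g1 : C -> E) :
  has_deriv f f1 -> has_deriv g g1 ->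
  has_deriv (fun z => f z + g z) (fun z => f1 z + g1 z).
Proof.
move=> hf hg r; have [K K0 h] := hf r; have [L L0 k] := hg r.
exists (K + L) => [|a b ha hb]; first exact: addr_ge0.
have [h1 h2] := h a b ha hb; have [k1 k2] := k a b ha hb.
split; first exact: le_rnormD.
rewrite mulrDl scalerDr !opprD.
have -> : f b + g b + (- f a - g a) + (- ((b - a) *: f1 a) - (b - a) *: g1 a) =
  (f b - f a - (b - a) *: f1 a) + (g b - g a - (b - a) *: g1 a).
  lin_eq [:: f a; f b; g a; g b; f1 a; g1 a].
exact: le_rnormD.
Qed.

Lemma has_derivZ (E : normedModType C) (f f1 : C -> C) (g g1 : C -> E) :
  has_deriv (E := C^o) f f1 -> has_deriv g g1 ->
  has_deriv (fun z => f z *: g z) (fun z => f1 z *: g z + f z *: g1 z).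
Proof.
move=> hf hg r.
have [K K0 h] := has_deriv_bound r hf; have [L L0 k] := has_deriv_bound r hg.
exists (K * L + K * L + K * L) => [|a b ha hb].
  by rewrite !addr_ge0// mulr_ge0.
have [h1 h2 h3 h4] := h a b ha hb; have [k1 k2 k3 k4] := k a b ha hb.
split.
  apply: (@le_trans _ _ (K * L + K * L)); last by rewrite lerDl mulr_ge0.
  by apply: le_rnormD; apply: le_rnormZ.
have -> : f b *: g b - f a *: g a - (b - a) *: (f1 a *: g a + f a *: g1 a) =
  (f b - f a - (b - a) *: (f1 a : C^o)) *: g a + f a *: (g b - g a - (b - a) *: g1 a)
  + (f b - f a) *: (g b - g a).
  rewrite -[_ *: (f1 a : C^o)]/((b - a) * f1 a).
  lin_eq [:: g a; g b; g1 a].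
rewrite !mulrDl; apply: le_rnormD; first apply: le_rnormD.
- by rewrite mulrAC; exact: le_rnormZ.
- by rewrite -mulrA; exact: le_rnormZ.
- by rewrite expr2 mulrACA; exact: le_rnormZ.
Qed.

Lemma has_deriv_comp (E : normedModType C) (f f1 : C -> E) (g g1 : C -> C) :
  has_deriv f f1 -> has_deriv (E := C^o) g g1 ->
  has_deriv (fun z => f (g z)) (fun z => g1 z *: f1 (g z)).
Proof.
move=> hf hg r.
have [L L0 k] := has_deriv_bound r hg; have [K K0 h] := has_deriv_bound L hf.
exists (L * K + (K * L ^+ 2 + L * K)) => [|a b ha hb].
  by rewrite !addr_ge0 ?mulr_ge0// exprn_ge0.
have [k1 k2 k3 k4] := k a b ha hb.
have [_ k5 _ _] := k b a hb ha.
have [h1 h2 h3 h4] := h (g a) (g b) k2 k5.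
split.
  apply: (@le_trans _ _ (L * K)); first exact: le_rnormZ.
  by rewrite lerDl addr_ge0 ?mulr_ge0// exprn_ge0.
have -> : f (g b) - f (g a) - (b - a) *: (g1 a *: f1 (g a)) =
  (f (g b) - f (g a) - (g b - g a) *: f1 (g a)) +
  (g b - g a - (b - a) *: (g1 a : C^o)) *: f1 (g a).
  rewrite -[_ *: (g1 a : C^o)]/((b - a) * g1 a).
  lin_eq [:: f (g a); f (g b); f1 (g a)].
apply: (@le_trans _ _ ((K * L ^+ 2 + L * K) * cabs (b - a) ^+ 2)); last first.
  by rewrite ler_wpM2r ?exprn_ge0 ?rnorm_ge0// lerDr mulr_ge0.
rewrite mulrDl; apply: le_rnormD.
  apply: (le_trans h4); rewrite -mulrA -exprMn ler_wpM2l//.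
  by rewrite lerXn2r// nnegrE ?mulr_ge0 ?rnorm_ge0.
by rewrite mulrAC; exact: le_rnormZ.
Qed.

Lemma has_deriv_sum (E : normedModType C) (I : Type) (s : seq I)
    (f f1 : I -> C -> E) :
  (forall i, has_deriv (f i) (f1 i)) ->
  has_deriv (fun z => \sum_(i <- s) f i z) (fun z => \sum_(i <- s) f1 i z).
Proof.
move=> h; elim: s => [|i s IH].
  apply: has_deriv_eq (has_deriv_cst (0 : E)) => z /=; by rewrite big_nil.
apply: has_deriv_eq (has_derivD (h i) IH) => z /=; by rewrite big_cons.
Qed.

Lemma has_deriv_scale (E : normedModType C) (f f1 : C -> C) (v : E) :
  has_deriv (E := C^o) f f1 -> has_deriv (fun z => f z *: v) (fun z => f1 z *: v).
Proof.
move=> h; apply: has_deriv_eq (has_derivZ h (has_deriv_cst v)) => z //=.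
by rewrite scaler0 addr0.
Qed.

Lemma has_derivM (f f1 g g1 : C -> C) :
  has_deriv (E := C^o) f f1 -> has_deriv (E := C^o) g g1 ->
  has_deriv (E := C^o) (fun z => f z * g z) (fun z => f1 z * g z + f z * g1 z).
Proof. by move=> hf hg; exact: (has_derivZ hf hg). Qed.

Lemma has_derivX (f f1 : C -> C) n :
  has_deriv (E := C^o) f f1 ->
  has_deriv (E := C^o) (fun z => f z ^+ n) (fun z => n%:R * f z ^+ n.-1 * f1 z).
Proof.
move=> hf; elim: n => [|n IH].
  apply: has_deriv_eq (has_deriv_cst (1 : C^o)) => z /=; first by rewrite expr0.
  by rewrite !mul0r.
apply: has_deriv_eq (has_derivM hf IH) => z /=; first by rewrite exprS.
case: n {IH} => [|n] /=; first by rewrite !expr0; ring.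
by rewrite exprS -(addn1 n.+1) natrD; ring.
Qed.

Lemma le_cabs_segment (p q : C) (t : R) : 0 <= t <= 1 ->
  cabs (p + (t%:C)%C * (q - p)) <= cabs p + cabs q.
Proof.
move=> /andP[t0 t1].
have -> : p + (t%:C)%C * (q - p) = ((1 - t)%:C)%C * p + (t%:C)%C * q.
  by rewrite rmorphB /= rmorph1; ring.
rewrite (le_trans (rnormD _ _))// !cabsM !cabsR !ger0_norm ?subr_ge0// lerD//.
  by rewrite ler_piMl ?rnorm_ge0// lerBlDr lerDl.
by rewrite ler_piMl ?rnorm_ge0.
Qed.

(** Cutting the segment into N equal pieces leaves quadratic remainders of total
    size O(1/N); no integral is needed. *)
Lemma has_deriv_mvt (E : normedModType C) (f f1 : C -> E) (p q : C) (e : R) :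
  has_deriv f f1 ->
  (forall t : R, 0 <= t <= 1 -> rnorm (f1 (p + (t%:C)%C * (q - p))) <= e) ->
  rnorm (f q - f p) <= e * cabs (q - p).
Proof.
move=> hf he.
have [K K0 h] := hf (cabs p + cabs q).
set d := cabs (q - p).
apply/ler_addgt0Pr => eps eps0.
pose N := (Num.truncn (K * d ^+ 2 / eps)).+1.
have N0 : 0 < N%:R :> R by rewrite ltr0n.
have Nbig : K * d ^+ 2 / eps < N%:R by exact: truncnS_gt.
pose tt i : R := i%:R / N%:R.
pose z i := p + ((tt i)%:C)%C * (q - p).
have zN : z N = q by rewrite /z /tt divff ?gt_eqF// rmorph1 mul1r addrC subrK.
have z0 : z 0%N = p by rewrite /z /tt mul0r rmorph0 mul0r addr0.
have tt01 i : (i <= N)%N -> 0 <= tt i <= 1.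
  move=> iN; rewrite /tt divr_ge0//= ler_pdivrMr// mul1r ler_nat//.
have dz i : z i.+1 - z i = ((N%:R^-1)%:C)%C * (q - p).
  rewrite /z opprD addrACA subrr add0r -mulrBl -rmorphB /tt -mulrBl.
  by rewrite -natrB// subSnn mul1r.
have cdz i : cabs (z i.+1 - z i) = d / N%:R.
  by rewrite dz cabsM cabsR ger0_norm ?invr_ge0// mulrC.
have -> : f q - f p = \sum_(i < N) (f (z i.+1) - f (z i)).
  by rewrite -{1}zN -{1}z0 -(big_mkord xpredT (fun i => f (z i.+1) - f (z i)))
    telescope_sumr.
apply: (le_trans (rnorm_sum _ _ _)).
apply: (@le_trans _ _ (\sum_(i < N) (e * d / N%:R + eps / N%:R))); last first.
  by rewrite sumr_const card_ord -mulrDl -[leLHS]mulr_natr divfK// gt_eqF.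
apply: ler_sum => i _.
have ci j : (j <= N)%N -> cabs (z j) <= cabs p + cabs q.
  by move=> jN; apply: le_cabs_segment; exact: tt01.
have [_ h2] := h (z i) (z i.+1) (ci _ (ltnW (ltn_ord i))) (ci _ (ltn_ord i)).
rewrite -(subrK ((z i.+1 - z i) *: f1 (z i)) (f (z i.+1) - f (z i))) addrC.
apply: le_rnormD.
  rewrite rnormZ cdz mulrC mulrA ler_wpM2r ?invr_ge0// ?ler_wpM2r ?rnorm_ge0//.
  by apply: he; apply: tt01; exact: ltnW.
apply: (le_trans h2); rewrite cdz expr_div_n expr2 -[N%:R ^+ 2]/(N%:R * N%:R).
rewrite invfM !mulrA ler_wpM2r ?invr_ge0// ler_pdivrMr//.
by move: Nbig; rewrite ltr_pdivrMr// => /ltW; rewrite expr2 mulrA [eps * _]mulrC.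
Qed.


(** The Taylor remainder, as a function of the expansion point b, has as derivative
    the remainder of f' at one order less, so induction on the order and the
    mean value inequality on the segment from a to b give the bound. *)
Lemma taylor (E : normedModType C) (fs : nat -> C -> E) :
  forall n, (forall j, (j <= n)%N -> has_deriv (fs j) (fs j.+1)) ->
  forall r : R, exists2 K : R, 0 <= K & forall a b : C, cabs a <= r -> cabs b <= r ->
    rnorm (fs 0%N b - \sum_(j < n.+1) ((b - a) ^+ j / j`!%:R) *: fs j a)
      <= K * cabs (b - a) ^+ n.+1.
Proof.
move=> n; elim: n fs => [|n IH] fs hfs r.
  have [K K0 h] := has_deriv_bound r (hfs 0%N isT).
  exists K => // a b ha hb; have [_ _ h3 _] := h a b ha hb.
  by rewrite big_ord1 expr0 fact0 divr1 scale1r expr1.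
have [K K0 h] := IH (fun j => fs j.+1) (fun j => hfs j.+1) (`|r| + `|r|).
exists K => // a b ha hb.
have ar : cabs a <= `|r| by rewrite (le_trans ha)// ler_norm.
have br : cabs b <= `|r| by rewrite (le_trans hb)// ler_norm.
pose g z := fs 0%N z - \sum_(j < n.+2) ((z - a) ^+ j / j`!%:R) *: fs j a.
pose g1 z := fs 1%N z - \sum_(j < n.+1) ((z - a) ^+ j / j`!%:R) *: fs j.+1 a.
have hza : has_deriv (E := C^o) (fun z => z - a) (fun=> 1).
  by apply: has_deriv_eq (has_derivD has_deriv_id (has_deriv_cst (- a : C^o))) => z /=;
     rewrite ?addr0.
have hg : has_deriv g g1.
  pose dj (j : 'I_n.+2) z := ((j%:R * (z - a) ^+ j.-1 * 1) * (j`!%:R)^-1) *: fs j a.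
  have hs : has_deriv (fun z => \sum_(j < n.+2) ((z - a) ^+ j / j`!%:R) *: fs j a)
     (fun z => \sum_(j < n.+2) dj j z).
    apply: has_deriv_sum => j; apply: has_deriv_scale.
    apply: has_deriv_eq (has_derivM (has_derivX j hza)
      (has_deriv_cst ((j`!%:R)^-1 : C^o))) => z //=.
    by rewrite mulr0 addr0.
  have := has_derivZ (has_deriv_cst (-1 : C^o)) hs.
  move=> /(has_derivD (hfs 0%N isT)); apply: has_deriv_eq => z.
    by rewrite /g scaleN1r.
  rewrite /g1 scale0r add0r scaleN1r; congr (_ - _).
  rewrite big_ord_recl /dj /= !mul0r scale0r add0r; apply: eq_bigr => j _.
  congr (_ *: _); rewrite /bump /= add1n mulr1 factS natrM invfM.
  by rewrite mulrACA divff ?mul1r// pnatr_eq0.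
have ga : g a = 0.
  rewrite /g big_ord_recl big1 => [|j _].
    by rewrite expr0 fact0 divr1 scale1r addr0 subrr.
  by rewrite subrr expr0n /= mul0r scale0r.
rewrite -/(g b) -[g b]subr0 -{1}ga.
rewrite exprSr mulrA.
apply: has_deriv_mvt hg _ => t t01.
have ht : cabs (a + (t%:C)%C * (b - a)) <= `|r| + `|r|.
  by rewrite (le_trans (le_cabs_segment _ _ t01))// lerD.
have ha2 : cabs a <= `|r| + `|r| by rewrite (le_trans ar)// lerDr.
apply: (le_trans (h _ _ ha2 ht)).
rewrite ler_wpM2l// addrAC subrr add0r lerXn2r// ?nnegrE ?rnorm_ge0//.
move: t01 => /andP[t0 t1].
by rewrite cabsM cabsR ger0_norm// ler_piMl// rnorm_ge0.
Qed.

End HasDeriv.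

(** * The complex exponential *)

Section RealBounds.
Context (R : realType).
Implicit Types a b : R.

Lemma expR_ge1 a : 0 <= a -> 1 <= expR a.
Proof. by move=> a0; rewrite (le_trans _ (expR_ge1Dx a))// lerDl. Qed.

Lemma expR_sub1_le a : `|expR a - 1| <= `|a| * expR `|a|.
Proof.
have [a0|a0] := leP 0 a.
  rewrite !ger0_norm// ?subr_ge0 ?expR_ge1//.
  have := expR_ge1Dx (- a); rewrite expRN => h.
  have ha := expR_gt0 a.
  have : (1 - a) * expR a <= 1.
    by rewrite -ler_pdivlMr// mul1r.
  lra.
have e1 : expR a <= 1 by rewrite -expR0 ler_expR ltW.
rewrite ler0_norm ?subr_le0// (ler0_norm (ltW a0))//.
have h := expR_ge1Dx a.
apply: (@le_trans _ _ (- a)); first by lra.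
by rewrite ler_peMr ?expR_ge1 ?oppr_ge0 ?(ltW a0).
Qed.

Lemma expR_sub1D_le a : `|expR a - 1 - a| <= `|a| ^+ 2 * expR `|a|.
Proof.
have h1 : 0 <= expR a - 1 - a by have := expR_ge1Dx a; lra.
rewrite ger0_norm//.
have h : expR a - 1 - a <= a * (expR a - 1).
  have := expR_ge1Dx (- a); rewrite expRN => h.
  have : (1 - a) * expR a <= 1.
    by rewrite -ler_pdivlMr ?expR_gt0// mul1r.
  lra.
apply: (le_trans h); apply: (le_trans (ler_norm _)).
by rewrite normrM expr2 -mulrA ler_wpM2l// expR_sub1_le.
Qed.

Lemma sin_norm_le b : `|sin b| <= `|b|.
Proof.
wlog b0 : b / 0 <= b => [hw|].
  have [|/ltW b0] := leP 0 b; first exact: hw.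
  by rewrite -normrN -sinN -[leRHS]normrN; apply: hw; rewrite oppr_ge0.
have [c _ h] := @MVT_segment R (@sin R) (@cos R) 0 b b0
  (fun x _ => is_derive_sin x) (continuous_subspaceT (@continuous_sin R)).
move: h; rewrite sin0 !subr0 => ->.
by rewrite normrM ler_piMl// cos_max.
Qed.

Lemma cos_sub1_le b : `|cos b - 1| <= `|b| ^+ 2.
Proof.
wlog b0 : b / 0 <= b => [hw|].
  have [|/ltW b0] := leP 0 b; first exact: hw.
  by rewrite -cosN -[`|b|]normrN; apply: hw; rewrite oppr_ge0.
have [c c0b h] := @MVT_segment R (@cos R) (fun x => - sin x) 0 b b0
  (fun x _ => is_derive_cos x) (continuous_subspaceT (@continuous_cos R)).
move: h; rewrite cos0 !subr0 => ->.
rewrite normrM normrN expr2 ler_wpM2r// (le_trans (sin_norm_le _))//.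
by move: c0b; rewrite in_itv /= => /andP[h1 h2]; rewrite !ger0_norm.
Qed.

Lemma sin_sub_le b : `|b| <= 1 -> `|sin b - b| <= `|b| ^+ 2.
Proof.
wlog b0 : b / 0 <= b => [hw|].
  have [|/ltW b0] := leP 0 b; first exact: hw.
  move=> b1; rewrite -normrN opprD -sinN -[`|b|]normrN; apply: hw.
    by rewrite oppr_ge0.
  by rewrite normrN.
move=> b1.
have [c c0b h] := @MVT_segment R (@sin R) (@cos R) 0 b b0
  (fun x _ => is_derive_sin x) (continuous_subspaceT (@continuous_sin R)).
move: h; rewrite sin0 !subr0 => ->.
rewrite -{2}[b]mul1r -mulrBl normrM expr2 ler_wpM2r//.
move: c0b; rewrite in_itv /= => /andP[h1 h2].
rewrite (le_trans (cos_sub1_le _))// !ger0_norm// expr2.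
rewrite ger0_norm// in b1.
by rewrite (le_trans _ h2)// ler_piMl// (le_trans h2).
Qed.

End RealBounds.

Section Cexp.
Context (R : realType).
Local Notation C := R[i].
Implicit Types z w : C.

Definition cexp z : C :=
  (expR (complex.Re z) * cos (complex.Im z) +i*
   (expR (complex.Re z) * sin (complex.Im z)))%C.

Lemma cexpD z w : cexp (z + w) = cexp z * cexp w.
Proof.
case: z w => a b [c d]; rewrite /cexp /= expRD cosD sinD.
by apply/eqP; rewrite eq_complex /=; apply/andP; split; apply/eqP; ring.
Qed.

Lemma cexp0 : cexp 0 = 1.
Proof. by rewrite /cexp /= expR0 cos0 sin0 mulr0 mulr1. Qed.

Lemma cexpR (a : R) : cexp (a%:C)%C = ((expR a)%:C)%C.
Proof. by rewrite /cexp /= cos0 sin0 mulr0 mulr1. Qed.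

Lemma cabs_cexp z : cabs (cexp z) = expR (complex.Re z).
Proof.
rewrite cabs_def /cexp /= !exprMn -mulrDr cos2Dsin2 mulr1 sqrtr_sqr.
by rewrite ger0_norm ?expR_ge0.
Qed.

Lemma cexp_neq0 z : cexp z != 0.
Proof.
apply/eqP => h; have := cabs_cexp z; rewrite h rnorm0 => /eqP.
by rewrite eq_sym gt_eqF ?expR_gt0.
Qed.

Lemma cexp_nat n z : cexp (n%:R * z) = cexp z ^+ n.
Proof.
elim: n => [|n IH]; first by rewrite mul0r cexp0 expr0.
by rewrite -addn1 natrD mulrDl mul1r cexpD IH addn1 exprSr.
Qed.

Lemma cexp_conj z : cexp (z^*)%C = ((cexp z)^*)%C.
Proof. by case: z => a b; rewrite /cexp /= cosN sinN mulrN. Qed.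

(** The real and imaginary parts are estimated separately, from the real
    inequalities for exp, sin and cos. *)
Lemma cexp_taylor1 z : cabs z <= 1 -> cabs (cexp z - 1 - z) <= 4 * expR 1 * cabs z ^+ 2.
Proof.
move=> z1.
have a1 := le_trans (cabs_Re z) z1; have b1 := le_trans (cabs_Im z) z1.
have ar := cabs_Re z; have br := cabs_Im z.
move: z1 a1 b1 ar br; case: z => a b /=; set d := cabs _.
move=> z1 a1 b1 ar br.
have e3 : expR `|a| <= expR 1 by rewrite ler_expR.
have e1 : 1 <= expR 1 :> R by exact: expR_ge1.
set e : R := expR 1 in e3 e1 *.
apply: (le_trans (cabs_le _)) => /=.
have a2 : `|a| ^+ 2 <= d ^+ 2 by rewrite lerXn2r// nnegrE// (le_trans _ ar).
have b2 : `|b| ^+ 2 <= d ^+ 2 by rewrite lerXn2r// nnegrE// (le_trans _ br).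
have ab : `|a| * `|b| <= d ^+ 2 by rewrite expr2 ler_pM.
have E1 : `|expR a * cos b - 1 - a| <= `|a| ^+ 2 * e + e * `|b| ^+ 2.
  have -> : expR a * cos b - 1 - a = (expR a - 1 - a) + expR a * (cos b - 1).
    by ring.
  apply: (le_trans (ler_normD _ _)); apply: lerD.
    by rewrite (le_trans (expR_sub1D_le _))// ler_wpM2l.
  rewrite normrM ler_pM// ?cos_sub1_le// ger0_norm ?expR_ge0//.
  by rewrite (le_trans _ e3)// ler_expR ler_norm.
have E2 : `|expR a * sin b - b| <= `|a| * e * `|b| + `|b| ^+ 2.
  have -> : expR a * sin b - b = (expR a - 1) * sin b + (sin b - b) by ring.
  apply: (le_trans (ler_normD _ _)); apply: lerD; last exact: sin_sub_le.
  rewrite normrM ler_pM// ?sin_norm_le//.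
  by rewrite (le_trans (expR_sub1_le _))// ler_wpM2l.
rewrite !subr0.
apply: (le_trans (lerD E1 E2)).
have d0 : 0 <= d ^+ 2 by exact: exprn_ge0 (rnorm_ge0 _).
have e0 : 0 <= e by lra.
have := ler_wpM2l e0 a2; have := ler_wpM2l e0 b2; have := ler_wpM2l e0 ab.
have := ler_wpM2l d0 e1; lra.
Qed.

Lemma cabs_cexp_le z r : cabs z <= r -> cabs (cexp z) <= expR r.
Proof.
move=> h; rewrite cabs_cexp ler_expR (le_trans _ h)//.
by rewrite (le_trans (ler_norm _))// cabs_Re.
Qed.

Lemma has_deriv_cexp : has_deriv (E := C^o) cexp cexp.
Proof.
move=> r.
pose K := expR r * (4 * expR 1 + (expR (`|r| + `|r|) + 1 + (`|r| + `|r|))).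
exists K => [|a b ha hb].
  by rewrite mulr_ge0 ?expR_ge0// !addr_ge0// expR_ge0.
have ea : cabs (cexp a) <= expR r by exact: cabs_cexp_le.
have e0 := expR_gt0 r.
split.
  rewrite (le_trans ea)// /K ler_peMr ?expR_ge0//.
  have := expR_ge0 (`|r| + `|r|); have := normr_ge0 r; have := expR_ge0 (1 : R); lra.
have -> : cexp b - cexp a - (b - a) *: (cexp a : C^o) =
   cexp a * (cexp (b - a) - 1 - (b - a)).
  have E : cexp b = cexp (b - a) * cexp a by rewrite -cexpD subrK.
  rewrite -[_ *: (_ : C^o)]/((b - a) * cexp a) E.
  set u := cexp (b - a); set v := cexp a.
  by rewrite -[LHS]/((u * v - v - (b - a) * v : C)); ring.
rewrite cabsM /K -mulrA; apply: ler_pM => //; rewrite ?rnorm_ge0//.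
have d2 : 0 <= cabs (b - a) ^+ 2 by rewrite exprn_ge0 ?rnorm_ge0.
have [d1|d1] := leP (cabs (b - a)) 1.
  apply: (le_trans (cexp_taylor1 d1)); rewrite ler_wpM2r// lerDl.
  by rewrite !addr_ge0// expR_ge0.
have dr : cabs (b - a) <= `|r| + `|r|.
  apply: (le_trans (rnormB _ _)); apply: lerD.
    by rewrite (le_trans hb)// ler_norm.
  by rewrite (le_trans ha)// ler_norm.
apply: (@le_trans _ _ (expR (`|r| + `|r|) + 1 + (`|r| + `|r|))).
  apply: (le_trans (rnormB _ _)); rewrite lerD//.
  by rewrite (le_trans (rnormB _ _))// cabs1 lerD// cabs_cexp_le.
have s0 : 0 <= expR (`|r| + `|r|) + 1 + (`|r| + `|r|).
  by rewrite !addr_ge0// expR_ge0.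
rewrite (@le_trans _ _ (4 * expR 1 + (expR (`|r| + `|r|) + 1 + (`|r| + `|r|))))//.
  by rewrite lerDr.
by rewrite ler_peMr ?addr_ge0// exprn_ege1// ltW.
Qed.

End Cexp.

(** * A measure with compact support lives on an interval *)

Section Cousin.
Context (R : realType).

(** A relation between the ends of an interval that is transitive and holds for
    all small intervals holds for [a, b]: the supremum of the reachable right ends
    is b. It stands for compactness of [a, b]. *)
Lemma interval_induction (a b : R) (P : R -> R -> Prop) : a <= b ->
  (forall u v w, a <= u -> u <= v -> v <= w -> w <= b -> P u v -> P v w -> P u w) ->
  (forall x, a <= x -> x <= b -> exists2 d : R, 0 < d &
     forall u v, a <= u -> u <= v -> v <= b -> x - d < u -> v < x + d -> P u v) ->
  P a b.
Proof.
move=> ab trP locP.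
pose S := [set c | a <= c <= b /\ P a c].
have Sa : S a.
  have [d d0 hd] := locP a (lexx a) ab.
  by split; [rewrite lexx|apply: hd; rewrite ?gtrBl ?ltrDl].
have hS : has_sup S by split; [exists a|exists b => x [] /andP[]].
have ac : a <= sup S by exact: sup_upper_bound.
have cb : sup S <= b by apply: ge_sup; [exists a|move=> x [] /andP[]].
have [d d0 hd] := locP _ ac cb.
have [c [/andP[ac' c'b] Pc] cc] := @sup_adherent _ S d d0 hS.
have Sc : S c by split=> //; rewrite ac' c'b.
have c'c : c <= sup S by exact: sup_upper_bound hS _ Sc.
pose e := Num.min (sup S + d / 2) b.
have ce : c <= e.
  by rewrite le_min c'b andbT (le_trans c'c)// lerDl divr_ge0// ltW.
have eb : e <= b by rewrite ge_min lexx orbT.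
have Pe : P a e.
  apply: (trP a c e) => //.
  apply: hd => //; rewrite gt_min ltrD2l; apply/orP; left.
  by rewrite ltr_pdivrMr// ltr_pMr// ltr1n.
have Se : S e by split=> //; rewrite eb (le_trans ac').
have := sup_upper_bound hS Se; rewrite ge_min => /orP[h|h].
  by exfalso; move: h; rewrite gerDl leNgt divr_gt0.
suff E : e = b by move: Pe; rewrite E.
by apply/eqP; rewrite eq_le eb /= le_min lexx andbT (le_trans h)// lerDl divr_ge0// ltW.
Qed.

End Cousin.

(** Countably many bounded intervals cover the complement of [a, b[. *)
Lemma null_off_itv (R : realType) (nu : {measure set (measurableTypeR R) -> \bar R})
    (a b : R) :
  (forall n, nu `[a - n%:R, a]%classic = 0%E) ->
  (forall n, nu `[b, b + n%:R]%classic = 0%E) ->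
  nu (~` `[a, b[%classic) = 0%E.
Proof.
move=> ha hb.
have mI (i : interval R) : measurable ([set` i] : set (measurableTypeR R)).
  exact: measurable_itv.
pose F n := (`[a - n%:R, a]%classic `|` `[b, b + n%:R]%classic : set (measurableTypeR R)).
have cov : ~` `[a, b[%classic `<=` \bigcup_n F n.
  move=> x /=; rewrite in_itv /= => /negP; rewrite negb_and -leNgt -ltNge => /orP[h|h].
    exists (Num.truncn (a - x)).+1 => //; left; rewrite /= in_itv /= (ltW h) andbT.
    by rewrite lerBlDr -lerBlDl ltW// truncnS_gt.
  exists (Num.truncn (x - b)).+1 => //; right; rewrite /= in_itv /= h /=.
  by rewrite -lerBlDl ltW// truncnS_gt.
have nF n : nu.-negligible (F n).
  by apply: negligibleU; (apply/negligibleP; [exact: mI|exact: ha || exact: hb]).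
apply/negligibleP; first exact: measurableC.
by apply: (@negligibleS _ (measurableTypeR R) _ nu _ _ cov); exact: negligible_bigcup.
Qed.

Section Support.
Context (R : realType) (mu : {charge set (measurableTypeR R) -> \bar R}).

(** Each point of [c, d] has a neighbourhood all of whose measurable subsets are
    null, and nullity of subsets passes to unions of adjacent intervals. *)
Lemma null_off_support (c d : R) : c <= d ->
  (forall x, c <= x <= d -> ~ charge_support mu x) ->
  forall A, measurable A -> A `<=` `[c, d]%classic -> mu A = 0%E.
Proof.
move=> cd hcd.
pose P (u v : R) := forall A : set (measurableTypeR R), measurable A -> A `<=` `[u, v]%classic -> mu A = 0%E.
apply: (@interval_induction R c d P) => //.
- move=> u v w cu uv vw wd Pu Pv A mA Auw.
  have mB : measurable (`[u, v]%classic : set (measurableTypeR R)) by exact: measurable_itv.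
  rewrite (chargeDI mu mA mB).
  have e1 : mu (A `\` `[u, v]%classic) = 0%E.
    apply: Pv; first exact: measurableD.
    move=> x [/Auw /=]; rewrite !in_itv /= => /andP[ux xw] /negP.
    by rewrite ux /= -ltNge => /ltW ->.
  have e2 : mu (A `&` `[u, v]%classic) = 0%E.
    by apply: Pu; [exact: measurableI|move=> x []].
  by rewrite e1 e2 adde0.
- move=> x cx xd; have /hcd : c <= x <= d by rewrite cx.
  move=> /existsNP[U] /not_implyP[Ux hU].
  have [e e0 he] := (nbhs_ballP _ _).1 Ux.
  exists e => // u v cu uv vd h1 h2 A mA Auv.
  apply/eqP; apply: contrapT => /negP nA; apply: hU; exists A; split => //.
  move=> y /Auv /=; rewrite in_itv /= => /andP[uy yv]; apply: he.
  rewrite /ball /= ltr_distlC; apply/andP; split.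
    by rewrite (lt_le_trans h1).
  by rewrite (le_lt_trans yv).
Qed.

Lemma null_pos_neg (c d : R) : c <= d ->
  (forall x, c <= x <= d -> ~ charge_support mu x) ->
  pos_part mu `[c, d]%classic = 0%E /\ neg_part mu `[c, d]%classic = 0%E.
Proof.
move=> cd h.
have mB : measurable (`[c, d]%classic : set (measurableTypeR R)) by exact: measurable_itv.
have [[mP _] [mN _] _ _] := hahn_posneg mu.
split.
- rewrite -[LHS]/(jordan_pos (hahn_posneg mu) _) jordan_posE cjordan_posE.
  rewrite /crestr0 mem_set// /crestr.
  by apply: (null_off_support cd h); [exact: measurableI|move=> x []].
- rewrite -[LHS]/(jordan_neg (hahn_posneg mu) _) jordan_negE cjordan_negE.
  rewrite /crestr0 mem_set// /crestr (null_off_support cd h) ?oppe0//.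
    exact: measurableI.
Qed.

(** The left end is taken below the least point of the support and the right end
    above the greatest one, so that the half-open interval carries everything. *)
Lemma compact_support_bounds : compact_support_measure mu ->
  exists a b : R, [/\ 0 < a, a < b,
    pos_part mu (~` `[a, b[%classic) = 0%E & neg_part mu (~` `[a, b[%classic) = 0%E].
Proof.
move=> [cK K0]; set K := charge_support mu in cK K0.
have [a [b [a0 ab hK]]] : exists a b : R, [/\ 0 < a, a < b &
    forall x, K x -> a < x < b].
  have [Ke|/set0P Kn0] := eqVneq K set0.
    by exists 1, 2; split => [||x]; rewrite ?Ke ?ltr01 ?ltr1n.
  have cid : {within K, continuous (@idfun R)} by apply: continuous_subspaceT => x; exact: cvg_id.
  have [m mK hm] := compact_EVT_min Kn0 cK cid.
  have [M MK hM] := compact_EVT_max Kn0 cK cid.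
  have m0 : 0 < m by apply: K0; rewrite inE in mK.
  exists (m / 2), (M + 1); split.
  - exact: divr_gt0.
  - have /= mM := hm M MK.
    rewrite (@lt_le_trans _ _ m)//; last by rewrite (le_trans mM)// lerDl.
    by rewrite ltr_pdivrMr// ltr_pMr// ltr1n.
  - move=> x Kx; have /= h1 := hm x (mem_set Kx); have /= h2 := hM x (mem_set Kx).
    apply/andP; split.
      by rewrite (lt_le_trans _ h1)// ltr_pdivrMr// ltr_pMr// ltr1n.
    by rewrite (le_lt_trans h2)// ltrDl.
exists a, b; split => //.
all: apply: null_off_itv => n.
all: have n0 : 0 <= n%:R :> R by [].
- by have [] := @null_pos_neg (a - n%:R) a ltac:(lra)
    ltac:(by move=> x /andP[_ xa] /hK /andP[/lt_le_trans - /(_ _ xa)]; rewrite ltxx).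
- by have [] := @null_pos_neg b (b + n%:R) ltac:(lra)
    ltac:(by move=> x /andP[bx _] /hK /andP[_ /(le_lt_trans bx)]; rewrite ltxx).
- by have [] := @null_pos_neg (a - n%:R) a ltac:(lra)
    ltac:(by move=> x /andP[_ xa] /hK /andP[/lt_le_trans - /(_ _ xa)]; rewrite ltxx).
- by have [] := @null_pos_neg b (b + n%:R) ltac:(lra)
    ltac:(by move=> x /andP[bx _] /hK /andP[_ /(le_lt_trans bx)]; rewrite ltxx).
Qed.

End Support.

(** * Riemann sums *)

Section RiemannSums.
Context (R : realType) (nu : {finite_measure set (measurableTypeR R) -> \bar R}).
Context (a b : R).
Hypotheses (a0 : 0 < a) (ab : a < b) (null : nu (~` `[a, b[%classic) = 0%E).
Local Notation Bor := (set (measurableTypeR R)).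
Local Notation mass A := (fine (nu (A : Bor))).
Local Notation D := (@half_line R : Bor).

Definition node (n i : nat) : R := a + (b - a) * (i%:R / n.+1%:R).
Definition cell (n i : nat) : Bor := `[node n i, node n i.+1[%classic.

Lemma measurable_cell n i : measurable (cell n i).
Proof. exact: measurable_itv. Qed.

Lemma measurable_half_line : measurable D.
Proof.
rewrite (_ : D = `]0, +oo[%classic); first exact: measurable_itv.
by apply/seteqP; split => x /=; rewrite in_itv /= andbT.
Qed.

Lemma mass_ge0 A : 0 <= mass A.
Proof. exact: fine_ge0. Qed.

Lemma massU A B : measurable (A : Bor) -> measurable (B : Bor) -> A `&` B = set0 ->
  mass (A `|` B) = mass A + mass B.
Proof. by move=> mA mB AB; rewrite measureU// fineD// fin_num_measure. Qed.

Lemma le_mass A B : measurable (A : Bor) -> measurable (B : Bor) -> A `<=` B ->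
  mass A <= mass B.
Proof. by move=> mA mB AB; rewrite fine_le ?fin_num_measure// le_measure// inE. Qed.

Lemma node0 n : node n 0 = a.
Proof. by rewrite /node mul0r mulr0 addr0. Qed.

Lemma nodeS n : node n n.+1 = b.
Proof. by rewrite /node divff ?pnatr_eq0// mulr1 addrC subrK. Qed.

Lemma node_le n i j : (i <= j)%N -> node n i <= node n j.
Proof.
move=> ij; rewrite lerD2l ler_wpM2l ?subr_ge0 ?(ltW ab)//.
by rewrite ler_wpM2r ?invr_ge0// ler_nat.
Qed.

Lemma node_in n i : (i < n.+1)%N -> a <= node n i < b.
Proof.
move=> ni; rewrite -{1}(node0 n) node_le//= -(nodeS n) ltrD2l ltr_pM2l ?subr_gt0//.
by rewrite ltr_pM2r ?invr_gt0 ?ltr0n// ltr_nat.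
Qed.

Lemma node_step n i : node n i.+1 - node n i = (b - a) / n.+1%:R.
Proof.
by rewrite /node opprD addrACA subrr add0r -mulrBr -mulrBl -natrB// subSnn mul1r.
Qed.

Lemma cell_near n i t : cell n i t -> `|t - node n i| <= (b - a) / n.+1%:R.
Proof.
rewrite /cell /= in_itv /= => /andP[h1 h2].
by rewrite ger0_norm ?subr_ge0// -(node_step n i) lerB// ltW.
Qed.

Lemma cell_sub n i t : (i < n.+1)%N -> cell n i t -> a <= t < b.
Proof.
rewrite /cell /= in_itv /= => ni /andP[h1 h2].
rewrite (le_trans _ h1) -?{1}(node0 n) ?node_le//=.
by rewrite (lt_le_trans h2)// -(nodeS n) node_le.
Qed.

(** The cells partition [a, b[, outside which the measure vanishes. *)
Lemma mass_cells n A : measurable (A : Bor) ->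
  mass (A `&` D) = \sum_(i < n.+1) mass (A `&` cell n i).
Proof.
move=> mA.
have key k : (k <= n.+1)%N ->
    mass (A `&` `[a, node n k[%classic) = \sum_(i < k) mass (A `&` cell n i).
  elim: k => [_|k IH kn].
    rewrite big_ord0 node0 set_itvco0// ?setI0 ?measure0//.
  rewrite big_ord_recr /= -IH ?(ltnW kn)//.
  rewrite -massU//.
  - congr (fine (nu _)); rewrite -setIUr; congr (_ `&` _).
    apply/seteqP; split => x /=; rewrite /cell /= !in_itv /=.
      by move=> /andP[-> h2]/=; case: (ltP x (node n k)); [left|right].
    have h := node_le n (leqnSn k).
    move=> [/andP[-> h2]|/andP[h1 ->]]; rewrite ?andbT.
      by rewrite (lt_le_trans h2).
    by rewrite (le_trans _ h1)// -{1}(node0 n) node_le.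
  - by apply: measurableI => //; exact: measurable_itv.
  - by apply: measurableI => //; exact: measurable_cell.
  - apply/seteqP; split => // x [[_]]; rewrite /cell /= !in_itv /= => /andP[_ h] [_ /andP[h1 _]].
    by move: (lt_le_trans h h1); rewrite ltxx.
rewrite -key// nodeS.
have mI : measurable (`[a, b[%classic : Bor) by exact: measurable_itv.
have mAI : measurable (A `&` `[a, b[%classic : Bor) by exact: measurableI.
have mAD : measurable (A `&` D : Bor) by apply: measurableI => //; exact: measurable_half_line.
have mC : measurable ((A `&` D) `\` `[a, b[%classic : Bor) by exact: measurableD.
have E : A `&` D = (A `&` `[a, b[%classic) `|` ((A `&` D) `\` `[a, b[%classic).
  apply/seteqP; split => x.
    move=> [Ax Dx]; have [h|h] := pselect (`[a, b[%classic x); [by left|by right].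
  move=> [[Ax]|[]//]; rewrite /= in_itv /= => /andP[h _]; split => //.
  exact: lt_le_trans h.
rewrite {1}E massU//; last first.
  by apply/seteqP; split => // x [[_ h] [_]]; apply.
suff -> : mass ((A `&` D) `\` `[a, b[%classic) = 0 by rewrite addr0.
apply/eqP; rewrite eq_le mass_ge0 andbT.
rewrite -[leRHS]/(fine 0%E) -null; apply: le_mass => //; exact: measurableC.
Qed.

Lemma total_mass n : mass D = \sum_(i < n.+1) mass (cell n i).
Proof.
have := @mass_cells n setT measurableT; rewrite setTI => ->.
by apply: eq_bigr => i _; rewrite setTI.
Qed.

Section Vector.
Context (X : normedModType R[i]).

(** Two sums over the two marginals of a nonnegative array w differ by at most the
    w-average of the distances: this compares two partitions through their common
    refinement. *)
Lemma refinement_dist (I J : Type) (s : seq I) (r : seq J) (w : I -> J -> R)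
    (u : I -> X) (v : J -> X) : (forall i j, 0 <= w i j) ->
  rnorm (\sum_(i <- s) ((\sum_(j <- r) w i j)%:C)%C *: u i -
         \sum_(j <- r) ((\sum_(i <- s) w i j)%:C)%C *: v j)
  <= \sum_(i <- s) \sum_(j <- r) w i j * rnorm (u i - v j).
Proof.
move=> w0.
under eq_bigr do rewrite rmorph_sum scaler_suml.
under [X in rnorm (_ - X)]eq_bigr do rewrite rmorph_sum scaler_suml.
rewrite [X in rnorm (_ - X)]exchange_big -sumrB.
apply: (le_trans (rnorm_sum _ _ _)); apply: ler_sum => i _.
rewrite -sumrB; apply: (le_trans (rnorm_sum _ _ _)); apply: ler_sum => j _.
by rewrite -scalerBr rnormZ cabsR ger0_norm.
Qed.

Definition riemann_sum (f : R -> X) (n : nat) : X :=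
  \sum_(i < n.+1) ((mass (cell n i))%:C)%C *: f (node n i).

Definition eps_continuous (f : R -> X) := forall x, 0 < x -> forall e : R, 0 < e ->
  exists2 d : R, 0 < d & forall t, `|t - x| < d -> rnorm (f t - f x) <= e.

Context (f : R -> X) (fc : eps_continuous f).

Lemma uniformly_continuous (e : R) : 0 < e -> exists2 d : R, 0 < d &
  forall s t, a <= s <= b -> `|s - t| < d -> rnorm (f s - f t) <= e.
Proof.
move=> e0.
pose P (u v : R) := exists2 d : R, 0 < d &
  forall s t, u <= s <= v -> `|s - t| < d -> rnorm (f s - f t) <= e.
apply: (@interval_induction R a b P (ltW ab)).
  move=> u v w _ uv vw _ [d d0 h] [d' d'0 h'].
  exists (Num.min d d'); first by rewrite lt_min d0.
  move=> s t /andP[us sw]; rewrite lt_min => /andP[h1 h2].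
  have [sv|vs] := leP s v; first by apply: h => //; rewrite us.
  by apply: h' => //; rewrite (ltW vs).
move=> x ax xb.
have e20 : 0 < e / 2 by exact: divr_gt0.
have [d d0 hd] := fc (lt_le_trans a0 ax) e20.
exists (d / 2); first exact: divr_gt0.
move=> u v au uv vb h1 h2; exists (d / 2); first exact: divr_gt0.
move=> s t /andP[us sv] st.
have sx : `|s - x| < d / 2 by rewrite ltr_distl (lt_le_trans h1)//= (le_lt_trans sv).
have d2 : d / 2 + d / 2 = d by rewrite -splitr.
rewrite -(subrK (f x) (f s)) -addrA [e](splitr e); apply: le_rnormD.
  by apply: hd; rewrite (lt_trans sx)// ltr_pdivrMr// ltr_pMr// ltr1n.
rewrite rnorm_distC; apply: hd.
rewrite -(subrK s t) -addrA (le_lt_trans (ler_normD _ _))// -d2 ltrD//.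
by rewrite distrC.
Qed.

Lemma cell_oscillation (e : R) : 0 < e -> exists N, forall n, (N <= n)%N ->
  forall (i : 'I_n.+1) t, cell n i t -> rnorm (f t - f (node n i)) <= e.
Proof.
move=> e0; have [d d0 hd] := uniformly_continuous e0.
exists (Num.truncn ((b - a) / d)) => n Nn i t ct.
apply: hd; first by have /andP[-> /ltW ->] := cell_sub (ltn_ord i) ct.
apply: (le_lt_trans (cell_near ct)).
rewrite ltr_pdivrMr ?ltr0n// mulrC -ltr_pdivrMr//.
by rewrite (lt_le_trans (truncnS_gt _))// ler_nat.
Qed.

(** Two cells that meet have nodes close to a common point. *)
Lemma riemann_sum_dist n m (e1 e2 : R) :
  (forall (i : 'I_n.+1) t, cell n i t -> rnorm (f t - f (node n i)) <= e1) ->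
  (forall (i : 'I_m.+1) t, cell m i t -> rnorm (f t - f (node m i)) <= e2) ->
  rnorm (riemann_sum f n - riemann_sum f m) <= mass D * (e1 + e2).
Proof.
move=> h1 h2.
pose w (i : 'I_n.+1) (j : 'I_m.+1) := mass (cell n i `&` cell m j).
have cD k (i : 'I_k.+1) : cell k i `&` D = cell k i.
  apply/setIidPl => t /(cell_sub (ltn_ord i)) /andP[h _]; exact: lt_le_trans h.
have En : riemann_sum f n = \sum_(i < n.+1) ((\sum_(j < m.+1) w i j)%:C)%C *: f (node n i).
  apply: eq_bigr => i _; rewrite -[cell n i](cD n i) (@mass_cells m); last exact: measurable_cell.
  done.
have Em : riemann_sum f m = \sum_(j < m.+1) ((\sum_(i < n.+1) w i j)%:C)%C *: f (node m j).
  apply: eq_bigr => j _; rewrite -[cell m j](cD m j) (@mass_cells n); last exact: measurable_cell.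
  by under eq_bigr do rewrite setIC.
rewrite En Em; apply: le_trans.
  by apply: refinement_dist => i j; exact: mass_ge0.
rewrite (total_mass n) mulr_suml; apply: ler_sum => i _.
rewrite -[cell n i](cD n i) (@mass_cells m); last exact: measurable_cell.
rewrite mulr_suml; apply: ler_sum => j _.
have [wz|wn0] := eqVneq (w i j) 0.
  by rewrite -/(w i j) wz !mul0r.
have [c0|/set0P[t [t1 t2]]] := eqVneq (cell n i `&` cell m j) set0.
  by move: wn0; rewrite /w c0 measure0 /= eqxx.
rewrite ler_wpM2l ?mass_ge0//.
rewrite -(subrK (f t) (f (node n i))) -addrA; apply: le_rnormD; last exact: h2.
by rewrite rnorm_distC; exact: h1.
Qed.

End Vector.
End RiemannSums.

(** * The Bochner integral of a continuous function *)

Section Limits.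
Context (R : realType) (X : normedModType R[i]).

(** Limits with explicit ranks and the real-valued norm, equivalent to the filter
    notion by [convergesP]. *)
Definition converges (u : nat -> X) (l : X) :=
  forall e : R, 0 < e -> exists N, forall n, (N <= n)%N -> rnorm (u n - l) <= e.

Lemma complex_gt0P (e : R[i]) : 0 < e -> exists2 r : R, 0 < r & e = (r%:C)%C.
Proof.
by case: e => a c; rewrite ltcE /= => /andP[/eqP -> a0]; exists a.
Qed.

Lemma convergesP u l : converges u l <-> u n @[n --> \oo] --> l.
Proof.
split=> [h|/cvgrPdist_le h e e0].
  apply/cvgrPdist_le => _ /complex_gt0P[r r0 ->].
  have [N hN] := h r r0; exists N => // n /= Nn.
  by rewrite normE lecR rnorm_distC hN.
have [|N _ hN] := h ((e%:C)%C); first by rewrite ltcR.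
exists N => n Nn; have := hN n Nn.
by rewrite /= normE lecR rnorm_distC.
Qed.

Lemma converges_unique u l l' : converges u l -> converges u l' -> l = l'.
Proof.
move=> h h'; apply/eqP; rewrite -subr_eq0; apply/eqP/rnorm_eq0/eqP.
rewrite eq_le rnorm_ge0 andbT; apply/ler_addgt0Pl => e e0.
have e20 : 0 < e / 2 by exact: divr_gt0.
have [N hN] := h _ e20; have [N' hN'] := h' _ e20.
rewrite addr0 (splitr e) -(subrK (u (maxn N N')) l) -addrA.
apply: le_rnormD; last by apply: hN'; rewrite leq_maxr.
by rewrite rnorm_distC; apply: hN; rewrite leq_maxl.
Qed.

End Limits.

Lemma cauchy_converges (R : realType) (X : completeNormedModType R[i]) (u : nat -> X) :
  (forall e : R, 0 < e -> exists N, forall m n, (N <= m)%N -> (N <= n)%N ->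
     rnorm (u m - u n) <= e) -> exists l, converges u l.
Proof.
move=> h.
suff : cvg (u @ \oo) by rewrite cvg_ex => -[l /convergesP ul]; exists l.
apply/cauchy_cvgP/cauchy_exP => _ /complex_gt0P[r r0 ->].
have r20 : 0 < r / 2 by exact: divr_gt0.
have [N hN] := h (r / 2) r20.
exists (u N), N => // n /= Nn.
rewrite /= -ball_normE /ball_ /= normE ltcR.
by rewrite (le_lt_trans (hN _ _ _ _))// ltr_pdivrMr// ltr_pMr// ltr1n.
Qed.

Section BochnerRiemann.
Context (R : realType) (nu : {finite_measure set (measurableTypeR R) -> \bar R}).
Context (a b : R).
Hypotheses (a0 : 0 < a) (ab : a < b) (null : nu (~` `[a, b[%classic) = 0%E).
Local Notation Bor := (set (measurableTypeR R)).
Local Notation mass A := (fine (nu (A : Bor))).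
Local Notation D := (@half_line R : Bor).
Context (X : completeNormedModType R[i]) (f : R -> X) (fc : eps_continuous f).
Local Notation node := (node a b).
Local Notation cell := (cell a b).
Local Notation RS := (riemann_sum nu a b f).

Lemma continuous_dist (y : X) : {in D, continuous (fun t => rnorm (f t - y))}.
Proof.
move=> x; rewrite inE => /= x0; apply/cvgrPdist_le => e e0.
have [d d0 hd] := fc x0 e0.
apply/nbhs_ballP; exists d => //= t.
rewrite /ball /= => xt.
have h : rnorm (f t - f x) <= e by apply: hd; rewrite distrC.
rewrite ler_distl; apply/andP; split.
  rewrite lerBlDr -(subrK (f x) (f t)) -addrA addrC.
  by rewrite (le_trans (rnormD _ _))// addrC lerD2l.
rewrite -(subrK (f t) (f x)) -addrA addrC.
by rewrite (le_trans (rnormD _ _))// lerD2l rnorm_distC.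
Qed.

Lemma measurable_dist (h : {fimfun (measurableTypeR R) >-> X}) : simple_function h ->
  measurable_fun D (fun t => rnorm (f t - h t)).
Proof.
move=> sh.
pose s := finmap.enum_fset (fset_set (range h)).
pose g (y : X) t := \1_(h @^-1` [set y]) t * rnorm (f t - y).
have -> : (fun t => rnorm (f t - h t)) = (fun t => \sum_(y <- s) g y t).
  apply/funext => t.
  rewrite (bigD1_seq (h t)) ?finmap.fset_uniq//=; last first.
    by rewrite in_fset_set// inE; exists t.
  rewrite /g indicE mem_set// mul1r big1 ?addr0// => y hy.
  by rewrite indicE memNset ?mul0r// => /= /eqP; rewrite eq_sym (negbTE hy).
apply: measurable_sum => y; apply: measurable_funM.
  exact: measurable_indic (sh y).
apply: open_continuous_measurable_fun; last exact: continuous_dist.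
exact: open_gt.
Qed.

(** Both sides are sums over the level sets of h and over the cells, so the distance
    is at most the integral of |h - f(node)| cell by cell, and h is compared to
    f(node) through f. The inequality holds for every simple function, hence
    for an arbitrary approximating sequence of the definition of the integral. *)
Lemma simple_integral_dist (h : {fimfun (measurableTypeR R) >-> X}) n (e : R) :
  simple_function h -> 0 <= e ->
  (forall (i : 'I_n.+1) t, cell n i t -> rnorm (f t - f (node n i)) <= e) ->
  ((rnorm (simple_integral nu D h - RS n))%:E <=
    \int[nu]_(t in D) (rnorm (f t - h t))%:E + (e * mass D)%:E)%E.
Proof.
move=> sh e0 he.
pose s := finmap.enum_fset (fset_set (range h)).
have us : uniq s by exact: finmap.fset_uniq.
pose w (y : X) (i : 'I_n.+1) := mass (h @^-1` [set y] `&` cell n i).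
have mc i : measurable (cell n i) by exact: measurable_cell.
have mD : measurable D by exact: measurable_half_line.
have mhc y i : measurable (h @^-1` [set y] `&` cell n i : Bor) by apply: measurableI.
have E1 : simple_integral nu D h = \sum_(y <- s) ((\sum_(i < n.+1) w y i)%:C)%C *: y.
  rewrite /simple_integral fsbig_finite//; apply: eq_bigr => y _.
  by rewrite setIC (mass_cells a0 ab null n).
have E2 : RS n = \sum_(i < n.+1) ((\sum_(y <- s) w y i)%:C)%C *: f (node n i).
  apply: eq_bigr => i _; congr ((_%:C)%C *: _).
  have -> : cell n i = \bigcup_(y in range h) (h @^-1` [set y] `&` cell n i).
    apply/seteqP; split => [t ct|t [y _ []]//].
    by exists (h t); [exists t|].
  rewrite measure_fin_bigcup//; last first.
    by move=> y y' _ _ [t [[<- _] [<- _]]].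
  rewrite fsbig_finite//= sum_fine// => y _.
  by rewrite fin_num_measure.
pose G (y : X) (i : 'I_n.+1) t : \bar R :=
  ((rnorm (y - f (node n i)))%:E * (\1_(h @^-1` [set y] `&` cell n i) t)%:E)%E.
have mG y i : measurable_fun D (G y i).
  by apply: measurable_funeM; apply/measurable_EFinP; exact: measurable_indic.
have G0 y i t : (0 <= G y i t)%E.
  by rewrite mule_ge0// lee_fin ?rnorm_ge0.
have mfh : measurable_fun D (fun t => (rnorm (f t - h t))%:E).
  by apply/measurable_EFinP; exact: measurable_dist.
have E3 : ((\sum_(y <- s) \sum_(i < n.+1) w y i * rnorm (y - f (node n i)))%:E =
     \int[nu]_(t in D) (\sum_(y <- s) \sum_(i < n.+1) G y i t))%E.
  rewrite ge0_integral_sum//; last 2 first.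
  - by move=> y; apply: emeasurable_sum => i.
  - by move=> y t _; exact: sume_ge0.
  rewrite -sumEFin; apply: eq_bigr => y _.
  rewrite ge0_integral_sum// -sumEFin; apply: eq_bigr => i _.
  rewrite ge0_integralZl_EFin ?rnorm_ge0//; last first.
    by apply/measurable_EFinP; exact: measurable_indic.
  rewrite integral_indic// EFinM muleC; congr (_ * _)%E.
  rewrite /w fineK ?fin_num_measure//; congr (nu _).
  apply/esym/setIidPl => t [_ /(cell_sub ab (ltn_ord i)) /andP[h1 _]].
  exact: lt_le_trans h1.
have E4 : (\int[nu]_(t in D) ((rnorm (f t - h t))%:E + e%:E) =
   \int[nu]_(t in D) (rnorm (f t - h t))%:E + (e * mass D)%:E)%E.
  rewrite ge0_integralD//; last by move=> t _; rewrite lee_fin rnorm_ge0.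
  by rewrite integral_cst// EFinM fineK// fin_num_measure.
rewrite -E4 E1 E2.
apply: (@le_trans _ _ (\sum_(y <- s) \sum_(i < n.+1) w y i * rnorm (y - f (node n i)))%:E).
  by rewrite lee_fin; apply: refinement_dist => y i; exact: mass_ge0.
rewrite E3; apply: ge0_le_integral => //.
- by move=> t _; apply: sume_ge0 => y _; exact: sume_ge0.
- by apply: emeasurable_sum => y; apply: emeasurable_sum => i.
- by apply: emeasurable_funD.
move=> t Dt.
rewrite (bigD1_seq (h t))//=; last by rewrite in_fset_set// inE; exists t.
rewrite [X in (_ + X)%E]big1 => [|y hy]; last first.
  rewrite big1// => i _; rewrite /G indicE memNset ?mule0// => -[/= /eqP].
  by rewrite eq_sym (negbTE hy).
rewrite adde0.
have [[i ci]|ni] := pselect (exists i : 'I_n.+1, cell n i t).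
  rewrite (bigD1 i)//= big1 ?adde0 => [|j ji].
    rewrite /G indicE mem_set// mule1 -EFinD lee_fin.
    rewrite -{1}(subrK (f t) (h t)) -addrA.
    by apply: le_rnormD; [rewrite rnorm_distC|exact: (he i t ci)].
  rewrite /G indicE memNset ?mule0// => -[_ cj].
  have ij : (nat_of_ord i <> j) by move=> /val_inj E; rewrite E eqxx in ji.
  move: ci cj; rewrite /cell /= !in_itv /= => /andP[i1 i2] /andP[j1 j2].
  have [lij|lji|//] := ltngtP i j.
  + by have := node_le ab n lij; rewrite leNgt (le_lt_trans j1).
  + by have := node_le ab n lji; rewrite leNgt (le_lt_trans i1).
rewrite big1 => [|i _].
  by rewrite -EFinD lee_fin addr_ge0// rnorm_ge0.
rewrite /G indicE memNset ?mule0// => -[_ cj].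
by apply: ni; exists i.
Qed.

End BochnerRiemann.

Section StepFunctions.
Context (R : realType) (nu : {finite_measure set (measurableTypeR R) -> \bar R}).
Context (a b : R).
Hypotheses (a0 : 0 < a) (ab : a < b) (null : nu (~` `[a, b[%classic) = 0%E).
Local Notation Bor := (set (measurableTypeR R)).
Local Notation mass A := (fine (nu (A : Bor))).
Local Notation D := (@half_line R : Bor).
Context (X : completeNormedModType R[i]) (f : R -> X) (fc : eps_continuous f).
Local Notation node := (node a b).
Local Notation cell := (cell a b).
Local Notation RS := (riemann_sum nu a b f).

Lemma cell_uniq n (i j : 'I_n.+1) (t : R) : cell n i t -> cell n j t -> i = j.
Proof.
rewrite /cell /= !in_itv /= => /andP[i1 i2] /andP[j1 j2].
have [lij|lji|/val_inj//] := ltngtP i j.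
- by have := node_le ab n lij; rewrite leNgt (le_lt_trans j1).
- by have := node_le ab n lji; rewrite leNgt (le_lt_trans i1).
Qed.

Lemma cell_exists n t : a <= t < b -> exists i : 'I_n.+1, cell n i t.
Proof.
move=> /andP[at_ tb].
have ba : 0 < b - a by rewrite subr_gt0.
have n0 : 0 < n.+1%:R :> R by rewrite ltr0n.
pose x := (t - a) / (b - a) * n.+1%:R.
have x0 : 0 <= x by rewrite mulr_ge0// divr_ge0 ?subr_ge0// ltW.
have xn : x < n.+1%:R by rewrite /x gtr_pMl// ltr_pdivrMr// mul1r ltrD2r.
have /andP[h1 h2] := truncn_itv x0.
have kn : (Num.truncn x < n.+1)%N by rewrite -(ltr_nat R) (le_lt_trans h1).
have tE : t = a + (b - a) * (x / n.+1%:R).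
  by rewrite /x mulfK ?gt_eqF// mulrC divfK ?gt_eqF// addrC subrK.
exists (Ordinal kn); rewrite /cell /= in_itv /= /node tE.
by rewrite lerD2l ltrD2l ler_pM2l// ltr_pM2l// ler_pM2r ?invr_gt0// ltr_pM2r ?invr_gt0// h1.
Qed.

Definition cell_index n (t : R) : option 'I_n.+1 := [pick i : 'I_n.+1 | `[< cell n i t >]].

Lemma cell_indexP n (t : R) (i : 'I_n.+1) : cell_index n t = Some i <-> cell n i t.
Proof.
rewrite /cell_index; case: pickP => [j /asboolP cj|h]; split.
- by move=> [<-].
- by move=> /(cell_uniq cj) ->.
- by [].
- by move=> ci; have := h i; rewrite asboolT.
Qed.

(** The default value 0 is taken outside [a, b[, where the measure vanishes. *)
Definition step_fun n (t : measurableTypeR R) : X :=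
  oapp (fun i : 'I_n.+1 => f (node n i)) 0 (cell_index n t).

Lemma step_fun_in n t : a <= t < b ->
  exists2 i : 'I_n.+1, cell n i t & step_fun n t = f (node n i).
Proof.
move=> /(cell_exists n)[i ci]; exists i => //.
by rewrite /step_fun ((cell_indexP t i).2 ci).
Qed.

Lemma step_fun_fimfun n : step_fun n \in fimfun.
Proof.
rewrite inE /=.
have -> : range (step_fun n) =
    oapp (fun i : 'I_n.+1 => f (node n i)) 0 @` range (cell_index n).
  apply/seteqP; split => y /=.
    by move=> [t _ <-]; exists (cell_index n t) => //; exists t.
  by move=> [_ [t _ <-] <-]; exists t.
exact/finite_image/finite_finset.
Qed.

Definition step n : {fimfun (measurableTypeR R) >-> X} := fimfun_Sub (step_fun_fimfun n).

Lemma simple_step n : simple_function (step n).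
Proof.
move=> y.
have mi o : measurable (cell_index n @^-1` [set o] : Bor).
  case: o => [i|].
    rewrite (_ : _ @^-1` _ = cell n i); first exact: measurable_cell.
    by apply/seteqP; split => t /cell_indexP.
  rewrite (_ : _ @^-1` _ = ~` \bigcup_(i in [set: 'I_n.+1]) cell n i).
    apply: measurableC; apply: fin_bigcup_measurable => // i _.
    exact: measurable_cell.
  apply/seteqP; split => t /=.
    by move=> h [i _ /cell_indexP]; rewrite h.
  move=> h; case E : (cell_index n t) => [i|//].
  by exfalso; apply: h; exists i => //; apply/cell_indexP.
rewrite (_ : _ @^-1` _ = \bigcup_(o in
    [set o | oapp (fun i : 'I_n.+1 => f (node n i)) 0 o = y])
    (cell_index n @^-1` [set o] : Bor)).
  by apply: fin_bigcup_measurable.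
apply/seteqP; split => t /=; first by move=> h; exists (cell_index n t).
by move=> [p hp E]; move: hp => /= <-; rewrite -[in RHS]E.
Qed.

Lemma step_dist n (e : R) : 0 <= e ->
  (forall (i : 'I_n.+1) t, cell n i t -> rnorm (f t - f (node n i)) <= e) ->
  (\int[nu]_(t in D) (rnorm (f t - step n t))%:E <= (e * mass D)%:E)%E.
Proof.
move=> e0 he.
have mD : measurable D by exact: measurable_half_line.
have mI : measurable (`[a, b[%classic : Bor) by exact: measurable_itv.
have mf : measurable_fun D (fun t => (rnorm (f t - step n t))%:E).
  by apply/measurable_EFinP; apply: measurable_dist => //; exact: simple_step.
rewrite (ge0_negligible_integral (measurableC mI))//; last first.
  by move=> t _; rewrite lee_fin rnorm_ge0.
rewrite setDE setCK.
have mDI : measurable (D `&` `[a, b[%classic : Bor) by exact: measurableI.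
apply: (@le_trans _ _ (\int[nu]_(t in (D `&` `[a, b[%classic : Bor)) e%:E)%E).
  apply: ge0_le_integral => //.
  - by move=> t _; rewrite lee_fin rnorm_ge0.
  - by apply: measurable_funS mf => //; exact: subIsetl.
  - move=> t [_]; rewrite /= in_itv /= => tab; rewrite lee_fin.
    have [i ci E] := step_fun_in n tab.
    by rewrite [X in _ - X](_ : _ = f (node n i))//; exact: he.
rewrite integral_cst// EFinM lee_wpmul2l ?lee_fin//.
rewrite fineK ?fin_num_measure// le_measure ?inE//; exact: subIsetl.
Qed.

(** Any sequence of simple functions witnessing the integral is close to the
    Riemann sums, by [simple_integral_dist]; the value is thus determined. *)
Lemma bochner_unique v : is_bochner_integral nu D f v -> converges RS v.
Proof.
move=> [g [sg _ ig /convergesP sv]] e e0.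
pose M := mass D.
have M0 : 0 <= M by exact: fine_ge0.
have e3 : 0 < e / 3 by exact: divr_gt0.
have e' : 0 < e / 3 / (M + 1) by rewrite divr_gt0// ltr_wpDl.
have [N hN] := cell_oscillation a0 ab fc e'.
exists N => n Nn.
have osc := hN n Nn.
have [N1 hN1] := sv _ e3.
move/fine_cvgP : ig => [fing ig].
have /cvgrPdist_le /(_ _ e3)[N2 _ hN2] := ig.
have [N3 _ hN3] := fing.
pose k := maxn N1 (maxn N2 N3).
have k1 : (N1 <= k)%N by rewrite leq_maxl.
have k2 : (N2 <= k)%N by rewrite /k maxnCA leq_maxl.
have k3 : (N3 <= k)%N by rewrite /k maxnA leq_maxr.
pose I := (\int[nu]_(t in D) (rnorm (f t - g k t))%:E)%E.
have fI : I \is a fin_num by exact: hN3 k k3.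
have hI : `|0 - fine I| <= e / 3 by exact: hN2 k k2.
have : ((rnorm (simple_integral nu D (g k) - RS n))%:E <=
    I + (e / 3 / (M + 1) * M)%:E)%E.
  have h := simple_integral_dist a0 ab null fc (sg k) (ltW e') osc.
  by rewrite /I /M; exact h.
rewrite -(fineK fI) -EFinD lee_fin => h.
have hI' : fine I <= e / 3.
  by move: hI; rewrite sub0r normrN => /(le_trans (ler_norm _)).
have hM : e / 3 / (M + 1) * M <= e / 3.
  rewrite -mulrA ler_piMr ?(ltW e3)// mulrC ler_pdivrMr ?ltr_wpDl// mul1r.
  by rewrite lerDl.
have h1 := hN1 k k1.
rewrite -(subrK (simple_integral nu D (g k)) (RS n)) -addrA.
apply: (@le_trans _ _ ((e / 3 + e / 3) + e / 3)); last by lra.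
apply: le_rnormD => //.
by rewrite rnorm_distC (le_trans h)// lerD.
Qed.

(** The Riemann sums form a Cauchy sequence, and the step functions attached to them
    witness that their limit is the integral. *)
Lemma bochner_exists : exists v, is_bochner_integral nu D f v.
Proof.
pose M := mass D.
have M0 : 0 <= M by exact: fine_ge0.
have small e : 0 < e -> exists N, forall n, (N <= n)%N ->
    exists2 d : R, 0 < d /\ M * (d + d) <= e &
      forall (i : 'I_n.+1) t, cell n i t -> rnorm (f t - f (node n i)) <= d.
  move=> e0.
  have e' : 0 < e / 2 / (M + 1) by rewrite divr_gt0 ?divr_gt0// ltr_wpDl.
  have [N hN] := cell_oscillation a0 ab fc e'.
  exists N => n Nn; exists (e / 2 / (M + 1)); last exact: hN.
  split=> //; rewrite -mulrDl -splitr mulrC -mulrA ler_piMr ?(ltW e0)//.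
  by rewrite mulrC ler_pdivrMr ?ltr_wpDl// mul1r lerDl.
have [v RSv] : exists v, converges RS v.
  apply: cauchy_converges => e e0; have [N hN] := small e e0.
  exists N => m n Nm Nn.
  have [d [d0 hd] od] := hN m Nm; have [d' [d'0 hd'] od'] := hN n Nn.
  apply: (le_trans (riemann_sum_dist a0 ab null od od')).
  rewrite mulrDr; move: hd hd'; rewrite !mulrDr -/M; lra.
exists v; exists step; split; first exact: simple_step.
- exists (~` `[a, b[%classic : Bor); split => //.
    by apply: measurableC; exact: measurable_itv.
  move=> t /= ht hab; apply: ht => _.
  apply/convergesP => e e0; have [N hN] := cell_oscillation a0 ab fc e0.
  exists N => n Nn; move: hab; rewrite /= in_itv /= => /(step_fun_in n)[i ci E].
  by rewrite [X in X - _](_ : _ = f (node n i))// rnorm_distC; exact: hN.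
- have sd n d : 0 < d -> (forall (i : 'I_n.+1) t, cell n i t ->
      rnorm (f t - f (node n i)) <= d) ->
      let I := (\int[nu]_(t in D) (rnorm (f t - step n t))%:E)%E in
      I \is a fin_num /\ 0 <= fine I <= d * M.
    move=> d0 od I.
    have I0 : (0 <= I)%E by apply: integral_ge0 => t _; rewrite lee_fin rnorm_ge0.
    have IM : (I <= (d * M)%:E)%E by exact: step_dist (ltW d0) od.
    have fI : I \is a fin_num by rewrite ge0_fin_numE// (le_lt_trans IM) ?ltry.
    by split=> //; rewrite -!lee_fin fineK// I0.
  apply/fine_cvgP; split.
    have [N hN] := small 1 ltr01.
    by exists N => // n /= Nn; have [d [d0 _] od] := hN n Nn; have [] := sd n d d0 od.
  apply/cvgrPdist_le => e e0; have [N hN] := small e e0.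
  exists N => // n /= Nn; have [d [d0 hd] od] := hN n Nn.
  have [_ /andP[h1 h2]] := sd n d d0 od.
  rewrite sub0r normrN ger0_norm// (le_trans h2)// (le_trans _ hd)// mulrC.
  by rewrite ler_wpM2l// lerDl ltW.
- apply/convergesP => e e0.
  have e20 : 0 < e / 2 by exact: divr_gt0.
  have [N hN] := small _ e20; have [N' hN'] := RSv _ e20.
  exists (maxn N N') => n; rewrite geq_max => /andP[Nn N'n].
  have [d [d0 hd] od] := hN n Nn.
  rewrite -(subrK (RS n) (simple_integral nu D (step n))) -addrA (splitr e).
  apply: le_rnormD; last exact: hN'.
  have h : ((rnorm (simple_integral nu D (step n) - RS n))%:E <=
      \int[nu]_(t in D) (rnorm (f t - step n t))%:E + (d * M)%:E)%E.
    have h := simple_integral_dist a0 ab null fc (@simple_step n) (ltW d0) od.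
    by rewrite /M; exact h.
  have h' : (\int[nu]_(t in D) (rnorm (f t - step n t))%:E <= (d * M)%:E)%E.
    by rewrite /M; exact: step_dist (ltW d0) od.
  have := le_trans h (leeD2r _ h').
  by rewrite -EFinD lee_fin => /le_trans; apply; rewrite -mulrDl mulrC.
Qed.

(** This is the only way in which Bochner integrals are used: every estimate is made
    on the finite sums and passes to the limit. *)
Lemma bochner_converges : converges RS (bochner_integral nu D f).
Proof. by apply: bochner_unique; apply: xgetPex; exact: bochner_exists. Qed.

End StepFunctions.

(** * Riemann sums of real functions *)

Section RealRiemann.
Context (R : realType) (nu : {finite_measure set (measurableTypeR R) -> \bar R}).
Context (a b : R).
Hypotheses (a0 : 0 < a) (ab : a < b) (null : nu (~` `[a, b[%classic) = 0%E).
Local Notation Bor := (set (measurableTypeR R)).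
Local Notation mass A := (fine (nu (A : Bor))).
Local Notation D := (@half_line R : Bor).
Local Notation node := (node a b).
Local Notation cell := (cell a b).
Local Notation I := (`[a, b[%classic : Bor).
Context (f : R -> R).
Hypothesis fc : forall x, 0 < x -> {for x, continuous f}.

Lemma eps_continuous_real : eps_continuous (X := R[i]^o) (fun t => ((f t)%:C)%C).
Proof.
move=> x x0 e e0; have /cvgrPdist_le /(_ e e0) := fc x0.
move=> /nbhs_ballP[d d0 hd]; exists d => // t ht.
rewrite -rmorphB cabsR distrC; apply: hd.
by rewrite /ball /= distrC.
Qed.

(** The Riemann sum is the integral over [a, b[ of a step function uniformly close
    to f. *)
Lemma Rintegral_riemann (e : R) : 0 < e -> exists N, forall n, (N <= n)%N ->
  `|\sum_(i < n.+1) mass (cell n i) * f (node n i) - Rintegral nu D f| <= e.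
Proof.
move=> e0; pose M := mass I.
have M0 : 0 <= M by exact: fine_ge0.
have e' : 0 < e / (M + 1) by rewrite divr_gt0// ltr_wpDl.
have [N hN] := cell_oscillation a0 ab eps_continuous_real e'.
exists N => n Nn.
have mD : measurable D by exact: measurable_half_line.
have mI : measurable I by exact: measurable_itv.
have mc i : measurable (cell n i) by exact: measurable_cell.
have mfD : measurable_fun D f.
  apply: open_continuous_measurable_fun; first exact: open_gt.
  by move=> x; rewrite inE => /fc.
have ID : I `<=` D.
  by move=> t; rewrite /= in_itv /= => /andP[at_ _]; exact: lt_le_trans at_.
have mfI : measurable_fun I f by exact: measurable_funS mfD.
have osc (i : 'I_n.+1) t : cell n i t -> `|f t - f (node n i)| <= e / (M + 1).
  by move=> ci; have := hN n Nn i t ci; rewrite -rmorphB cabsR.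
have fI : nu I \is a fin_num by rewrite fin_num_measure.
have If : nu.-integrable I (EFin \o f).
  apply: measurable_bounded_integrable => //; first by rewrite ltey_eq fI.
  pose B := \sum_(i < n.+1) `|f (node n i)| + e / (M + 1).
  exists B; split; first exact: num_real.
  move=> y By t; rewrite /= in_itv /= => tab; apply: le_trans (ltW By).
  have [i ci] := cell_exists ab n tab.
  rewrite -(subrK (f (node n i)) (f t)) addrC (le_trans (ler_normD _ _))// lerD ?osc//.
  by rewrite (bigD1 i)//= lerDl sumr_ge0.
pose g t := \sum_(i < n.+1) f (node n i) * \1_(cell n i) t.
have I1 (i : 'I_n.+1) : nu.-integrable I (fun t => ((f (node n i))%:E * (\1_(cell n i) t)%:E)%E).
  apply: integrableZl => //.
  by apply: integrableS (integrable_indic nu (mc i)).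
have gE : EFin \o g = (fun t => \sum_(i < n.+1) ((f (node n i))%:E * (\1_(cell n i) t)%:E)%E)%E.
  by apply/funext => t /=; rewrite /g -sumEFin.
have Ig : nu.-integrable I (EFin \o g).
  by rewrite gE; apply: integrable_sum => // i _.
have Eg : Rintegral nu I g = \sum_(i < n.+1) mass (cell n i) * f (node n i).
  rewrite /Rintegral -[X in integral _ _ X]/(EFin \o g) gE integral_sum//.
  under eq_bigr => i _.
    rewrite integralZl//; last by apply: integrableS (integrable_indic nu (mc i)).
    rewrite integral_indic// (_ : cell n i `&` I = cell n i); last first.
      by apply/setIidPl => t /(cell_sub ab (ltn_ord i)) /=; rewrite in_itv.
    over.
  rewrite -sum_fine; last by move=> i _; rewrite fin_numM// fin_num_measure.
  by apply: eq_bigr => i _; rewrite fineM ?fin_num_measure//= mulrC.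
have ED : Rintegral nu D f = Rintegral nu I f.
  rewrite /Rintegral; congr fine; rewrite integralE [RHS]integralE.
  have DC : D `\` ~` I = I by rewrite setDE setCK; exact/setIidPr.
  have mEf : measurable_fun D (fun t => (f t)%:E) by exact/measurable_EFinP.
  congr (_ - _)%E; rewrite (ge0_negligible_integral (measurableC mI)) ?DC//.
    exact: measurable_funepos.
  exact: measurable_funeneg.
rewrite -Eg ED -RintegralB//.
have IB : nu.-integrable I (EFin \o (fun t => g t - f t)).
  rewrite (_ : EFin \o _ = (fun t => (EFin \o g) t - (EFin \o f) t)%E)//.
  exact: integrableB.
apply: (le_trans (le_normr_Rintegral mI IB)).
have IB' : nu.-integrable I (EFin \o (fun t => `|g t - f t|)) by exact: integrable_norm.
have Ic : nu.-integrable I (EFin \o (fun=> e / (M + 1))).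
  by apply: finite_measure_integrable_cst.
apply: (@le_trans _ _ (Rintegral nu I (fun=> e / (M + 1)))).
  apply: le_Rintegral => // t; rewrite /= in_itv /= => tab.
  have [i ci] := cell_exists ab n tab.
  rewrite (_ : g t = f (node n i)); first by rewrite distrC; exact: osc.
  rewrite /g (bigD1 i)//= big1 ?addr0 => [|j ji].
    by rewrite indicE mem_set// mulr1.
  rewrite indicE memNset ?mulr0// => cj.
  by move: ji; rewrite (cell_uniq ab cj ci) eqxx.
rewrite Rintegral_cst// -/M -mulrA ler_piMr ?(ltW e0)//.
by rewrite mulrC ler_pdivrMr ?ltr_wpDl// mul1r lerDl.
Qed.

End RealRiemann.

(** * Quadrature rules and Laplace transforms *)

Section ConvergesTheory.
Context (R : realType) (X : normedModType R[i]).
Implicit Types (u v : nat -> X) (l m : X).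

Lemma converges_ext u v l : u =1 v -> converges u l -> converges v l.
Proof. by move=> /funext ->. Qed.

Lemma convergesD u v l m : converges u l -> converges v m ->
  converges (fun n => u n + v n) (l + m).
Proof.
move=> hu hv e e0; have e20 : 0 < e / 2 by exact: divr_gt0.
have [N hN] := hu _ e20; have [N' hN'] := hv _ e20.
exists (maxn N N') => n; rewrite geq_max => /andP[Nn N'n].
rewrite opprD addrACA (splitr e); apply: le_rnormD; [exact: hN|exact: hN'].
Qed.

Lemma convergesZ c u l : converges u l -> converges (fun n => c *: u n) (c *: l).
Proof.
move=> hu e e0.
have c0 : 0 < cabs c + 1 by rewrite ltr_wpDl// rnorm_ge0.
have [N hN] := hu (e / (cabs c + 1)) (divr_gt0 e0 c0).
exists N => n Nn; rewrite -scalerBr rnormZ.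
apply: (@le_trans _ _ (cabs c * (e / (cabs c + 1)))).
  by rewrite ler_wpM2l ?rnorm_ge0// hN.
by rewrite mulrCA ler_piMr ?(ltW e0)// ler_pdivrMr// mul1r lerDl.
Qed.

Lemma convergesN u l : converges u l -> converges (fun n => - u n) (- l).
Proof.
move=> h; rewrite -scaleN1r.
by apply: converges_ext (convergesZ (-1) h) => n /=; rewrite scaleN1r.
Qed.

Lemma convergesB u v l m : converges u l -> converges v m ->
  converges (fun n => u n - v n) (l - m).
Proof. by move=> hu hv; apply: convergesD => //; exact: convergesN. Qed.

Lemma converges_cst l : converges (fun=> l) l.
Proof. by move=> e e0; exists 0%N => n _; rewrite subrr rnorm0 ltW. Qed.

Lemma converges_le u l (c : R) : converges u l -> (forall n, rnorm (u n) <= c) ->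
  rnorm l <= c.
Proof.
move=> h hc; apply/ler_addgt0Pl => e e0; have [N hN] := h e e0.
rewrite -(subrK (u N) l); apply: le_rnormD => //.
by rewrite rnorm_distC; exact: hN.
Qed.

End ConvergesTheory.

Section Quadrature.
Context (R : realType).
Local Notation C := R[i].

(** Signed weights of uniformly bounded total size at points of [a, b]. A measure is
    represented by one such family, and all integrals against it, scalar or
    vector valued, are limits of the corresponding sums. *)
Record quadrature (a b V : R) := Quadrature {
  weight : nat -> nat -> R;
  point : nat -> nat -> R;
  weight_le : forall n, \sum_(i < n.+1) `|weight n i| <= V;
  point_in : forall n (i : 'I_n.+1), a <= point n i <= b
}.

Context (a b V : R) (q : quadrature a b V).

Definition qsum (X : normedModType C) (f : R -> X) (n : nat) : X :=
  \sum_(i < n.+1) ((weight q n i)%:C)%C *: f (point q n i).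

Lemma qsumD (X : normedModType C) (f g : R -> X) n :
  qsum (fun t => f t + g t) n = qsum f n + qsum g n.
Proof. by rewrite -big_split; apply: eq_bigr => i _; rewrite scalerDr. Qed.

Lemma qsumZ (X : normedModType C) c (f : R -> X) n :
  qsum (fun t => c *: f t) n = c *: qsum f n.
Proof.
by rewrite scaler_sumr; apply: eq_bigr => i _; rewrite !scalerA mulrC.
Qed.

Lemma qsumB (X : normedModType C) (f g : R -> X) n :
  qsum (fun t => f t - g t) n = qsum f n - qsum g n.
Proof. by rewrite -sumrB; apply: eq_bigr => i _; rewrite scalerBr. Qed.

Lemma qsum_scale (X : normedModType C) (f : R -> C) (x : X) n :
  qsum (fun t => f t *: x) n = qsum (X := C^o) f n *: x.
Proof. by rewrite scaler_suml; apply: eq_bigr => i _; rewrite scalerA. Qed.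

Lemma eq_qsum (X : normedModType C) (f g : R -> X) n :
  (forall t, a <= t <= b -> f t = g t) -> qsum f n = qsum g n.
Proof. by move=> h; apply: eq_bigr => i _; rewrite h// point_in. Qed.

Lemma qsum_le (X : normedModType C) (f : R -> X) n c : 0 <= c ->
  (forall t, a <= t <= b -> rnorm (f t) <= c) -> rnorm (qsum f n) <= V * c.
Proof.
move=> c0 h; apply: (le_trans (rnorm_sum _ _ _)).
apply: (@le_trans _ _ (\sum_(i < n.+1) `|weight q n i| * c)).
  apply: ler_sum => i _; rewrite rnormZ cabsR ler_wpM2l// h//; exact: point_in.
by rewrite -mulr_suml ler_wpM2r// weight_le.
Qed.

Lemma qlim_le (X : normedModType C) (f : R -> X) (l : X) c : 0 <= c ->
  (forall t, a <= t <= b -> rnorm (f t) <= c) -> converges (qsum f) l ->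
  rnorm l <= V * c.
Proof. by move=> c0 h hl; apply: converges_le hl _ => n; exact: qsum_le. Qed.

End Quadrature.

Section LaplaceTransform.
Context (R : realType) (a b V : R) (q : quadrature a b V).
Local Notation C := R[i].
Hypotheses (a0 : 0 < a) (ab : a < b) (V0 : 0 <= V).

(** The j-th derivative in z of exp(-zt). *)
Definition laplace_kernel (j : nat) (z : C) (t : R) : C :=
  (- (t%:C)%C) ^+ j * cexp (- z * (t%:C)%C).

Context (F : nat -> C -> C).
Hypothesis FP : forall j z, converges (X := C^o) (qsum q (X := C^o) (laplace_kernel j z)) (F j z).

Let b0 : 0 < b. Proof. exact: lt_trans ab. Qed.

Lemma laplace_kernel_le j z t : a <= t <= b ->
  cabs (laplace_kernel j z t) <= b ^+ j * expR (cabs z * b).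
Proof.
move=> /andP[at_ tb].
have t0 : 0 <= t by rewrite (le_trans _ at_)// ltW.
rewrite cabsM cabsX rnormN cabsR ger0_norm//.
apply: ler_pM; rewrite ?exprn_ge0 ?rnorm_ge0//.
  by rewrite lerXn2r// nnegrE// ltW.
apply: cabs_cexp_le; rewrite cabsM rnormN cabsR ger0_norm//.
by rewrite ler_wpM2l ?rnorm_ge0.
Qed.

(** The quadratic bound for the kernel is uniform for t in [a, b], so it survives
    integration. *)
Lemma has_deriv_laplace j : has_deriv (E := C^o) (F j) (F j.+1).
Proof.
move=> r.
have [K K0 hK] := @has_deriv_cexp R (`|r| * b).
pose L := V * (b ^+ j.+1 * expR (`|r| * b)) + V * (b ^+ j * (K * b ^+ 2)).
have bj k : 0 <= b ^+ k by exact/exprn_ge0/ltW.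
have e0 c : 0 <= expR c :> R by exact: expR_ge0.
exists L => [|z w hz hw].
  by rewrite ?addr_ge0 ?mulr_ge0 ?exprn_ge0 ?(ltW b0)//.
have hz' : cabs z <= `|r| by rewrite (le_trans hz)// ler_norm.
have hw' : cabs w <= `|r| by rewrite (le_trans hw)// ler_norm.
split.
  apply: (@le_trans _ _ (V * (b ^+ j.+1 * expR (`|r| * b)))).
    apply: (qlim_le (X := C^o) _ _ (FP j.+1 z)); first by rewrite mulr_ge0.
    move=> t /laplace_kernel_le h; apply: (le_trans (h _ _)).
    by rewrite ler_wpM2l// ler_expR ler_wpM2r// ltW.
  by rewrite lerDl ?mulr_ge0 ?exprn_ge0 ?(ltW b0)//.
apply: (@le_trans _ _ (V * (b ^+ j * (K * b ^+ 2 * cabs (w - z) ^+ 2)))); last first.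
  by rewrite /L mulrDl -!mulrA lerDr ?mulr_ge0 ?exprn_ge0 ?rnorm_ge0 ?(ltW b0)//.
have hl := convergesB (convergesB (FP j w) (FP j z)) (convergesZ (w - z) (FP j.+1 z)).
have K' : 0 <= b ^+ j * (K * b ^+ 2 * cabs (w - z) ^+ 2).
  by rewrite ?mulr_ge0 ?exprn_ge0 ?rnorm_ge0 ?(ltW b0)//.
apply: (qlim_le (X := C^o) (q := q) (f := fun t => (laplace_kernel j w t : C^o) -
  laplace_kernel j z t - (w - z) *: (laplace_kernel j.+1 z t : C^o)) K'); last first.
  by apply: converges_ext hl => n; rewrite !qsumB qsumZ.
move=> t /andP[at_ tb].
have t0 : 0 <= t by rewrite (le_trans _ at_)// ltW.
set tc : C := (t%:C)%C.
have ht : cabs tc <= b by rewrite cabsR ger0_norm.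
have hzt x : cabs x <= `|r| -> cabs (- x * tc) <= `|r| * b.
  by move=> hx; rewrite cabsM rnormN ler_pM ?rnorm_ge0.
have [_ h] := hK (- z * tc) (- w * tc) (hzt _ hz') (hzt _ hw').
have -> : (laplace_kernel j w t : C^o) - laplace_kernel j z t -
     (w - z) *: (laplace_kernel j.+1 z t : C^o) =
   (- tc) ^+ j * (cexp (- w * tc) - cexp (- z * tc) -
      (- w * tc - - z * tc) * cexp (- z * tc)).
  rewrite /laplace_kernel -/tc -[_ *: (_ : C^o)]/((w - z) * ((- tc) ^+ j.+1 * cexp (- z * tc))).
  rewrite -[LHS]/((- tc) ^+ j * cexp (- w * tc) - (- tc) ^+ j * cexp (- z * tc) -
     (w - z) * ((- tc) ^+ j.+1 * cexp (- z * tc)) : C).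
  by rewrite exprS; ring.
rewrite cabsM cabsX rnormN; apply: ler_pM; rewrite ?exprn_ge0 ?rnorm_ge0//.
  by rewrite lerXn2r// nnegrE ?rnorm_ge0// ltW.
apply: (le_trans h); rewrite -mulrA ler_wpM2l//.
have -> : - w * tc - - z * tc = tc * (z - w) by ring.
rewrite cabsM exprMn rnorm_distC ler_wpM2r ?exprn_ge0 ?rnorm_ge0//.
by rewrite lerXn2r// nnegrE ?rnorm_ge0// ltW.
Qed.

(** The measure does not charge points below a > 0. *)
Lemma laplace_decay z : 0 <= complex.Re z ->
  cabs (F 0%N z) <= V * expR (- (a * complex.Re z)).
Proof.
move=> z0; apply: (qlim_le (X := C^o) _ _ (FP 0%N z)); first exact: expR_ge0.
move=> t /andP[at_ tb]; rewrite /laplace_kernel expr0 mul1r cabs_cexp ler_expR.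
case: z z0 => x y /= x0; rewrite !(mulr0, oppr0, subr0) mulNr lerN2.
by rewrite mulrC ler_wpM2l.
Qed.

(** The weights are real. *)
Lemma laplace_conj j z : F j ((z^*)%C) = ((F j z)^*)%C.
Proof.
have h1 := FP j ((z^*)%C).
have h2 : converges (X := C^o) (qsum q (X := C^o) (laplace_kernel j ((z^*)%C))) ((F j z)^*)%C.
  move=> e e0; have [N hN] := FP j z e0; exists N => n Nn.
  have := hN n Nn; rewrite -cabsJ rmorphB /=; congr (rnorm (_ - _) <= _).
  rewrite /qsum rmorph_sum; apply: eq_bigr => i _.
  have cM (x y : C) : ((x * y)^*)%C = (x^*)%C * (y^*)%C by exact: rmorphM.
  have cR (x : R) : ((x%:C)^*)%C = (x%:C)%C by rewrite /= oppr0.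
  have cN (x : C) : ((- x)^*)%C = - (x^*)%C by exact: rmorphN.
  have cX (x : C) k : ((x ^+ k)^*)%C = (x^*)%C ^+ k by exact: rmorphXn.
  have E (x t : R) : (((x%:C)%C * laplace_kernel j z t)^*)%C =
      (x%:C)%C * laplace_kernel j ((z^*)%C) t.
    by rewrite /laplace_kernel cM cR cM cX cN cR -cexp_conj cM cN cR.
  exact: E.
exact: converges_unique h1 h2.
Qed.

End LaplaceTransform.

(** * A mean value inequality for the squared modulus *)

Section Holo.
Context (R : realType).
Local Notation C := R[i].

(** Three derivatives are all that [four_point_mean] asks for; counting them makes
    closure under products and composition a plain induction. *)
Fixpoint holo (n : nat) (f : C -> C) : Prop :=
  if n is m.+1 then exists2 f1, has_deriv (E := C^o) f f1 & holo m f1 else True.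

Lemma holoW n f : holo n.+1 f -> holo n f.
Proof.
elim: n f => [//|n IH] f [f1 h hf1]; exists f1 => //; exact: IH.
Qed.

Lemma holoD n f g : holo n f -> holo n g -> holo n (fun z => f z + g z).
Proof.
elim: n f g => [//|n IH] f g [f1 hf nf] [g1 hg ng].
exists (fun z => f1 z + g1 z); [exact: has_derivD|exact: IH].
Qed.

Lemma holoM n f g : holo n f -> holo n g -> holo n (fun z => f z * g z).
Proof.
elim: n f g => [//|n IH] f g hhf hhg.
have nf0 := holoW hhf; have ng0 := holoW hhg.
move: hhf hhg => [f1 hf nf] [g1 hg ng].
exists (fun z => f1 z * g z + f z * g1 z); first exact: has_derivM.
by apply: holoD; exact: IH.
Qed.

Lemma holo_comp n f g : holo n f -> holo n g -> holo n (fun z => f (g z)).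
Proof.
elim: n f g => [//|n IH] f g [f1 hf nf] hhg; have ng0 := holoW hhg.
move: hhg => [g1 hg ng].
exists (fun z => g1 z * f1 (g z)); first exact: has_deriv_comp hf hg.
by apply: holoM => //; exact: IH.
Qed.

Lemma holo_chain n (fs : nat -> C -> C) :
  (forall j, has_deriv (E := C^o) (fs j) (fs j.+1)) -> holo n (fs 0%N).
Proof.
elim: n fs => [//|n IH] fs h; exists (fs 1%N) => //.
exact: IH (fun j => fs j.+1) (fun j => h j.+1).
Qed.

Lemma holo_cexp n : holo n (@cexp R).
Proof. exact: (@holo_chain n (fun=> @cexp R) (fun=> @has_deriv_cexp R)). Qed.

Lemma holo_cst n (c : C) : holo n (fun=> c).
Proof.
elim: n c => [//|n IH] c; exists (fun=> 0) => //; exact: has_deriv_cst.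
Qed.

Lemma holo_id n : holo n (fun z => z).
Proof.
case: n => [//|n]; exists (fun=> 1); [exact: has_deriv_id|exact: holo_cst].
Qed.

Lemma cabs_sqrB (p r : C) (e B : R) : cabs p <= B -> cabs r <= e ->
  cabs p ^+ 2 - 2 * B * e <= cabs (p + r) ^+ 2.
Proof.
move=> hp hr.
have p0 := @rnorm_ge0 R C^o p; have r0 := @rnorm_ge0 R C^o r.
have s0 := @rnorm_ge0 R C^o (p + r).
have h : cabs p - cabs r <= cabs (p + r).
  by have := @rnorm_lerB R C^o p (- r); rewrite rnormN opprK.
have hB : cabs p * cabs r <= B * e by apply: ler_pM.
have [d|d] := leP (cabs r) (cabs p); nra.
Qed.

(** For a quadratic polynomial the four values at h, -h, ih, -ih sum, in squared
    modulus, to 4 (|A|^2 + h^2 |B|^2 + h^4 |D|^2): the mixed terms cancel. *)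
Lemma four_point (A B D : C) (h : R) :
  4 * cabs A ^+ 2 <=
  cabs (A + B * (h%:C)%C + D * (h%:C)%C ^+ 2) ^+ 2 +
  cabs (A + B * (- (h%:C)%C) + D * (- (h%:C)%C) ^+ 2) ^+ 2 +
  cabs (A + B * ('i%C * (h%:C)%C) + D * ('i%C * (h%:C)%C) ^+ 2) ^+ 2 +
  cabs (A + B * (- ('i%C * (h%:C)%C)) + D * (- ('i%C * (h%:C)%C)) ^+ 2) ^+ 2.
Proof.
rewrite !cabs_sqr; case: A B D => a1 a2 [b1 b2] [d1 d2].
rewrite !expr2 /= !(mul0r, mulr0, subr0, addr0, add0r, mul1r, sub0r, oppr0).
set rhs := (X in _ <= X).
have -> : rhs = 4 * (a1 * a1 + a2 * a2) + 4 * (h ^+ 2 * (b1 ^+ 2 + b2 ^+ 2)) +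
   4 * (h ^+ 4 * (d1 ^+ 2 + d2 ^+ 2)) by rewrite /rhs; ring.
rewrite -addrA lerDl addr_ge0// mulr_ge0// mulr_ge0 ?addr_ge0 ?sqr_ge0//.
by rewrite -[4%N]/(2 * 2)%N exprM sqr_ge0.
Qed.

(** Discrete subharmonicity of |g|^2: up to a third order error, the mean of |g|^2
    at the four points p + h, p - h, p + ih, p - ih is at least |g(p)|^2. The error
    is of smaller order than h^2, so a strictly subharmonic perturbation makes one
    of the four values really larger. *)
Lemma four_point_mean (g : C -> C) : holo 3 g -> forall r : R, exists2 K : R, 0 <= K &
  forall p (h : R), cabs p <= r -> 0 <= h <= 1 ->
  4 * cabs (g p) ^+ 2 - K * h ^+ 3 <=
  cabs (g (p + (h%:C)%C)) ^+ 2 + cabs (g (p + (- (h%:C)%C))) ^+ 2 +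
  cabs (g (p + 'i%C * (h%:C)%C)) ^+ 2 + cabs (g (p + (- ('i%C * (h%:C)%C)))) ^+ 2.
Proof.
move=> [g1 h1 [g2 h2 [g3 h3 _]]] r.
pose fs (j : nat) : C -> C^o := nth g3 [:: g; g1; g2] j.
have hfs j : (j <= 2)%N -> has_deriv (fs j) (fs j.+1) by case: j => [|[|[|j]]].
have [K K0 hK] := taylor hfs (`|r| + 1).
have [B0 B00 hB0] := has_deriv_bound (`|r| + 1) h1.
have [B1 B10 hB1] := has_deriv_bound (`|r| + 1) h2.
have [B2 B20 hB2] := has_deriv_bound (`|r| + 1) h3.
pose B := B0 + B1 + B2.
have B_ge0 : 0 <= B by rewrite !addr_ge0.
exists (4 * (2 * B * K)) => [|p h pr /andP[h0 h11]]; first by rewrite !mulr_ge0.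
have pr' : cabs p <= `|r| + 1.
  by rewrite (le_trans pr)// (le_trans (ler_norm _))// lerDl.
have key w : cabs w = h ->
   cabs (g p + g1 p * w + (g2 p / 2) * w ^+ 2) ^+ 2 - 2 * B * (K * h ^+ 3)
     <= cabs (g (p + w)) ^+ 2.
  move=> wh.
  have hpw : cabs (p + w) <= `|r| + 1.
    apply: le_rnormD; last by rewrite wh.
    by rewrite (le_trans pr)// ler_norm.
  have := hK p (p + w) pr' hpw.
  rewrite !big_ord_recl big_ord0 /fs /= /bump /= !addrA [p + w - p]addrAC subrr add0r wh.
  rewrite !fact0 !factS fact0 !muln1 expr0 expr1 addr0 divr1 scale1r.
  set r3 := (X in cabs X <= _) => hr3.
  have -> : g (p + w) = (g p + g1 p * w + (g2 p / 2) * w ^+ 2) + r3.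
    rewrite /r3 -[_ *: (g1 p : C^o)]/(_ * g1 p) -[_ *: (g2 p : C^o)]/(_ * g2 p).
    rewrite -[RHS]/(g p + g1 p * w + (g2 p / 2) * w ^+ 2 +
      (g (p + w) - (g p + w / 1 * g1 p + (w ^+ 2 / 2) * g2 p)) : C).
    by rewrite divr1; ring.
  apply: cabs_sqrB => //.
  have [_ c0 _ _] := hB0 p p pr' pr'; have [_ c1 _ _] := hB1 p p pr' pr'.
  have [_ c2 _ _] := hB2 p p pr' pr'.
  apply: le_rnormD; first apply: le_rnormD => //.
    by rewrite cabsM wh -[B1]mulr1 ler_pM ?rnorm_ge0.
  rewrite cabsM [cabs (g2 p / 2)]cabsM cabsX wh.
  have c2' : cabs (2^-1 : C) <= 1.
    rewrite cabsV (_ : 2 = ((2 : R)%:C)%C) ?cabsR ?rmorph_nat//.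
    by rewrite normr_nat invf_le1// ler1n.
  rewrite -[B2]mulr1 ler_pM ?mulr_ge0 ?exprn_ge0 ?rnorm_ge0//.
    by rewrite -[B2]mulr1 ler_pM ?rnorm_ge0.
  by rewrite exprn_ile1.
have hh : cabs ((h%:C)%C : C) = h by rewrite cabsR ger0_norm.
have hi : cabs ('i%C * (h%:C)%C : C) = h.
  by rewrite cabsM hh cabs_def /= expr0n expr1n add0r sqrtr1 mul1r.
have k1 := key (h%:C)%C hh.
have k2 := key (- (h%:C)%C) (etrans (rnormN _) hh).
have k3 := key ('i%C * (h%:C)%C) hi.
have k4 := key (- ('i%C * (h%:C)%C)) (etrans (rnormN _) hi).
have := four_point (g p) (g1 p) (g2 p / 2) h.
lra.
Qed.

End Holo.

(** * Leaving a maximum in a complex direction *)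

Section Contact.
Context (R : realType).
Local Notation C := R[i].
Context (F : nat -> C -> C) (x0 M : R).
Hypotheses (dF : forall j, has_deriv (E := C^o) (F j) (F j.+1)).
Hypotheses (x00 : 0 < x0) (M0 : 0 < M).
Local Notation xC := ((x0%:C)%C : C).
Hypotheses (FM : cabs (F 0%N xC) = M) (Freal : forall j, complex.Im (F j xC) = 0).
Hypothesis Fnz : exists2 j, (0 < j)%N & F j xC != 0.

(** A complex n-th root of 1 or of -1 turns the leading term of F - F(x0) into a real
    number of the wanted sign. *)
Lemma root_sign (n : nat) (s : bool) : (0 < n)%N ->
  exists2 tau : C, cabs tau = 1 & tau ^+ n = (-1) ^+ s.
Proof.
move=> n0; case: s; last by exists 1; rewrite ?cabs1// expr1n.
exists (cexp ('i%C * ((pi / n%:R)%:C)%C)).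
  by rewrite cabs_cexp /= !(mul0r, mulr0, oppr0, subr0, addr0) expR0.
rewrite -cexp_nat (_ : n%:R * _ = 'i%C * (pi%:C)%C).
  rewrite /cexp /= !(mul0r, mulr0, mul1r, oppr0, subr0, add0r, addr0) expR0 !mul1r.
  by rewrite cospi sinpi expr1; apply/eqP; rewrite eq_complex /= oppr0 !eqxx.
rewrite mulrCA; congr (_ * _).
rewrite (_ : n%:R = ((n%:R : R)%:C)%C); last by rewrite rmorph_nat.
by rewrite -rmorphM mulrCA divff ?mulr1// pnatr_eq0 -lt0n.
Qed.

(** Let n be the order of the first nonzero derivative of F at x0. In a suitable
    direction tau the leading term has the same sign as F(x0), so |F| exceeds
    M = |F(x0)| by at least a multiple of r^n at distance r. The ray is taken in the
    coordinate log z, where the path of the next part is drawn. *)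
Lemma contact_direction : exists (n : nat) (kappa c r0 : R) (tau : C),
  [/\ 0 < kappa, 0 < c, 0 < r0 <= 1, cabs tau = 1 &
   forall r : R, 0 <= r <= r0 ->
     let z := xC * cexp ((r%:C)%C * tau) in
     kappa * cabs (z - xC) ^+ n <= cabs (F 0%N z) - M /\
     c * r ^+ n <= cabs (F 0%N z) - M].
Proof.
have exn : exists n, (0 < n)%N && (F n xC != 0).
  by case: Fnz => j j0 Fj; exists j; rewrite j0.
case: (ex_minnP exn) => n /andP[n0 Fn] nmin.
have [s sE] : exists s : R, F 0%N xC = (s%:C)%C.
  exists (complex.Re (F 0%N xC)); have := Freal 0%N.
  by case: (F 0%N xC) => ? ? /= ->.
have [al alE] : exists al : R, F n xC / n`!%:R = (al%:C)%C.
  exists (complex.Re (F n xC) / n`!%:R); have := Freal n.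
  case: (F n xC) => u v /= ->.
  by rewrite rmorphM /= fmorphV rmorph_nat.
have sM : `|s| = M by rewrite -FM sE cabsR.
have al0 : al != 0.
  apply/eqP => h; move: alE; rewrite h => /eqP; rewrite mulf_eq0 (negbTE Fn) /=.
  by rewrite invr_eq0 pnatr_eq0 eqn0Ngt fact_gt0.
have [tau tau1 taun] := root_sign (al * s < 0)%R n0.
pose al' := (-1) ^+ (al * s < 0)%R * al.
have al'a : `|al'| = `|al| by rewrite /al' normrM normrX normrN1 expr1n mul1r.
have al's : 0 <= al' * s.
  rewrite /al'; case: ltP => h; rewrite ?expr1 ?expr0; last by rewrite mul1r.
  by rewrite -mulrA mulN1r oppr_ge0 ltW.
have taunA : tau ^+ n * (F n xC / n`!%:R) = (al'%:C)%C.
  by rewrite taun alE /al' rmorphM /= rmorphXn rmorphN1.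
pose e1 : R := 4 * expR 1.
have e10 : 0 < e1 by rewrite mulr_gt0// expR_gt0.
pose c1 := 1 + e1.
have c10 : 0 < c1 by rewrite addr_gt0.
have [K K0 hK] := @taylor R C^o F n (fun j _ => dF j) (x0 + x0 * c1).
have [K1 K10 hK1] := has_deriv_bound 2 (has_derivX n (@has_deriv_id R)).
pose Q := `|al| * K1 * e1 + K * x0 * c1 ^+ n.+1 + 1.
have Q0 : 0 < Q.
  by rewrite ltr_wpDl// addr_ge0 ?mulr_ge0 ?exprn_ge0 ?(ltW e10) ?(ltW x00) ?(ltW c10).
have ala : 0 < `|al| by rewrite normr_gt0.
pose r0 := Num.min (Num.min 1 e1^-1) (`|al| / 2 / Q).
have r00 : 0 < r0 by rewrite !lt_min ltr01 invr_gt0 e10 !divr_gt0.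
have c1n : 0 < c1 ^+ n by rewrite exprn_gt0.
exists n, (`|al| / 2 / c1 ^+ n), (`|al| / 2 * x0 ^+ n), r0, tau; split => //.
- by rewrite !divr_gt0.
- by rewrite mulr_gt0 ?divr_gt0// exprn_gt0.
- by rewrite r00 /= !ge_min lexx.
move=> r /andP[rge0 rr0] z.
have [r_eq0|rn0] := eqVneq r 0.
  rewrite /z r_eq0 rmorph0 mul0r cexp0 mulr1 FM !subrr rnorm0 !expr0n.
  by rewrite (gtn_eqF n0) !mulr0.
have rgt0 : 0 < r by rewrite lt_neqAle eq_sym rn0.
move: rr0; rewrite !le_min => /andP[/andP[r1 re] rQ].
pose w := (r%:C)%C * tau.
have wr : cabs w = r by rewrite cabsM tau1 mulr1 cabsR gtr0_norm.
have w0 : w != 0 by apply/eqP => h; move: wr rgt0; rewrite h rnorm0 => <-; rewrite ltxx.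
(* z - x0 = x0 w (1 + ep) with ep of order r: to first order the ray in log z is
   a ray in z of direction tau *)
pose ep := (cexp w - 1 - w) / w.
have epr : cabs ep <= e1 * r.
  rewrite cabsM cabsV wr ler_pdivrMr// -mulrA -expr2.
  by rewrite -wr; apply: cexp_taylor1; rewrite wr.
have ep1 : cabs ep <= 1.
  by rewrite (le_trans epr)// mulrC -ler_pdivlMr// mul1r.
have zE : z - xC = xC * w * (1 + ep).
  by rewrite /ep /z mulrDr mulr1 -mulrA (mulrC w) divfK// -/w; ring.
have hep : cabs (1 + ep) <= c1.
  apply: le_rnormD; first by rewrite cabs1.
  by rewrite (le_trans epr)// ler_piMr// ltW.
have etaE : cabs (z - xC) = x0 * r * cabs (1 + ep).
  by rewrite zE cabsM [cabs (xC * w)]cabsM cabsR wr gtr0_norm.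
have xr0 : 0 < x0 * r by rewrite mulr_gt0.
have etale : cabs (z - xC) <= x0 * r * c1 by rewrite etaE ler_wpM2l// ltW.
have zball : cabs z <= x0 + x0 * c1.
  rewrite -(subrK xC z) addrC; apply: le_rnormD; first by rewrite cabsR gtr0_norm.
  rewrite (le_trans etale)// -mulrA ler_wpM2l ?(ltW x00)//.
  by rewrite ler_piMl// ltW.
have xball : cabs xC <= x0 + x0 * c1.
  by rewrite cabsR gtr0_norm// lerDl mulr_ge0// ltW.
have := hK xC z xball zball.
rewrite big_ord_recr /= (_ : \sum_(i < n) _ = F 0%N xC); last first.
  case: n n0 nmin {Fn alE taun taunA hK hK1 Q Q0 r0 r00 rQ c1n} => [//|n] _ nmin.
  rewrite big_ord_recl expr0 fact0 divr1 scale1r big1 ?addr0// => i _.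
  have [->|h] := eqVneq (F (bump 0 i) xC) 0; first by rewrite scaler0.
  by have := nmin (bump 0 i); rewrite h /= => /(_ isT); rewrite leqNgt /bump /= add1n ltnS ltn_ord.
have -> : ((z - xC) ^+ n / n`!%:R) *: (F n xC : C^o) =
    ((al' * (x0 * r) ^+ n)%:C)%C * (1 + ep) ^+ n.
  have -> : ((al' * (x0 * r) ^+ n)%:C)%C = (al'%:C)%C * (xC * (r%:C)%C) ^+ n.
    by rewrite -rmorphM -rmorphXn -rmorphM.
  rewrite -[LHS]/((z - xC) ^+ n / n`!%:R * F n xC) zE -taunA /w !exprMn.
  by ring.
set T := (_ * (1 + ep) ^+ n) => hT.
have e1b : cabs (1 : C) <= 2 by rewrite cabs1 ler1n.
have e2b : cabs (1 + ep) <= 2 by rewrite (le_trans (rnormD _ _))// cabs1 [2](_ : _ = 1 + 1)// lerD2l.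
have [_ _ hpow _] := hK1 1 (1 + ep) e1b e2b.
rewrite expr1n addrAC subrr add0r in hpow.
pose P := (al' * (x0 * r) ^+ n).
(* al' has the sign of s = F(x0), by the choice of tau *)
have PE : `|s + P| = M + `|al| * (x0 * r) ^+ n.
  have P1 : `|P| = `|al| * (x0 * r) ^+ n.
    by rewrite normrM al'a ger0_norm// exprn_ge0// ltW.
  have Ps : 0 <= P * s by rewrite /P mulrAC mulr_ge0// exprn_ge0// ltW.
  rewrite -P1 -sM; have [p0|p0] := leP 0 P; have [q0|q0] := leP 0 s.
  - by rewrite !ger0_norm ?addr_ge0// addrC.
  - have -> : P = 0 by nra.
    by rewrite addr0 normr0 addr0.
  - have -> : s = 0 by nra.
    by rewrite add0r normr0 add0r.
  - by rewrite !ltr0_norm//; lra.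
pose Er := F 0%N z - F 0%N xC - T.
have ErE : cabs Er <= K * (x0 * r * c1) ^+ n.+1.
  rewrite /Er -addrA -opprD; apply: (le_trans hT); rewrite ler_wpM2l//.
  by rewrite lerXn2r// nnegrE ?rnorm_ge0// !mulr_ge0// ltW.
have TE : cabs (T - (P%:C)%C) <= `|al| * (x0 * r) ^+ n * (K1 * (e1 * r)).
  rewrite /T -/P -[X in _ - X]mulr1 -mulrBr cabsM cabsR normrM al'a.
  rewrite [`|(x0 * r) ^+ n|]ger0_norm ?exprn_ge0 ?(ltW xr0)//.
  apply: ler_wpM2l; first by rewrite mulr_ge0// exprn_ge0// ltW.
  by apply: (le_trans hpow); rewrite ler_wpM2l.
have low : M + `|al| * (x0 * r) ^+ n - (K * (x0 * r * c1) ^+ n.+1 +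
   `|al| * (x0 * r) ^+ n * (K1 * (e1 * r))) <= cabs (F 0%N z).
  rewrite lerBlDr -PE -cabsR rmorphD /= -sE.
  have -> : F 0%N xC + (P%:C)%C = F 0%N z - (Er + (T - (P%:C)%C)).
    by rewrite /Er; ring.
  rewrite (le_trans (rnormB _ _))// lerD2l.
  exact: le_rnormD.
have main : `|al| / 2 * (x0 * r) ^+ n <= cabs (F 0%N z) - M.
  rewrite lerBrDr (le_trans _ low)//.
  have xrn : 0 < (x0 * r) ^+ n by rewrite exprn_gt0.
  have -> : K * (x0 * r * c1) ^+ n.+1 = (x0 * r) ^+ n * (K * x0 * c1 ^+ n.+1 * r).
    by rewrite exprMn [(x0 * r) ^+ n.+1]exprSr; ring.
  have hQ : K * x0 * c1 ^+ n.+1 * r + `|al| * K1 * e1 * r <= `|al| / 2.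
    rewrite -mulrDl (le_trans _ (_ : Q * r <= _))//; last first.
      by rewrite mulrC -ler_pdivlMr.
    by rewrite ler_wpM2r// /Q; lra.
  have := ler_wpM2l (ltW xrn) hQ; nra.
split.
  apply: le_trans main; rewrite -[leLHS]mulrA ler_wpM2l//.
  rewrite mulrC ler_pdivrMr// -exprMn lerXn2r// nnegrE ?rnorm_ge0//.
  by rewrite mulr_ge0 ?(ltW xr0) ?(ltW c10).
by apply: le_trans main; rewrite -[leLHS]mulrA -exprMn.
Qed.

End Contact.

(** * A path around the origin *)

Section Joined.
Context (R : realType).
Local Notation C := R[i].

Definition on_segment (G : C -> Prop) (p q : C) :=
  forall t : R, 0 <= t <= 1 -> G (p + (t%:C)%C * (q - p)).

(** Polygonal lines in G, with their length; the induction principle is what the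
    mean value inequality along a path needs. *)
Inductive joined (G : C -> Prop) (p : C) : R -> C -> Prop :=
| joined_refl : joined G p 0 p
| joined_step L q r : joined G p L q -> on_segment G q r ->
    joined G p (L + cabs (r - q)) r.

Lemma joined_sub (G G' : C -> Prop) p L q : (forall z, G z -> G' z) ->
  joined G p L q -> joined G' p L q.
Proof.
move=> GG'; elim=> [|{}L {}q r _ IH h]; first exact: joined_refl.
by apply: joined_step => // t /h /GG'.
Qed.

Lemma joined_ge0 G p L q : joined G p L q -> 0 <= L.
Proof. by elim=> // {}L {}q r _ IH _; rewrite addr_ge0// rnorm_ge0. Qed.

Lemma joined_mvt (E : normedModType C) (f f1 : C -> E) G p L q (e : R) :
  has_deriv f f1 -> (forall z, G z -> rnorm (f1 z) <= e) ->
  joined G p L q -> rnorm (f q - f p) <= e * L.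
Proof.
move=> hf he; elim=> [|{}L {}q r _ IH h].
  by rewrite subrr rnorm0 mulr0.
rewrite -(subrK (f q) (f r)) -addrA mulrDr addrC; apply: le_rnormD => //.
by apply: (has_deriv_mvt hf) => t /h /he.
Qed.

Lemma joined_conj (G G' : C -> Prop) p L q : (forall z, G z -> G' ((z^*)%C)) ->
  joined G p L q -> joined G' ((p^*)%C) L ((q^*)%C).
Proof.
move=> GG'; elim=> [|{}L {}q r _ IH h]; first exact: joined_refl.
rewrite -[cabs _]cabsJ rmorphB; apply: joined_step => // t /h /GG'.
by rewrite rmorphD rmorphM rmorphB /= oppr0.
Qed.

End Joined.

Section Path.
Context (R : realType).
Local Notation C := R[i].
Context (F : nat -> C -> C) (a V x0 M : R).
Hypotheses (a0 : 0 < a) (V0 : 0 <= V).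
Hypotheses (dF : forall j, has_deriv (E := C^o) (F j) (F j.+1)).
Hypothesis decay : forall z, 0 <= complex.Re z ->
  cabs (F 0%N z) <= V * expR (- (a * complex.Re z)).
Hypothesis F00 : F 0%N 0 = 0.
Hypotheses (x00 : 0 < x0) (M0 : 0 < M).
Local Notation xC := ((x0%:C)%C : C).
Hypotheses (FM : cabs (F 0%N xC) = M) (Freal : forall j, complex.Im (F j xC) = 0).
Hypothesis Fnz : exists2 j, (0 < j)%N & F j xC != 0.

Let D l := F 0%N (cexp l).
Let l0 : C := ((ln x0)%:C)%C.

(** Here l stands for log z. Along the path either |F| exceeds M, up to a factor
    vanishing to order n at x0, or z stays in a left half-plane: these are the two
    cases in which resolvents can be bounded. All constants are uniform along the
    path, and rho bounds |l|. *)
Definition tame n (kappa rho : R) (l : C) := cabs l <= rho /\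
  (kappa * cabs (cexp l - xC) ^+ n <= cabs (F 0%N (cexp l)) - M \/
   kappa <= - complex.Re (cexp l)).

Definition reach n p := exists kappa rho L, 0 < kappa /\ joined (tame n kappa rho) l0 L p.

Lemma tame_le n k k' rho rho' l : k <= k' -> rho' <= rho ->
  tame n k' rho' l -> tame n k rho l.
Proof.
move=> kk rr [h1 h2]; split; first exact: le_trans h1 rr.
case: h2 => h; [left|right]; last exact: le_trans h.
by apply: le_trans h; rewrite ler_wpM2r// exprn_ge0// rnorm_ge0.
Qed.

(** On a segment where |F| > M + c the factor |z - x0|^n is bounded, so such segments
    are harmless whatever n is. *)
Lemma reach_step n p q (c : R) : reach n p -> 0 < c ->
  on_segment (fun l => M + c <= cabs (D l) \/ c <= - complex.Re (cexp l)) p q ->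
  reach n q.
Proof.
move=> [k [rho [L [k0 hj]]]] c0 hs.
pose rho' := Num.max rho (cabs p + cabs q).
pose B := expR rho' + x0.
have B0 : 0 <= B by rewrite addr_ge0 ?expR_ge0// ltW.
have Bn : 0 <= B ^+ n by exact: exprn_ge0.
pose k' := Num.min k (Num.min c (c / (B ^+ n + 1))).
have k'0 : 0 < k' by rewrite !lt_min k0 c0 divr_gt0// ltr_wpDl.
exists k', rho', (L + cabs (q - p)); split=> //.
apply: joined_step.
  apply: joined_sub hj => z; apply: tame_le; first by rewrite ge_min lexx.
  by rewrite le_max lexx.
move=> t t01; have ht := le_cabs_segment p q t01.
have hr : cabs (p + (t%:C)%C * (q - p)) <= rho' by rewrite (le_trans ht)// le_max lexx orbT.
split=> //; case: (hs t t01) => h; [left|right]; last first.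
  by apply: le_trans h; rewrite !ge_min lexx orbT.
apply: (@le_trans _ _ c); last by rewrite lerBrDr addrC.
have hB : cabs (cexp (p + (t%:C)%C * (q - p)) - xC) <= B.
  rewrite (le_trans (rnormB _ _))// lerD ?cabs_cexp_le//.
  by rewrite cabsR gtr0_norm.
apply: (@le_trans _ _ (c / (B ^+ n + 1) * B ^+ n)).
  apply: ler_pM; rewrite ?exprn_ge0 ?rnorm_ge0 ?(ltW k'0)//.
    by rewrite !ge_min lexx !orbT.
  by rewrite lerXn2r// nnegrE rnorm_ge0.
rewrite -mulrA ler_piMr ?(ltW c0)// mulrC ler_pdivrMr ?ltr_wpDl// mul1r.
by rewrite lerDl.
Qed.

Lemma cexp_l0 w : cexp (l0 + w) = xC * cexp w.
Proof. by rewrite cexpD cexpR lnK// posrE. Qed.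

Lemma first_point : exists n q c, [/\ reach n q, 0 < c, M + c <= cabs (D q) &
  `|complex.Im q| <= 1].
Proof.
have [n [kappa [c [r0 [tau [k0 c0 /andP[r00 r01] tau1 h]]]]]] :=
  contact_direction dF x00 FM Freal Fnz.
pose q := l0 + (r0%:C)%C * tau.
exists n, q, (c * r0 ^+ n); split.
- exists kappa, (cabs l0 + cabs q), (0 + cabs (q - l0)); split=> //.
  apply: joined_step; first exact: joined_refl.
  move=> t t01; split; first exact: le_cabs_segment.
  left; rewrite /q addrAC subrr add0r mulrA -rmorphM cexp_l0.
  have tr : 0 <= t * r0 <= r0.
    move: t01 => /andP[t0 t1]; rewrite mulr_ge0 ?(ltW r00)//=.
    by rewrite ler_piMl// ltW.
  by have [] := h (t * r0) tr.
- by rewrite mulr_gt0// exprn_gt0.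
- rewrite /D /q cexp_l0 addrC -lerBrDr.
  by have [] := h r0; rewrite ?lexx ?(ltW r00).
- rewrite /q (_ : complex.Im _ = complex.Im ((r0%:C)%C * tau)); last first.
    by case: ((r0%:C)%C * tau) => ? ? /=; rewrite add0r.
  by rewrite (le_trans (cabs_Im _))// cabsM tau1 mulr1 cabsR gtr0_norm.
Qed.

Section Ascent.
Context (n : nat) (q0 : C) (c0 : R).
Hypotheses (rq0 : reach n q0) (c00 : 0 < c0) (Dq0 : M + c0 <= cabs (D q0)).
Hypothesis (Iq0 : `|complex.Im q0| <= 1).
Hypothesis strip : forall p, reach n p -> `|complex.Im p| < pi -> `|complex.Im p| <= pi / 2.

Let X0 := V / (M * a).

Let hX0 : 0 <= X0. Proof. by rewrite divr_ge0// mulr_ge0// ltW. Qed.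

Let decay_X0 : V * expR (- (a * X0)) <= M.
Proof.
rewrite expRN -ler_pdivlMr ?invr_gt0 ?expR_gt0// invrK.
rewrite -ler_pdivrMl// (le_trans _ (expR_ge1Dx _))//.
rewrite /X0 (_ : a * _ = M^-1 * V); first by rewrite lerDr.
by field; rewrite !gt_eqF.
Qed.

(** In the right half-plane |F| is at most V exp(-a Re z), so it cannot exceed M far
    to the right. *)
Lemma Re_bounds p : M < cabs (D p) -> `|complex.Im p| <= pi / 2 ->
  0 <= complex.Re (cexp p) <= X0.
Proof.
move=> hD hI.
have x_ge0 : 0 <= complex.Re (cexp p).
  by rewrite /cexp /= mulr_ge0 ?expR_ge0// cos_ge0_pihalf// -ler_norml.
rewrite x_ge0 leNgt; apply/negP => h.
move: hD; apply/negP; rewrite -leNgt; apply: (le_trans (decay x_ge0)).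
apply: le_trans decay_X0; rewrite ler_wpM2l// ler_expR lerN2 ler_wpM2l ?(ltW a0)//.
exact: ltW.
Qed.

Let E := cabs (cexp q0) ^+ 2 + X0 ^+ 2 + 1.
Let E0 : 0 < E. Proof. by rewrite ltr_wpDl// addr_ge0// exprn_ge0// rnorm_ge0. Qed.
(* exp(eps E) is the factor that reduces the excess c0 to c0 / 2 *)
Let eps := ln ((M + c0) / (M + c0 / 2)) / E.
Let Mc0 : 0 < M + c0 / 2. Proof. by rewrite addr_gt0// divr_gt0. Qed.
Let Mc : 0 < M + c0. Proof. by rewrite addr_gt0. Qed.
Let epsE : expR (eps * E) = (M + c0) / (M + c0 / 2).
Proof. by rewrite /eps divfK ?gt_eqF// lnK// posrE divr_gt0. Qed.
Let eps0 : 0 < eps.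
Proof.
rewrite divr_gt0// ln_gt0// ltr_pdivlMr// mul1r ltrD2l.
by rewrite ltr_pdivrMr// ltr_pMr// ltr1n.
Qed.

Let g l := D l * cexp ((eps%:C)%C * (cexp l * cexp l)).

Let hologN m : holo m g.
Proof.
apply: holoM.
  by apply: holo_comp; [exact: holo_chain|exact: holo_cexp].
apply: (holo_comp (f := @cexp R)); first exact: holo_cexp.
by apply: holoM; [exact: holo_cst|apply: holoM; exact: holo_cexp].
Qed.

Let cabs_g l : cabs (g l) =
  cabs (D l) * expR (eps * (2 * complex.Re (cexp l) ^+ 2 - cabs (cexp l) ^+ 2)).
Proof.
rewrite cabsM cabs_cexp; congr (_ * expR _).
by rewrite cabs_sqr; case: (cexp l) => x y /=; rewrite mul0r subr0; ring.
Qed.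

Let G0 := (M + c0 / 2) * expR (eps * X0 ^+ 2).
Let G1 := (M + c0 / 4) * expR (eps * X0 ^+ 2).

Let g_q0 : G0 <= cabs (g q0).
Proof.
rewrite cabs_g.
apply: (@le_trans _ _ ((M + c0) * expR (- (eps * cabs (cexp q0) ^+ 2)))); last first.
  apply: ler_pM => //; rewrite ?expR_ge0 ?(ltW Mc)//.
  by rewrite ler_expR -mulrN ler_pM2l// lerDr mulr_ge0// sqr_ge0.
rewrite expRN ler_pdivlMr ?expR_gt0// /G0 -mulrA -expRD -ler_pdivlMl//.
rewrite [_^-1 * _]mulrC -epsE ler_expR -mulrDr ler_pM2l// /E; lra.
Qed.

(* |Im l| <= 2 in the strip, so delta (Im l)^2 is at most G0^2 - G1^2 *)
Let delta := (G0 ^+ 2 - G1 ^+ 2) / 4.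
Let G10 : 0 < G1. Proof. by rewrite mulr_gt0 ?expR_gt0// addr_gt0// divr_gt0. Qed.
Let G1G0 : G1 < G0.
Proof. by rewrite ltr_pM2r ?expR_gt0// ltrD2l ltr_pM2l// ltf_pV2 ?posrE// ltr_nat. Qed.
Let delta0 : 0 < delta.
Proof. by rewrite divr_gt0// subr_gt0 ltrXn2r// ?nnegrE ltW// (lt_trans G10). Qed.

Let psi l := cabs (g l) ^+ 2 + delta * complex.Im l ^+ 2.

Let Y2 := 2 * X0 ^+ 2 + V / (M * eps).

Lemma lower_zeta : exists2 y : R, 0 < y & forall p, M < cabs (D p) -> y <= cabs (cexp p).
Proof.
have [K K0 h] := has_deriv_bound 1 (dF 0).
exists (Num.min 1 (M / (K + 1))) => [|p hp].
  by rewrite lt_min ltr01 divr_gt0// ltr_wpDl.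
rewrite leNgt; apply/negP; rewrite lt_min => /andP[h1 h2].
have c01 : cabs (0 : C) <= 1 by rewrite rnorm0.
have [_ _ + _] := h 0 (cexp p) c01 (ltW h1); rewrite F00 !subr0 => hK.
have := lt_le_trans hp hK; apply/negP; rewrite -leNgt.
apply: (@le_trans _ _ ((K + 1) * cabs (cexp p))).
  by rewrite ler_wpM2r ?rnorm_ge0// lerDl.
by rewrite -ler_pdivlMl ?ltr_wpDl// mulrC ltW.
Qed.

(** The weight exp(eps z^2) of g is small for z of large imaginary part and bounded
    real part. So, as psi does not decrease along the ascent, z stays in a compact
    subset of the plane without 0 (near 0 the transform is small), and the loss
    caused by the weight is at most three quarters of the initial excess c0. *)
Lemma ascent_bounds : exists rho : R, forall p, M < cabs (D p) ->
  `|complex.Im p| <= pi / 2 -> cabs (g q0) ^+ 2 <= psi p ->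
  M + c0 / 4 <= cabs (D p) /\ cabs p <= rho.
Proof.
have [y y0 hy] := lower_zeta.
exists (Y2 + y^-1 + 2) => p hD hI hpsi.
have /andP[x_ge0 xX] := Re_bounds hD hI.
have I2 : `|complex.Im p| <= 2 by rewrite (le_trans hI)// ltW// pihalf_lt2.
have I4 : complex.Im p ^+ 2 <= 4.
  by rewrite -real_normK ?num_real// (_ : 4 = 2 ^+ 2) ?lerXn2r ?nnegrE//; ring.
have gG1 : G1 <= cabs (g p).
  rewrite -(@ler_pXn2r _ 2)// ?nnegrE ?rnorm_ge0 ?(ltW G10)//.
  have q2 : G0 ^+ 2 <= cabs (g q0) ^+ 2.
    by rewrite lerXn2r// ?nnegrE ?rnorm_ge0// (le_trans (ltW G10))// ltW.
  have := ler_wpM2l (ltW delta0) I4.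
  by move: hpsi q2; rewrite /psi /delta; lra.
have e2 : 2 * complex.Re (cexp p) ^+ 2 <= 2 * X0 ^+ 2.
  by rewrite ler_pM2l// lerXn2r// nnegrE.
have gle : cabs (g p) <= cabs (D p) * expR (eps * X0 ^+ 2).
  rewrite cabs_g ler_wpM2l ?rnorm_ge0// ler_expR ler_pM2l//.
  have -> : cabs (cexp p) ^+ 2 = complex.Re (cexp p) ^+ 2 + complex.Im (cexp p) ^+ 2.
    exact: cabs_sqr.
  have := sqr_ge0 (complex.Im (cexp p)).
  have : complex.Re (cexp p) ^+ 2 <= X0 ^+ 2 by rewrite lerXn2r// nnegrE.
  by lra.
split.
  by move: (le_trans gG1 gle); rewrite ler_pM2r ?expR_gt0.
have DV : cabs (D p) <= V.
  rewrite (le_trans (decay x_ge0))// ler_piMr//.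
  by rewrite -expR0 ler_expR oppr_le0 mulr_ge0// ltW.
have z2 : cabs (cexp p) ^+ 2 <= Y2.
  set zz := cabs (cexp p) ^+ 2.
  have : M <= V * expR (eps * (2 * X0 ^+ 2 - zz)).
    have MG : M <= G1.
      rewrite /G1 -[leLHS]mulr1 ler_pM ?(ltW M0)//; first by rewrite lerDl divr_ge0// ltW.
      by rewrite expR_ge1// mulr_ge0 ?sqr_ge0// ltW.
    apply: (le_trans MG); apply: (le_trans gG1); rewrite cabs_g.
    apply: ler_pM; rewrite ?rnorm_ge0 ?expR_ge0//.
    by rewrite ler_expR ler_pM2l// lerD2r.
  rewrite -[eps * _]opprK expRN ler_pdivlMr ?expR_gt0// => h.
  have h' : M * (1 - eps * (2 * X0 ^+ 2 - zz)) <= V.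
    by apply: le_trans h; rewrite ler_pM2l// expR_ge1Dx.
  have Me : 0 < M * eps by exact: mulr_gt0.
  rewrite /Y2 -lerBlDl ler_pdivlMr//; apply: le_trans h'.
  have -> : (zz - 2 * X0 ^+ 2) * (M * eps) = M * (eps * (zz - 2 * X0 ^+ 2)) by ring.
  by rewrite ler_pM2l//; lra.
have Y20 : 0 <= Y2.
  apply: addr_ge0; first by rewrite mulr_ge0 ?sqr_ge0.
  by apply: divr_ge0 => //; apply/ltW/mulr_gt0.
have Re1 : complex.Re p <= Y2.
  have : expR (complex.Re p) ^+ 2 <= Y2 by rewrite -cabs_cexp.
  rewrite -expRM_natl => h; have := le_trans (expR_ge1Dx _) h.
  by case: (leP 0 (complex.Re p)) => h0; lra.
have Re2 : - complex.Re p <= y^-1.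
  have := hy p hD; rewrite cabs_cexp => h.
  apply: (@le_trans _ _ (expR (- complex.Re p))).
    by rewrite (le_trans _ (expR_ge1Dx _))// lerDr.
  by rewrite expRN lef_pV2 ?posrE ?expR_gt0.
have yi0 : 0 <= y^-1 by rewrite invr_ge0 ltW.
apply: (le_trans (cabs_le _)); apply: lerD => //.
by rewrite ler_norml; apply/andP; split; lra.
Qed.

(** psi = |g|^2 + delta (Im l)^2 is strictly subharmonic because delta (Im l)^2 has
    Laplacian 2 delta; so among the four neighbours at distance h one has psi larger
    by delta h^2 / 4, and the constants are uniform on the compact set of
    [ascent_bounds]. *)
Lemma ascent_step : exists2 h : R, 0 < h & forall p, reach n p ->
  `|complex.Im p| <= pi / 2 -> M + c0 / 4 <= cabs (D p) -> cabs (g q0) ^+ 2 <= psi p ->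
  exists p', [/\ reach n p', `|complex.Im p'| <= pi / 2, M + c0 / 4 <= cabs (D p') &
    psi p + delta * h ^+ 2 / 4 <= psi p'].
Proof.
have [rho hrho] := ascent_bounds.
have [K K0 hK] := four_point_mean (hologN 3) rho.
have [D1 hD1 _] : holo 1 D by apply: holo_comp; [exact: holo_chain|exact: holo_cexp].
have [L L0 hL] := has_deriv_bound (rho + 1) hD1.
pose h := Num.min (Num.min (1 / 2) (delta / (K + 1))) (c0 / 8 / (L + 1)).
have K10 : 0 < K + 1 by rewrite ltr_wpDl.
have L10 : 0 < L + 1 by rewrite ltr_wpDl.
have c80 : 0 < c0 / 8 by rewrite divr_gt0.
have h0 : 0 < h.
  by rewrite !lt_min (divr_gt0 delta0 K10) (divr_gt0 c80 L10) divr_gt0.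
exists h => // p rp Ip Dp hpsi.
have MD : M < cabs (D p) by rewrite (lt_le_trans _ Dp)// ltrDl divr_gt0.
have [_ prho] := hrho p MD Ip hpsi.
have h12 : h <= 1 / 2 by rewrite !ge_min lexx.
have hd : h <= delta / (K + 1) by rewrite !ge_min lexx orbT.
have hc : h <= c0 / 8 / (L + 1) by rewrite !ge_min lexx orbT.
have h01 : 0 <= h <= 1 by rewrite (ltW h0) (le_trans h12)// ler_pdivrMr// mul1r ler1n.
have := hK p h prho h01.
set w1 := (h%:C)%C; set w2 := - w1; set w3 := 'i%C * w1; set w4 := - w3 => h4.
have I1 : complex.Im (p + w1) = complex.Im p by case: (p) => ? ? /=; rewrite addr0.
have I2 : complex.Im (p + w2) = complex.Im p by case: (p) => ? ? /=; rewrite subr0.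
have I3 : complex.Im (p + w3) = complex.Im p + h.
  by case: (p) => ? ? /=; rewrite mul0r mul1r add0r.
have I4 : complex.Im (p + w4) = complex.Im p - h.
  by case: (p) => ? ? /=; rewrite mul0r mul1r add0r.
have cw1 : cabs w1 = h by rewrite cabsR gtr0_norm.
have cw3 : cabs w3 = h by rewrite cabsM cw1 cabs_def /= expr0n expr1n add0r sqrtr1 mul1r.
have Kh : K * h ^+ 3 <= delta * h ^+ 2.
  rewrite exprS mulrA ler_wpM2r ?sqr_ge0//.
  apply: (@le_trans _ _ ((K + 1) * h)); first by rewrite ler_wpM2r ?(ltW h0)// lerDl.
  by rewrite mulrC -ler_pdivlMr// ltr_wpDl.
have sum : 4 * psi p + delta * h ^+ 2 <=
    psi (p + w1) + psi (p + w2) + psi (p + w3) + psi (p + w4).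
  rewrite /psi I1 I2 I3 I4.
  have -> : delta * (complex.Im p + h) ^+ 2 =
    delta * complex.Im p ^+ 2 + 2 * (delta * complex.Im p * h) + delta * h ^+ 2 by ring.
  have -> : delta * (complex.Im p - h) ^+ 2 =
    delta * complex.Im p ^+ 2 - 2 * (delta * complex.Im p * h) + delta * h ^+ 2 by ring.
  move: h4 Kh; set d2 := delta * h ^+ 2; set K3 := K * h ^+ 3.
  set di := delta * complex.Im p ^+ 2; set dih := delta * complex.Im p * h.
  lra.
(* otherwise the four values would sum to less than 4 psi p + delta h^2 *)
have [w [wh hw Iw]] : exists w, [/\ cabs w = h, psi p + delta * h ^+ 2 / 4 <= psi (p + w) &
    `|complex.Im (p + w)| <= `|complex.Im p| + h].
  have nh : `|h| = h by rewrite gtr0_norm.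
  have [c1|c1] := leP (psi p + delta * h ^+ 2 / 4) (psi (p + w1)).
    by exists w1; split=> //; rewrite I1 lerDl ltW.
  have [c2|c2] := leP (psi p + delta * h ^+ 2 / 4) (psi (p + w2)).
    by exists w2; split=> //; rewrite ?rnormN// I2 lerDl ltW.
  have [c3|c3] := leP (psi p + delta * h ^+ 2 / 4) (psi (p + w3)).
    by exists w3; split=> //; rewrite I3 (le_trans (ler_normD _ _))// nh.
  exists w4; split; rewrite ?rnormN//; last by rewrite I4 (le_trans (ler_normB _ _))// nh.
  move: c1 c2 c3 sum; set d2 := delta * h ^+ 2; lra.
have seg (t : R) : 0 <= t <= 1 ->
    M + c0 / 8 <= cabs (D (p + (t%:C)%C * (p + w - p))).
  move=> /andP[t0 t1]; rewrite addrAC subrr add0r.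
  have tw : cabs ((t%:C)%C * w) <= h.
    by rewrite cabsM cabsR ger0_norm// wh ler_piMl// ltW.
  have pr1 : cabs p <= rho + 1 by rewrite (le_trans prho)// lerDl.
  have pt1 : cabs (p + (t%:C)%C * w) <= rho + 1.
    by apply: le_rnormD => //; rewrite (le_trans tw)//; case/andP: h01.
  have [_ _ + _] := hL p (p + (t%:C)%C * w) pr1 pt1.
  rewrite addrAC subrr add0r => lip.
  have Lh : L * h <= c0 / 8.
    apply: (@le_trans _ _ ((L + 1) * h)); first by rewrite ler_wpM2r ?(ltW h0)// lerDl.
    by rewrite mulrC -ler_pdivlMr// ltr_wpDl.
  have := @rnorm_lerB R C^o (D p) (D (p + (t%:C)%C * w)); rewrite rnorm_distC.
  have : L * cabs ((t%:C)%C * w) <= L * h by rewrite ler_wpM2l.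
  by move: lip Dp Lh; lra.
have rp' : reach n (p + w).
  apply: (reach_step rp (c := c0 / 8)); first by rewrite divr_gt0.
  by move=> t t01; left; exact: seg.
have Ip' : `|complex.Im (p + w)| <= pi / 2.
  apply: strip => //; apply: (le_lt_trans Iw).
  have := pihalf_ge1 R; have : pi = pi / 2 + pi / 2 :> R by rewrite -splitr.
  by move: Ip h12; lra.
have MD' : M < cabs (D (p + w)).
  have := seg 1; rewrite ler01 lexx rmorph1 mul1r [p + (_ - p)]addrC subrK => /(_ isT).
  by apply: lt_le_trans; rewrite ltrDl divr_gt0.
exists (p + w); split=> //.
have hpsi' : cabs (g q0) ^+ 2 <= psi (p + w).
  apply: (le_trans hpsi); apply: le_trans hw; rewrite lerDl.
  by rewrite divr_ge0// mulr_ge0 ?sqr_ge0// ltW.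
by have [] := hrho _ MD' Ip' hpsi'.
Qed.

(** The ascent could go on for ever while psi is bounded on a compact set. This plays
    the role of the Phragmen-Lindelof principle in the right half-plane. *)
Lemma ascent_absurd : False.
Proof.
have [h h0 step] := ascent_step.
have [rho hrho] := ascent_bounds.
have [g1 hg1 _] := hologN 1.
have [B B0 hB] := has_deriv_bound rho hg1.
pose d := delta * h ^+ 2 / 4.
have d0 : 0 < d by rewrite divr_gt0// mulr_gt0// exprn_gt0.
have iter_ k : exists p, [/\ reach n p, `|complex.Im p| <= pi / 2,
    M + c0 / 4 <= cabs (D p) & cabs (g q0) ^+ 2 + k%:R * d <= psi p].
  elim: k => [|k [p [rp Ip Dp hp]]].
    exists q0; split => //.
    - apply: strip => //; apply: (le_lt_trans Iq0).
      by have := pi_ge2 R; lra.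
    - by apply: le_trans Dq0; rewrite lerD2l ler_pdivrMr// ler_peMr ?(ltW c00)// ler1n.
    - by rewrite mul0r addr0 lerDl mulr_ge0 ?sqr_ge0// ltW.
  have hp' : cabs (g q0) ^+ 2 <= psi p.
    by apply: le_trans hp; rewrite lerDl mulr_ge0// ltW.
  have [p' [rp' Ip' Dp' hpp']] := step p rp Ip Dp hp'.
  exists p'; split=> //; apply: le_trans hpp'.
  by rewrite -natr1 mulrDl mul1r addrA lerD2r.
pose k := (Num.truncn ((B ^+ 2 + delta * 4) / d)).+1.
have [p [rp Ip Dp hp]] := iter_ k.
have hp' : cabs (g q0) ^+ 2 <= psi p.
  by apply: le_trans hp; rewrite lerDl mulr_ge0// ltW.
have MD : M < cabs (D p) by rewrite (lt_le_trans _ Dp)// ltrDl divr_gt0.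
have [_ prho] := hrho p MD Ip hp'.
have [_ gB _ _] := hB p p prho prho.
have kd : B ^+ 2 + delta * 4 < k%:R * d.
  by rewrite -ltr_pdivrMr// truncnS_gt.
have I2 : `|complex.Im p| <= 2 by rewrite (le_trans Ip)// ltW// pihalf_lt2.
have psiB : psi p <= B ^+ 2 + delta * 4.
  apply: lerD; first by rewrite lerXn2r// nnegrE rnorm_ge0.
  rewrite ler_pM2l// -real_normK ?num_real// (_ : 4 = 2 ^+ 2 :> R); last by ring.
  by rewrite lerXn2r// nnegrE.
have := sqr_ge0 (cabs (g q0)); move: psiB hp kd; lra.
Qed.

End Ascent.

(** Hence the reachable set is not confined to |Im l| <= pi / 2, the right
    half-plane of z. As the steps are short, the strip is left through a point with
    |Im l| < pi. *)
Lemma leaves_strip : exists n p, reach n p /\ pi / 2 < `|complex.Im p| < pi.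
Proof.
have [n [q [c [rq c0 Dq Iq]]]] := first_point.
apply: contrapT => h.
apply: (@ascent_absurd n q c rq c0 Dq Iq) => p rp Ipi.
rewrite leNgt; apply/negP => I2; apply: h; exists n, p; split=> //.
by rewrite I2 Ipi.
Qed.

(** From the point outside the right half-plane one continues along an arc of the
    circle |z| = constant, a vertical segment for l, up to the negative axis.
    There |Im l| = pi, so together with its conjugate the path winds once around 0. *)
Lemma winding_path : exists n kappa rho L l1, [/\ 0 < kappa,
  joined (tame n kappa rho) l0 L l1 & `|complex.Im l1| = pi].
Proof.
have [n [p [rp /andP[I1 I2]]]] := leaves_strip.
have [s s1 sE] : exists2 s : R, s = 1 \/ s = -1 & complex.Im p = s * `|complex.Im p|.
  have [h|h] := leP 0 (complex.Im p).
    by exists 1; [left|rewrite mul1r ger0_norm].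
  by exists (-1); [right|rewrite ltr0_norm// mulN1r opprK].
have cosM x : cos (s * x) = cos x by case: s1 => ->; rewrite ?mul1r// mulN1r cosN.
pose th := `|complex.Im p|.
have pi0 : 0 < pi :> R by exact: pi_gt0.
have th0 : 0 <= th <= pi by rewrite normr_ge0 ltW.
have costh : cos th < 0.
  rewrite -(cos_pihalf R) ltr_cos// in_itv //= .
  by rewrite ltW ?divr_gt0//= ler_pdivrMr// ler_pMr// ler1n.
pose l1 : C := (complex.Re p +i* (s * pi))%C.
pose c := expR (complex.Re p) * - cos th.
have c0 : 0 < c by rewrite mulr_gt0 ?expR_gt0// oppr_gt0.
have [k [rho [L [k0 hj]]]] : reach n l1.
  apply: (reach_step rp c0) => t /andP[t0 t1]; right.
  have -> : p + (t%:C)%C * (l1 - p) =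
      (complex.Re p +i* (s * ((1 - t) * th + t * pi)))%C.
    rewrite /l1 [p in LHS]complexE [in LHS]sE -/th.
    apply/eqP; rewrite eq_complex /=; apply/andP; split; apply/eqP; ring.
  rewrite /cexp /= cosM /c -mulrN ler_wpM2l ?expR_ge0// lerN2.
  move: th0 => /andP[th0 thpi].
  have thle : th <= (1 - t) * th + t * pi.
    have := ler_wpM2l t0 thpi; lra.
  have pile : (1 - t) * th + t * pi <= pi.
    have t1' : 0 <= 1 - t by lra.
    have := ler_wpM2l t1' thpi; lra.
  rewrite leNgt ltr_cos ?in_itv/= ?th0 ?thpi//; first by rewrite -leNgt.
  by rewrite pile (le_trans th0).
exists n, k, rho, L, l1; split=> //.
by case: s1 => E; rewrite /l1 /= E ?mul1r ?mulN1r ?normrN gtr0_norm.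
Qed.

End Path.

(** * Quadrature for a signed measure *)

Section ChargeQuadrature.
Context (R : realType) (mu : {charge set (measurableTypeR R) -> \bar R}).
Local Notation C := R[i].
Local Notation D := (@half_line R : set (measurableTypeR R)).
Local Notation pmass A := (fine (pos_part mu (A : set (measurableTypeR R)))).
Local Notation nmass A := (fine (neg_part mu (A : set (measurableTypeR R)))).

Section Fixed.
Context (a b : R).
Hypotheses (a0 : 0 < a) (ab : a < b).
Hypotheses (np : pos_part mu (~` `[a, b[%classic) = 0%E)
           (nn : neg_part mu (~` `[a, b[%classic) = 0%E).

Definition total_variation : R := pmass D + nmass D.

Lemma charge_weight_le n :
  \sum_(i < n.+1) `|pmass (cell a b n i) - nmass (cell a b n i)| <= total_variation.
Proof.
rewrite /total_variation (total_mass a0 ab np n) (total_mass a0 ab nn n) -big_split.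
apply: ler_sum => i _; apply: (le_trans (ler_normB _ _)).
by rewrite !ger0_norm// fine_ge0.
Qed.

Lemma node_bounds n (i : 'I_n.+1) : a <= node a b n i <= b.
Proof. by have /andP[-> /ltW] := node_in ab (ltn_ord i). Qed.

(** The weights are the masses of the cells for the signed measure, written as a
    difference because the Jordan parts are what integrals are defined from. *)
Definition charge_quad : quadrature a b total_variation :=
  @Quadrature R a b total_variation
    (fun n i => pmass (cell a b n i) - nmass (cell a b n i)) (node a b)
    charge_weight_le node_bounds.

Lemma charge_bochner_converges (X : completeNormedModType C) (f : R -> X) :
  eps_continuous f ->
  converges (qsum charge_quad f) (charge_bochner_integral mu D f).
Proof.
move=> fc; have := convergesB (bochner_converges a0 ab np fc) (bochner_converges a0 ab nn fc).
apply: converges_ext => n; rewrite /riemann_sum -sumrB; apply: eq_bigr => i _ /=.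
by rewrite -scalerBl -rmorphB.
Qed.

Lemma charge_integral_converges (f : R -> R) (fc : forall x, 0 < x -> {for x, continuous f})
    (e : R) : 0 < e -> exists N, forall n, (N <= n)%N ->
  `|\sum_(i < n.+1) weight charge_quad n i * f (point charge_quad n i) -
    charge_integral mu D f| <= e.
Proof.
move=> e0; have e20 : 0 < e / 2 by exact: divr_gt0.
have [N hN] := Rintegral_riemann a0 ab np fc e20.
have [N' hN'] := Rintegral_riemann a0 ab nn fc e20.
exists (maxn N N') => n; rewrite geq_max => /andP[Nn N'n].
have := hN n Nn; have := hN' n N'n; rewrite /charge_integral /=.
set I1 := Rintegral _ _ _; set I2 := Rintegral _ _ _.
set S2 := \sum_(i < n.+1) _; set S1 := \sum_(i < n.+1) _; set S := \sum_(i < n.+1) _.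
have -> : S = S1 - S2.
  by rewrite /S -sumrB; apply: eq_bigr => i _; rewrite mulrBl.
move=> h1 h2.
have -> : S1 - S2 - (I2 - I1) = (S1 - I2) - (S2 - I1) by ring.
by rewrite (splitr e) (le_trans (ler_normB _ _))// lerD.
Qed.

Lemma sum_weight n : mu D = 0%E -> \sum_(i < n.+1) weight charge_quad n i = 0.
Proof.
move=> muD; rewrite /= sumrB -(total_mass a0 ab np n) -(total_mass a0 ab nn n).
have mD : measurable D by exact: measurable_half_line.
have := jordan_decomp (hahn_posneg mu) mD; rewrite muD /cadd /= /cscale /= mulN1e => h.
have : fine (0%E : \bar R) = fine (pos_part mu D - neg_part mu D)%E by rewrite h.
by rewrite fineB ?fin_num_measure//= => <-.
Qed.

Definition cint (f : R -> C) : C :=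
  (charge_integral mu D (fun t => complex.Re (f t)) +i*
   charge_integral mu D (fun t => complex.Im (f t)))%C.

(** Complex integrals are only needed for the kernels; they are built from real
    ones. *)
Lemma cint_converges (f : R -> C) :
  (forall x, 0 < x -> {for x, continuous (fun t => complex.Re (f t))}) ->
  (forall x, 0 < x -> {for x, continuous (fun t => complex.Im (f t))}) ->
  converges (X := C^o) (qsum charge_quad (X := C^o) f) (cint f).
Proof.
move=> c1 c2 e e0; have e20 : 0 < e / 2 by exact: divr_gt0.
have [N hN] := charge_integral_converges c1 e20.
have [N' hN'] := charge_integral_converges c2 e20.
exists (maxn N N') => n; rewrite geq_max => /andP[Nn N'n].
apply: (le_trans (cabs_le _)); rewrite (splitr e).
have ReE : complex.Re (qsum charge_quad (X := C^o) f n) =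
    \sum_(i < n.+1) weight charge_quad n i * complex.Re (f (point charge_quad n i)).
  rewrite /qsum; elim/big_rec2: _ => [//|i u v _ <-].
  rewrite -[_ *: (_ : C^o)]/(_ * _); case: v (f _) => ? ? [? ?] /=.
  by rewrite mul0r subr0.
have ImE : complex.Im (qsum charge_quad (X := C^o) f n) =
    \sum_(i < n.+1) weight charge_quad n i * complex.Im (f (point charge_quad n i)).
  rewrite /qsum; elim/big_rec2: _ => [//|i u v _ <-].
  rewrite -[_ *: (_ : C^o)]/(_ * _); case: v (f _) => ? ? [? ?] /=.
  by rewrite mul0r addr0.
have := hN n Nn; have := hN' n N'n; rewrite -ReE -ImE.
by case: (qsum _ _ _) => u v /= h1 h2; apply: lerD.
Qed.

End Fixed.
End ChargeQuadrature.

Lemma has_deriv_continuous (R : realType) (f f1 : R[i] -> R[i]) :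
  has_deriv (E := R[i]^o) f f1 -> forall x : R,
  {for x, continuous (fun t : R => complex.Re (f ((t%:C)%C)))} /\
  {for x, continuous (fun t : R => complex.Im (f ((t%:C)%C)))}.
Proof.
move=> hf x.
have [K K0 hK] := has_deriv_bound (`|x| + 1) hf.
have lip t : `|x - t| < 1 -> cabs (f ((t%:C)%C) - f ((x%:C)%C)) <= K * `|x - t|.
  move=> xt.
  have hx : cabs ((x%:C)%C : R[i]) <= `|x| + 1 by rewrite cabsR lerDl.
  have ht : cabs ((t%:C)%C : R[i]) <= `|x| + 1.
    rewrite cabsR -(subrK x t) addrC (le_trans (ler_normD _ _))// lerD2l.
    by rewrite distrC ltW.
  have [_ _ + _] := hK _ _ hx ht; by rewrite -rmorphB cabsR distrC.
have key (p : R[i] -> R) : (forall z w, p (z - w) = p z - p w) ->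
    (forall z, `|p z| <= cabs z) -> {for x, continuous (fun t : R => p (f ((t%:C)%C)))}.
  move=> pB ple; apply/cvgrPdist_le => e e0.
  apply/nbhs_ballP; exists (Num.min 1 (e / (K + 1))).
    by rewrite /= lt_min ltr01 divr_gt0// ltr_wpDl.
  move=> t; rewrite /ball /= lt_min => /andP[t1 te].
  rewrite distrC -pB (le_trans (ple _))// (le_trans (lip t t1))//.
  apply: (@le_trans _ _ ((K + 1) * `|x - t|)); first by rewrite ler_wpM2r// lerDl.
  by rewrite mulrC -ler_pdivlMr ?ltr_wpDl// ltW.
split; apply: key.
- by move=> [? ?] [? ?].
- exact: cabs_Re.
- by move=> [? ?] [? ?].
- exact: cabs_Im.
Qed.

(** * Exponentials as limits of powers *)

Section ExpSeries.
Context (R : realType).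

(** The partial sums of exp converge uniformly on [-B, B], being dominated by those
    at B. *)
Lemma exp_partial_sums (B e : R) : 0 <= B -> 0 < e ->
  exists k : nat, forall y, `|y| <= B ->
    `|expR y - \sum_(j < k.+1) y ^+ j / j`!%:R| <= e.
Proof.
move=> B0 e0.
pose S (y : R) (m : nat) := \sum_(j < m) y ^+ j / j`!%:R.
have SE y : series (exp_coeff y) = S y.
  by apply/funext => m; rewrite /series /= big_mkord.
have cS y : S y m @[m --> \oo] --> expR y.
  by rewrite -SE; exact: is_cvg_series_exp_coeff.
have Sdiff y n d : S y (n + d)%N - S y n = \sum_(n <= j < n + d) y ^+ j / j`!%:R.
  rewrite /S -!(big_mkord xpredT (fun j => y ^+ j / j`!%:R)).
  by rewrite (@big_cat_nat _ _ _ n) ?leq_addr//= addrAC subrr add0r.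
have Sle y n d : `|y| <= B -> `|S y (n + d)%N - S y n| <= S B (n + d)%N - S B n.
  move=> yB; rewrite !Sdiff; apply: (le_trans (ler_norm_sum _ _ _)).
  apply: ler_sum => j _; rewrite normrM normrX [`|_^-1|]ger0_norm ?invr_ge0//.
  by rewrite ler_wpM2r ?invr_ge0// lerXn2r// nnegrE.
have e20 : 0 < e / 2 by exact: divr_gt0.
have /cvgrPdist_le /(_ _ e20)[N _ hN] := cS B.
exists N => y yB; rewrite -/(S y N.+1).
have key d : `|S y (N.+1 + d)%N - S y N.+1| <= e.
  apply: (le_trans (Sle y N.+1 d yB)).
  have /= h1 := hN N.+1 (leqnSn N).
  have /= h2 := hN (N.+1 + d)%N (leq_trans (leqnSn N) (leq_addr _ _)).
  have -> : S B (N.+1 + d)%N - S B N.+1 = (expR B - S B N.+1) - (expR B - S B (N.+1 + d)%N).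
    by ring.
  by rewrite (le_trans (ler_norm _))// (le_trans (ler_normB _ _))// (splitr e) lerD.
apply/ler_addgt0Pl => d d0.
have /cvgrPdist_le /(_ _ d0)[N' _ hN'] := cS y.
have /= h := hN' (N.+1 + N')%N (leq_addl _ _).
rewrite -(subrK (S y (N.+1 + N')%N) (expR y)) -addrA.
by rewrite (le_trans (ler_normD _ _))// lerD.
Qed.

End ExpSeries.

Section QuadratureExp.
Context (R : realType) (a b V : R) (q : quadrature a b V).
Local Notation C := R[i].
Hypothesis V0 : 0 <= V.
Local Notation cv := (@converges R (R[i])^o).
Local Notation qs := (@qsum R a b V q (R[i])^o).

(** The exponential is a uniform limit of its Taylor polynomials on the bounded
    range of phi, and every positive power integrates to 0; only the constant term
    is left. *)
Lemma exp_power_moments (w phi : R -> R) (W B : R) (l0 l : C) :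
  (forall t, a <= t <= b -> `|w t| <= W) -> (forall t, a <= t <= b -> `|phi t| <= B) ->
  0 <= W -> 0 <= B ->
  cv (qs (fun t => ((w t)%:C)%C)) l0 ->
  (forall j, cv (qs (fun t => ((w t * phi t ^+ j.+1)%:C)%C)) 0) ->
  cv (qs (fun t => ((w t * expR (phi t))%:C)%C)) l -> l = l0.
Proof.
move=> hw hphi W0 B0 hl0 hj hl.
apply/eqP; rewrite -subr_eq0; apply/eqP/(@rnorm_eq0 R (R[i])^o)/eqP.
rewrite eq_le rnorm_ge0 andbT; apply/ler_addgt0Pl => e e0; rewrite addr0.
have VW : 0 < V * W + 1 by rewrite ltr_wpDl// mulr_ge0.
have [k hk] := exp_partial_sums B0 (divr_gt0 e0 VW).
pose r t : C := ((w t * (expR (phi t) - \sum_(j < k.+1) phi t ^+ j / j`!%:R))%:C)%C.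
have hr : cv (qs r) (l - l0).
  have hs m : cv (qs (fun t => ((w t * \sum_(j < m) phi t ^+ j.+1 / j.+1`!%:R)%:C)%C)) 0.
    elim: m => [|m IH].
      apply: converges_ext (@converges_cst R (R[i])^o 0) => n.
      rewrite (_ : (fun t => _) = fun=> 0 : (R[i])^o).
        by rewrite /qsum big1// => i _; rewrite scaler0.
      by apply/funext => t; rewrite big_ord0 mulr0.
    have := convergesD IH (convergesZ ((((m.+1`!)%:R^-1 : R)%:C)%C) (hj m)).
    rewrite scaler0 addr0; apply: converges_ext => n; rewrite -qsumZ -qsumD.
    congr (qsum _ _ _); apply/funext => t; rewrite big_ord_recr /=.
    rewrite -[_ *: (_ : C^o)]/(_ * _ : C) -rmorphM -rmorphD; congr ((_%:C)%C); ring.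
  have := convergesB (convergesB hl (hs k)) hl0; rewrite subr0.
  apply: converges_ext => n; rewrite -!qsumB; congr (qsum _ _ _); apply/funext => t.
  rewrite /r big_ord_recl expr0 fact0 divr1 -!rmorphB; congr ((_%:C)%C).
  rewrite -[\sum_(i < k) _ in RHS]/(\sum_(i < k) phi t ^+ i.+1 / i.+1`!%:R).
  by ring.
apply: (@le_trans _ _ (V * (W * (e / (V * W + 1))))).
  apply: qlim_le hr; first by rewrite mulr_ge0// divr_ge0// ltW.
  move=> t tab; rewrite cabsR normrM ler_pM ?hw//; exact: hk (hphi t tab).
rewrite mulrA mulrCA ler_piMr ?(ltW e0)// ler_pdivrMr// mul1r lerDl//.
Qed.

End QuadratureExp.

Section Rays.
Context (R : realType) (nu : {finite_measure set (measurableTypeR R) -> \bar R}).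
Local Notation Bor := (set (measurableTypeR R)).
Local Notation D := (@half_line R : Bor).
Local Notation mass A := (fine (nu (A : Bor))).

(** A smooth approximation of the indicator of the ray ]c, oo[, analytic in
    exp(-nt). *)
Definition soft_ray (c y : R) (n : nat) (t : R) : R := expR (- y * expR (- (n%:R * (t - c)))).

Lemma soft_ray_pointwise (c y t : R) : 0 < y ->
  soft_ray c y n t @[n --> \oo] -->
    (\1_(`]c, +oo[%classic : Bor) t + expR (- y) * \1_([set c] : Bor) t : R).
Proof.
move=> y0.
have E1 : (t \in (`]c, +oo[%classic : Bor)) = (c < t)%R.
  by apply/idP/idP; rewrite inE /= in_itv /= andbT.
have E2 : (t \in ([set c] : Bor)) = (t == c).
  by apply/idP/idP => [|/eqP ->]; rewrite inE//= => ->.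
rewrite !indicE E1 E2.
apply/cvgrPdist_le => e e0.
have [tc|ct|->] := ltgtP t c.
- rewrite mulr0 addr0.
  have d0 : 0 < c - t by rewrite subr_gt0.
  exists (Num.truncn (y * (c - t) * e)^-1).+1 => // n /= hn.
  have yde : 0 < y * (c - t) * e by rewrite !mulr_gt0.
  have hn' : (y * (c - t) * e)^-1 <= n%:R.
    by rewrite ltW// (lt_le_trans (truncnS_gt _))// ler_nat.
  rewrite sub0r normrN ger0_norm ?expR_ge0// /soft_ray mulNr [expR (- (y * _))]expRN.
  have n0 : 0 < n%:R :> R by rewrite (lt_le_trans _ hn')// invr_gt0.
  have step : y * ((c - t) * n%:R) <= expR (y * expR (- (n%:R * (t - c)))).
    apply: (@le_trans _ _ (y * expR (- (n%:R * (t - c))))).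
      rewrite ler_pM2l// (le_trans _ (expR_ge1Dx _))//.
      by lra.
    by rewrite (le_trans _ (expR_ge1Dx _))// lerDr.
  rewrite invf_ple ?posrE ?expR_gt0//; apply: le_trans step.
  rewrite mulrA -ler_pdivrMl ?mulr_gt0//.
  by move: hn'; rewrite invfM.
- rewrite mulr0 addr0.
  have d0 : 0 < t - c by rewrite subr_gt0.
  exists (Num.truncn (y / ((t - c) * e))).+1 => // n /= hn.
  have hn' : y / ((t - c) * e) <= n%:R.
    by rewrite ltW// (lt_le_trans (truncnS_gt _))// ler_nat.
  set u := y * expR (- (n%:R * (t - c))).
  have u0 : 0 <= u by rewrite mulr_ge0 ?expR_ge0// ltW.
  have -> : soft_ray c y n t = expR (- u) by rewrite /soft_ray mulNr.
  have h1 : expR (- u) <= 1 by rewrite -expR0 ler_expR oppr_le0.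
  rewrite ger0_norm ?subr_ge0//.
  apply: (@le_trans _ _ u); first by have := expR_ge1Dx (- u); lra.
  rewrite /u expRN ler_pdivrMr ?expR_gt0//.
  have n0 : 0 <= n%:R :> R by [].
  have : y <= e * (n%:R * (t - c)).
    by move: hn'; rewrite ler_pdivrMr ?mulr_gt0//; lra.
  move=> /le_trans; apply; rewrite ler_pM2l// (le_trans _ (expR_ge1Dx _))//.
  by rewrite lerDr.
- exists 0%N => // n _; rewrite /= /soft_ray subrr mulr0 oppr0 expR0 mulr1 add0r.
  by rewrite mulr1 subrr normr0 ltW.
Qed.

(** The limit sees the atom at c with a weight exp(-y) that varies with y, so that
    two values of y separate the atom from the ray. *)
Lemma soft_ray_cvg (c y : R) : 0 < y ->
  Rintegral nu D (soft_ray c y n) @[n --> \oo] -->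
    mass (D `&` `]c, +oo[%classic) + expR (- y) * mass (D `&` [set c]).
Proof.
move=> y0.
have mD : measurable D by exact: measurable_half_line.
have mI : measurable (`]c, +oo[%classic : Bor) by exact: measurable_itv.
have mc : measurable ([set c] : Bor) by exact: measurable_set1.
pose f t : \bar R := (\1_(`]c, +oo[%classic : Bor) t + expR (- y) * \1_([set c] : Bor) t)%:E.
have IfE : (\int[nu]_(t in D) f t =
    (mass (D `&` `]c, +oo[%classic) + expR (- y) * mass (D `&` [set c]))%:E)%E.
  have m1 : measurable_fun D (fun t => (\1_(`]c, +oo[%classic : Bor) t)%:E : \bar R).
    by apply/measurable_EFinP; exact: measurable_indic.
  have m2 : measurable_fun D (fun t => (\1_([set c] : Bor) t)%:E : \bar R).
    by apply/measurable_EFinP; exact: measurable_indic.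
  rewrite /f; under eq_integral do rewrite EFinD EFinM.
  have g0 t : D t -> (0 <= (expR (- y))%:E * (\1_([set c] : Bor) t)%:E)%E.
    by move=> _; rewrite mule_ge0// lee_fin ?expR_ge0.
  have m3 : measurable_fun D (fun t => (expR (- y))%:E * (\1_([set c] : Bor) t)%:E)%E.
    exact: measurable_funeM.
  rewrite ge0_integralD//.
  rewrite ge0_integralZl_EFin ?expR_ge0// !integral_indic// EFinD EFinM.
  by rewrite !fineK ?fin_num_measure//; [rewrite !(setIC D)|exact: measurableI..].
have lim : (\int[nu]_(t in D) (soft_ray c y n t)%:E)%E @[n --> \oo] -->
   (\int[nu]_(t in D) f t)%E.
  apply: (@dominated_cvg _ _ _ nu D mD (fun n t => (soft_ray c y n t)%:E) f (fun=> 1%E)) => //.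
  - move=> n; apply/measurable_EFinP; apply: measurable_funTS.
    apply: continuous_measurable_fun => t.
    apply: continuous_comp; last exact: continuous_expR.
    apply: cvgM; first exact: cvg_cst.
    apply: continuous_comp; last exact: continuous_expR.
    apply: cvgN; apply: cvgM; first exact: cvg_cst.
    by apply: cvgB; [exact: cvg_id|exact: cvg_cst].
  - move=> t _; apply: cvg_EFin; first exact: nearW.
    exact: soft_ray_pointwise.
  - exact: finite_measure_integrable_cst.
  - move=> n t _; rewrite abse_EFin lee_fin ger0_norm ?expR_ge0//.
    by rewrite -expR0 ler_expR mulNr oppr_le0 mulr_ge0 ?expR_ge0// ltW.
by move: lim; rewrite IfE => /fine_cvg.
Qed.

End Rays.

(** * The Laplace transform of a signed measure *)

(** Open rays form a pi-system that generates the Borel sets. *)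
Lemma measure_eq_rays (R : realType) (m1 m2 : {finite_measure set (measurableTypeR R) -> \bar R}) :
  (forall c : R, m1 `]c, +oo[%classic = m2 `]c, +oo[%classic) ->
  forall A : set (measurableTypeR R), measurable A -> m1 A = m2 A.
Proof.
move=> h A mA.
apply: (@measure_unique _ R (measurableTypeR R) (@RGenOInfty.G R)
  (fun k => `](- k%:R), +oo[%classic)) => //.
- exact: RGenOInfty.measurableE.
- move=> _ _ [x ->] [y ->]; exists (Num.max x y).
  by apply/seteqP; split => t /=; rewrite !in_itv /= !andbT gt_max => /andP.
- by move=> k; exists (- k%:R).
- apply/seteqP; split => // t _; exists (Num.truncn `|t|).+1 => //=.
  rewrite in_itv /= andbT ltrNl (le_lt_trans _ (truncnS_gt `|t|))//.
  by rewrite -normrN ler_norm.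
- by move=> Z [x ->]; exact: h.
- by move=> k; rewrite ltey_eq fin_num_measure//; exact: measurable_itv.
Qed.

Section LaplaceOfCharge.
Context (R : realType) (mu : {charge set (measurableTypeR R) -> \bar R}) (a b : R).
Local Notation C := R[i].
Local Notation Bor := (set (measurableTypeR R)).
Local Notation D := (@half_line R : Bor).
Hypotheses (a0 : 0 < a) (ab : a < b).
Hypotheses (np : pos_part mu (~` `[a, b[%classic) = 0%E)
           (nn : neg_part mu (~` `[a, b[%classic) = 0%E).
Hypothesis muD : mu D = 0%E.
Local Notation V := (total_variation mu).
Local Notation q := (charge_quad a0 ab np nn).

(** The j-th derivative of the Laplace transform, extended to complex arguments. *)
Definition ctransform (j : nat) (z : C) : C := cint mu (laplace_kernel j z).
Local Notation F := ctransform.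

Lemma total_variation_ge0 : 0 <= V.
Proof. by rewrite addr_ge0// fine_ge0. Qed.

Lemma kernel_continuous j z (x : R) :
  {for x, continuous (fun t => complex.Re (laplace_kernel j z t))} /\
  {for x, continuous (fun t => complex.Im (laplace_kernel j z t))}.
Proof.
have hN : holo 1 (fun w : C => - w).
  have -> : (fun w : C => - w) = (fun w => -1 * w) by apply/funext => w; rewrite mulN1r.
  apply: holoM; [exact: holo_cst|exact: holo_id].
have [f1 hf _] : holo 1 (fun w : C => (- w) ^+ j * cexp (- z * w)).
  apply: holoM; last first.
    by apply: holo_comp; [exact: holo_cexp|apply: holoM; [exact: holo_cst|exact: holo_id]].
  elim: j => [|j IH]; first exact: holo_cst.
  have -> : (fun w : C => (- w) ^+ j.+1) = (fun w => - w * (- w) ^+ j).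
    by apply/funext => w; rewrite exprS.
  exact: holoM.
exact: has_deriv_continuous hf x.
Qed.

Lemma ctransform_converges j z :
  converges (X := C^o) (qsum q (X := C^o) (laplace_kernel j z)) (F j z).
Proof. by apply: cint_converges => x _; have [] := kernel_continuous j z x. Qed.

Lemma charge_integral_qlim (f : R -> R) (fc : forall x, 0 < x -> {for x, continuous f}) :
  converges (X := C^o) (qsum q (X := C^o) (fun t => ((f t)%:C)%C))
    (((charge_integral mu D f)%:C)%C).
Proof.
move=> e e0; have [N hN] := charge_integral_converges a0 ab np nn fc e0.
exists N => n Nn; have := hN n Nn; rewrite -cabsR rmorphB rmorph_sum.
by congr (rnorm (_ - _) <= _); apply: eq_bigr => i _; rewrite rmorphM.
Qed.

Lemma real_kernel (j : nat) (x t : R) :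
  laplace_kernel j ((x%:C)%C) t = (((- t) ^+ j * expR (- (x * t)))%:C)%C.
Proof.
have E : - (x%:C)%C * (t%:C)%C = ((- (x * t))%:C)%C by rewrite rmorphN rmorphM mulNr.
rewrite /laplace_kernel E cexpR rmorphM; congr (_ * _).
by rewrite rmorphXn; congr (_ ^+ _); rewrite rmorphN.
Qed.

Lemma ctransform_real x : F 0 ((x%:C)%C) = ((laplace mu x)%:C)%C.
Proof.
have fc y : 0 < y -> {for y, continuous (fun t => expR (- (x * t)))}.
  move=> _; have [+ _] := kernel_continuous 0 ((x%:C)%C) y.
  have -> // : (fun t => complex.Re (laplace_kernel 0 ((x%:C)%C) t)) =
    (fun t => expR (- (x * t))).
  by apply/funext => t; rewrite real_kernel expr0 mul1r.
apply: converges_unique (ctransform_converges 0 ((x%:C)%C)) _.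
apply: converges_ext (charge_integral_qlim fc) => n.
by congr (qsum _ _ _); apply/funext => t; rewrite real_kernel expr0 mul1r.
Qed.

Lemma ctransform0 : F 0 0 = 0.
Proof.
apply: converges_unique (ctransform_converges 0 0) _.
apply: converges_ext (@converges_cst R C^o 0) => n.
rewrite /qsum (_ : \sum_(i < n.+1) _ = ((\sum_(i < n.+1) weight q n i)%:C)%C).
  by rewrite (sum_weight a0 ab np nn n muD).
rewrite rmorph_sum; apply: eq_bigr => i _.
rewrite (_ : (0 : C) = ((0%:C)%C)) // real_kernel expr0 mul0r oppr0 expR0 mulr1.
by rewrite -[LHS]/(_ * _) rmorph1 mulr1.
Qed.

Lemma ctransform_Im j x : complex.Im (F j ((x%:C)%C)) = 0.
Proof.
have conjIm (w : C) : complex.Im (w^*)%C = - complex.Im w by case: w.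
have conjR : (((x%:C)%C : C)^*)%C = (x%:C)%C by rewrite /= oppr0.
have := conjIm (F j ((x%:C)%C)); rewrite -(laplace_conj ctransform_converges) conjR.
lra.
Qed.

Lemma has_deriv_ctransform j : has_deriv (E := C^o) (F j) (F j.+1).
Proof. exact: (has_deriv_laplace a0 ab total_variation_ge0 ctransform_converges). Qed.

Lemma ctransform_decay z : 0 <= complex.Re z ->
  cabs (F 0 z) <= V * expR (- (a * complex.Re z)).
Proof. exact: (laplace_decay ctransform_converges). Qed.

Lemma laplace_decay_real x : 0 <= x -> `|laplace mu x| <= V * expR (- (a * x)).
Proof. by move=> x0; rewrite -cabsR -ctransform_real; exact: ctransform_decay. Qed.

(** If all derivatives vanished at x, the integrals of (xt)^j exp(-xt), j > 0, would
    vanish, hence the integral of exp(xt) exp(-xt) = 1 would equal F(x); but it is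
    F(0) = 0. *)
Lemma ctransform_nonflat x : F 0 ((x%:C)%C) != 0 -> 0 <= x ->
  exists2 j, (0 < j)%N & F j ((x%:C)%C) != 0.
Proof.
move=> Fx x0; apply: contrapT => hno; move: Fx; apply/negP; rewrite negbK; apply/eqP.
have hj j : F j.+1 ((x%:C)%C) = 0.
  by apply/eqP; apply: contrapT => /negP h; apply: hno; exists j.+1.
have b0 : 0 < b by exact: lt_trans ab.
have hab t : a <= t <= b -> 0 <= t <= b.
  by move=> /andP[h ->]; rewrite andbT (le_trans _ h)// ltW.
apply/esym; apply: (@exp_power_moments R a b V q total_variation_ge0
  (fun t => expR (- (x * t))) (fun t => x * t) 1 (x * b)) => //.
- move=> t /hab /andP[t0 _]; rewrite ger0_norm ?expR_ge0//.
  by rewrite -expR0 ler_expR oppr_le0 mulr_ge0.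
- by move=> t /hab /andP[t0 tb]; rewrite ger0_norm ?mulr_ge0// ler_wpM2l.
- by rewrite mulr_ge0// ltW.
- apply: converges_ext (ctransform_converges 0 ((x%:C)%C)) => n.
  by congr (qsum _ _ _); apply/funext => t; rewrite real_kernel expr0 mul1r.
- move=> j; have := convergesZ ((((- x) ^+ j.+1)%:C)%C) (ctransform_converges j.+1 ((x%:C)%C)).
  rewrite hj scaler0; apply: converges_ext => n; rewrite -qsumZ.
  congr (qsum _ _ _); apply/funext => t; rewrite real_kernel -[_ *: (_ : C^o)]/(_ * _ : C).
  by rewrite -rmorphM; congr ((_%:C)%C); rewrite mulrA -exprMn mulrNN mulrC.
- have := ctransform_converges 0 0; rewrite ctransform0; apply: converges_ext => n.
  congr (qsum _ _ _); apply/funext => t.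
  rewrite (_ : (0 : C) = ((0%:C)%C)) // real_kernel expr0 mul0r oppr0 expR0 mulr1.
  by rewrite -expRD addNr expR0.
Qed.

(** exp(-n(t - c)) and its positive powers are multiples of functions exp(-xt), x > 0,
    whose integrals vanish. *)
Lemma laplace_zero_soft_ray c y n : (forall x, 0 <= x -> laplace mu x = 0) -> 0 <= y ->
  charge_integral mu D (soft_ray c y n) = 0.
Proof.
move=> hL y0.
have b0 : 0 < b by exact: lt_trans ab.
have hab t : a <= t <= b -> 0 <= t <= b.
  by move=> /andP[h ->]; rewrite andbT (le_trans _ h)// ltW.
pose phi t := - y * expR (- (n%:R * (t - c))).
apply: (@complexI R); rewrite rmorph0.
apply: (@exp_power_moments R a b V q total_variation_ge0 (fun=> 1) phi 1
  (y * expR (n%:R * c))) => //.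
- by move=> t _; rewrite normr1.
- move=> t /hab /andP[t0 _]; rewrite /phi mulNr normrN normrM ger0_norm//.
  rewrite ler_wpM2l// ger0_norm ?expR_ge0// ler_expR.
  have : 0 <= n%:R * t by rewrite mulr_ge0.
  by lra.
- by rewrite mulr_ge0 ?expR_ge0.
- have := ctransform_converges 0 0; rewrite ctransform0; apply: converges_ext => m.
  congr (qsum _ _ _); apply/funext => t.
  by rewrite (_ : (0 : C) = ((0%:C)%C)) // real_kernel expr0 mul0r oppr0 expR0 mulr1.
- move=> j.
  have := convergesZ ((((- y * expR (n%:R * c)) ^+ j.+1)%:C)%C)
    (ctransform_converges 0 (((j.+1%:R * n%:R)%:C)%C)).
  rewrite ctransform_real hL ?mulr_ge0// scaler0; apply: converges_ext => m.
  rewrite -qsumZ; congr (qsum _ _ _); apply/funext => t.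
  rewrite real_kernel -[_ *: (_ : C^o)]/(_ * _ : C) -rmorphM; congr ((_%:C)%C).
  rewrite expr0 !mul1r /phi !exprMn -mulrA; congr (_ * _).
  rewrite -!expRM_natl -expRD; congr expR; ring.
- have fc z : 0 < z -> {for z, continuous (soft_ray c y n)}.
    move=> _; apply: continuous_comp; last exact: continuous_expR.
    apply: cvgM; first exact: cvg_cst.
    apply: continuous_comp; last exact: continuous_expR.
    apply: cvgN; apply: cvgM; first exact: cvg_cst.
    by apply: cvgB; [exact: cvg_id|exact: cvg_cst].
  apply: converges_ext (charge_integral_qlim fc) => m.
  by congr (qsum _ _ _); apply/funext => t; rewrite mul1r.
Qed.

(** The integrals of the approximations [soft_ray] vanish, so the two Jordan parts
    agree on rays. *)
Lemma laplace_injective : (forall x, 0 <= x -> laplace mu x = 0) ->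
  forall A : Bor, measurable A -> mu A = 0%E.
Proof.
move=> hL A mA.
have mD : measurable D by exact: measurable_half_line.
have ray (c : R) : measurable (`]c, +oo[%classic : Bor) by exact: measurable_itv.
have E y c : 0 < y ->
    fine (pos_part mu (D `&` `]c, +oo[%classic)) +
      expR (- y) * fine (pos_part mu (D `&` [set c])) =
    fine (neg_part mu (D `&` `]c, +oo[%classic)) +
      expR (- y) * fine (neg_part mu (D `&` [set c])).
  move=> y0.
  have hp := @soft_ray_cvg R (pos_part mu) c y y0; have hn := @soft_ray_cvg R (neg_part mu) c y y0.
  have pn : (fun n => Rintegral (pos_part mu) D (soft_ray c y n)) =
      (fun n => Rintegral (neg_part mu) D (soft_ray c y n)).
    apply/funext => n; apply/eqP; rewrite -subr_eq0.
    by rewrite -/(charge_integral mu D (soft_ray c y n)) laplace_zero_soft_ray// ltW.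
  rewrite pn in hp; exact: (cvg_unique _ hp hn).
have E' c : fine (pos_part mu (D `&` `]c, +oo[%classic)) =
    fine (neg_part mu (D `&` `]c, +oo[%classic)).
  have h1 := E 1 c ltr01; have h2 := E 2 c (ltr0n R 2).
  have e12 : expR (- 1) - expR (- 2) != 0 :> R.
    by rewrite subr_eq0 gt_eqF// ltr_expR ltrN2 ltr1n.
  have : (expR (- 1) - expR (- 2)) * (fine (pos_part mu (D `&` [set c])) -
     fine (neg_part mu (D `&` [set c]))) = 0 by move: h1 h2; lra.
  move/eqP; rewrite mulf_eq0 (negbTE e12) /= subr_eq0 => /eqP h.
  by move: h1; rewrite h => /addIr.
have null (nu : {finite_measure set (measurableTypeR R) -> \bar R}) (c : R) :
    nu (~` `[a, b[%classic) = 0%E ->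
    nu `]c, +oo[%classic = (fine (nu (D `&` `]c, +oo[%classic)))%:E.
  move=> nu0; rewrite fineK; last by rewrite fin_num_measure//; exact: measurableI.
  have mI : measurable (`[a, b[%classic : Bor) by exact: measurable_itv.
  apply/eqP; rewrite eq_le; apply/andP; split; last first.
    by apply: le_measure; rewrite ?inE//; (exact: measurableI || exact: subIsetr).
  apply: (@le_trans _ _ (nu ((D `&` `]c, +oo[%classic) `|` ~` `[a, b[%classic))).
    apply: le_measure; rewrite ?inE//.
      by apply: measurableU; [exact: measurableI|exact: measurableC].
    move=> t ct; have [Dt|nD] := pselect (D t); [by left|right] => /=.
    by rewrite in_itv /= => /andP[at_ _]; apply: nD; exact: lt_le_trans at_.
  apply: (le_trans (measureU2 _ _ _)); [exact: measurableI|exact: measurableC|].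
  by rewrite [X in (_ + X)%E]nu0 adde0.
have pe : forall A : Bor, measurable A -> pos_part mu A = neg_part mu A.
  by apply: measure_eq_rays => c; rewrite (null _ c np) (null _ c nn) E'.
have -> : mu A = (pos_part mu A - neg_part mu A)%E.
  by rewrite (jordan_decomp (hahn_posneg mu) mA) /cadd /= /cscale mulN1e.
by rewrite pe// subee// fin_num_measure.
Qed.

(** The transform is not identically zero on the half-line by injectivity, vanishes
    at 0 and tends to 0 at infinity; so the supremum of its modulus is reached, at a
    positive point. *)
Lemma laplace_max : nontrivial_charge mu -> exists x0 M : R,
  [/\ 0 < x0, 0 < M, `|laplace mu x0| = M & forall x, 0 <= x -> `|laplace mu x| <= M].
Proof.
move=> [A [mA nA]].
have [x1 x10 Lx1] : exists2 x1, 0 <= x1 & laplace mu x1 != 0.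
  apply: contrapT => h; apply: nA; apply: laplace_injective => // x x0.
  by apply/eqP; apply: contrapT => /negP nz; apply: h; exists x.
have L0 : laplace mu 0 = 0.
  by apply: (@complexI R); rewrite -ctransform_real ctransform0.
pose m := `|laplace mu x1|.
have m0 : 0 < m by rewrite normr_gt0.
have V0 := total_variation_ge0.
pose X := Num.max x1 (V / (m * a)).
have X0 : 0 <= X by rewrite le_max x10.
have beyond x : X < x -> `|laplace mu x| <= m.
  move=> Xx; have x0 : 0 <= x by rewrite (le_trans X0)// ltW.
  apply: (le_trans (laplace_decay_real x0)).
  rewrite expRN -ler_pdivlMr ?invr_gt0 ?expR_gt0// invrK.
  rewrite -ler_pdivrMl//; apply: (@le_trans _ _ (1 + a * x)); last exact: expR_ge1Dx.
  have : V / (m * a) < x by rewrite (le_lt_trans _ Xx)// le_max lexx orbT.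
  rewrite ltr_pdivrMr ?mulr_gt0// => h; rewrite ler_pdivrMl//.
  by rewrite mulrDr mulr1 -[leLHS]add0r lerD ?(ltW m0)//; move: h; lra.
have cL : {within `[0, X], continuous (fun x => `|laplace mu x|)}.
  apply: continuous_subspaceT => x; apply: continuous_comp; last exact: norm_continuous.
  have [+ _] := has_deriv_continuous (has_deriv_ctransform 0) x.
  have -> // : (fun t => complex.Re (F 0 ((t%:C)%C))) = laplace mu.
  by apply/funext => t; rewrite ctransform_real.
have [x0 x0X hx0] := EVT_max X0 cL.
move: x0X; rewrite in_itv /= => /andP[x00 x0X].
have m_le : m <= `|laplace mu x0|.
  by apply: hx0; rewrite in_itv /= x10 le_max lexx.
exists x0, `|laplace mu x0|; split; last 2 first.
- by [].
- move=> x xge0; have [xX|Xx] := leP x X; first by apply: hx0; rewrite in_itv /= xge0.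
  by rewrite (le_trans (beyond x Xx)).
- rewrite lt_neqAle x00 andbT eq_sym; apply/eqP => h.
  by move: m_le; rewrite h L0 normr0 leNgt m0.
- exact: lt_le_trans m_le.
Qed.

End LaplaceOfCharge.

(** * Bounded operators *)

Section Operators.
Context (R : realType) (X : normedModType R[i]).
Local Notation C := R[i].

(** The supremum defining the operator norm behaves as expected only on bounded
    operators, whence the hypothesis on K. *)
Lemma opnorm_bound (B : X -> X) (K : R) :
  (forall (c : C) v, B (c *: v) = c *: B v) -> (forall v, rnorm (B v) <= K * rnorm v) ->
  forall v, rnorm (B v) <= opnorm B * rnorm v.
Proof.
move=> BZ BK v.
have hs : has_sup [set rnorm (B x) | x in [set x | rnorm x <= 1]].
  split; first by exists (rnorm (B 0)), 0 => //=; rewrite rnorm0 ler01.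
  exists `|K| => _ [x /= x1 <-]; apply: (le_trans (BK x)).
  apply: (le_trans (ler_norm _)); rewrite normrM ler_piMr//.
  by rewrite ger0_norm ?rnorm_ge0.
have [v0|vn0] := eqVneq (rnorm v) 0.
  rewrite (rnorm_eq0 v0) -(scale0r (0 : X)) BZ !scale0r !rnorm0 mulr0//.
have vp : 0 < rnorm v by rewrite lt_neqAle rnorm_ge0 andbT eq_sym.
pose c : C := (((rnorm v)^-1)%:C)%C.
have cc : cabs c = (rnorm v)^-1 by rewrite cabsR ger0_norm// invr_ge0 ltW.
have : rnorm (B (c *: v)) <= opnorm B.
  apply: sup_upper_bound => //; exists (c *: v) => //=.
  by rewrite rnormZ cc mulVf.
by rewrite BZ rnormZ cc mulrC ler_pdivrMr.
Qed.

Lemma opnorm_ge0 (B : X -> X) : 0 <= opnorm B.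
Proof.
rewrite /opnorm; have [hs|hn] := pselect (has_sup [set rnorm (B x) | x in [set x | rnorm x <= 1]]).
  apply: (@le_trans _ _ (rnorm (B 0))); first exact: rnorm_ge0.
  by apply: sup_upper_bound => //; exists 0 => //=; rewrite rnorm0 ler01.
by rewrite sup_out.
Qed.

End Operators.

(** Sokal's argument. If no bound is uniform, one chooses operators of rapidly
    growing norm and corrections of size 3^-n to a point, each of which makes the
    n-th operator large on a whole ball of radius 3^-n / 2 around the corrected
    point; the limit point lies in all these balls and contradicts pointwise
    boundedness. *)
Lemma uniform_boundedness (R : realType) (X : completeNormedModType R[i])
    (I : Type) (A : set I) (B : I -> {linear X -> X}) :
  (forall i, A i -> exists K : R, forall v, rnorm (B i v) <= K * rnorm v) ->
  (forall v, exists K : R, forall i, A i -> rnorm (B i v) <= K) ->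
  exists K : R, forall i, A i -> forall v, rnorm (B i v) <= K * rnorm v.
Proof.
move=> hB hp; apply: contrapT => hno.
have big n : exists i, A i /\ exists v, (n%:R : R) * rnorm v < rnorm (B i v).
  apply: contrapT => h; apply: hno; exists n%:R => i Ai v.
  by rewrite leNgt; apply/negP => hv; apply: h; exists i; split => //; exists v.
(* B(x + v) and B(x - v) differ by 2 B v, so one of them is at least as large as B v *)
have kick (i : I) (v x : X) : exists2 w, w = v \/ w = - v &
    rnorm (B i v) <= rnorm (B i (x + w)).
  have [h|h] := leP (rnorm (B i v)) (rnorm (B i (x + v))); first by exists v; [left|].
  exists (- v); first by right.
  have : rnorm (B i v) + rnorm (B i v) <= rnorm (B i (x + v)) + rnorm (B i (x - v)).
    have <- : rnorm (B i (x + v) - B i (x - v)) = rnorm (B i v) + rnorm (B i v).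
      rewrite -linearB opprD opprK addrACA subrr add0r -mulr2n linearMn.
      have -> : (B i v) *+ 2 = ((2 : R)%:C)%C *: B i v by rewrite rmorph_nat scaler_nat.
      by rewrite rnormZ cabsR normr_nat mulr2n mulrDl mul1r.
    exact: rnormB.
  by move: h; lra.
pose r n : R := 3^-1 ^+ n.
have r0 n : 0 < r n by rewrite exprn_gt0// invr_gt0.
have step n (x : X) : exists ix : I * X, [/\ A ix.1, rnorm (ix.2 - x) <= r n &
    forall z, rnorm (z - ix.2) <= r n / 2 -> n%:R <= rnorm (B ix.1 z)].
  pose m := (Num.truncn (n%:R * 6 / r n)).+1.
  have hm : n%:R * 6 / r n < m%:R by exact: truncnS_gt.
  have [i [Ai [v hv]]] := big m.
  have [K hK] := hB i Ai.
  pose o := opnorm (B i).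
  have ho y : rnorm (B i y) <= o * rnorm y.
    by apply: opnorm_bound hK y => c y; rewrite linearZ.
  have mo : m%:R < o.
    have vp : 0 < rnorm v.
      rewrite lt_neqAle rnorm_ge0 andbT; apply/eqP => h.
      have v0 : v = 0 by exact: rnorm_eq0.
      by move: hv; rewrite v0 linear0 rnorm0 mulr0 ltxx.
    by rewrite -(ltr_pM2r vp) (lt_le_trans hv).
  have o0 : 0 < o by rewrite (le_lt_trans _ mo).
  have hs : has_sup [set rnorm (B i y) | y in [set y | rnorm y <= 1]].
    by apply: contrapT => h; move: o0; rewrite /o /opnorm sup_out// ltxx.
  have o3 : 0 < o / 3 by rewrite divr_gt0.
  have [_ [u /= u1 <-] hu] := sup_adherent o3 hs.
  have hu' : 2 * (o / 3) < rnorm (B i u) by move: hu; rewrite -/(opnorm (B i)) -/o; lra.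
  have [w hw kw] := kick i (((r n)%:C)%C *: u) x.
  exists (i, x + w); split => //=.
    rewrite addrAC subrr add0r; have -> : rnorm w = rnorm (((r n)%:C)%C *: u).
      by case: hw => ->; rewrite ?rnormN.
    by rewrite rnormZ cabsR gtr0_norm// ler_piMr// ltW.
  move=> z hz.
  move: kw; rewrite linearZ rnormZ cabsR gtr0_norm// => kw.
  have h1 := ho (z - (x + w)); rewrite linearB in h1.
  have h2 := @rnorm_lerB R X (B i (x + w)) (B i z); rewrite rnorm_distC in h2.
  have h3 : o * rnorm (z - (x + w)) <= o * (r n / 2) by rewrite ler_wpM2l// ltW.
  have h4 : r n * (2 * (o / 3)) <= r n * rnorm (B i u) by rewrite ler_wpM2l// ltW.
  have h5 : n%:R * 6 <= o * r n by rewrite -ler_pdivrMr// (le_trans (ltW hm))// ltW.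
  have E3 : o * (r n / 2) = o * r n / 2 by rewrite mulrA.
  have E4 (y1 y2 : R) : y1 * (2 * (y2 / 3)) = y2 * y1 * 2 / 3 by field.
  move: h1 h2 h3 h4 h5 kw; rewrite E3 E4 /=; set p := o * r n.
  set v1 := rnorm (B i (x + w)); set v2 := rnorm (B i z); set v3 := r n * _.
  set v4 := rnorm (_ - _); set v5 := o * _; set v6 := (n%:R : R).
  clearbody p v1 v2 v3 v4 v5 v6; lra.
have [f hf] := choice (fun nx : nat * X => step nx.1 nx.2).
pose fix xs n : X := if n is k.+1 then (f (k, xs k)).2 else 0.
pose ii n : I := (f (n, xs n)).1.
have xsS n : rnorm (xs n.+1 - xs n) <= r n by have [] := hf (n, xs n).
have rS n : r n.+1 = r n / 3 by rewrite /r exprSr.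
have far n d : rnorm (xs (n + d)%N - xs n) <= (r n - r (n + d)%N) * (3 / 2).
  elim: d => [|d IH]; first by rewrite addn0 !subrr rnorm0 mul0r.
  rewrite addnS -(subrK (xs (n + d)%N) (xs (n + d).+1)) -addrA.
  apply: (le_trans (rnormD _ _)); have := xsS (n + d)%N; rewrite rS.
  by move: IH; lra.
have far' n d : rnorm (xs (n + d)%N - xs n) <= r n * (3 / 2).
  by apply: (le_trans (far n d)); rewrite ler_wpM2r ?divr_ge0// gerBl ltW.
have rsmall (e : R) : 0 < e -> exists N, r N * (3 / 2) * 2 <= e.
  move=> e0; pose N := (Num.truncn (3 / e)).+1; exists N.
  have hN : 3 / e < N%:R by exact: truncnS_gt.
  have Nr : N%:R * r N <= 1.
    elim: N {hN} => [|N IH]; first by rewrite mul0r.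
    rewrite rS; have r1 : r N <= 1 by rewrite exprn_ile1// ?invr_ge0// invf_le1// ler1n.
    by rewrite -natr1; move: IH; lra.
  have : 3 * r N <= e * (N%:R * r N).
    rewrite mulrA ler_wpM2r ?(ltW (r0 N))// mulrC -ler_pdivrMr//; exact: ltW.
  by have := ler_wpM2l (ltW e0) Nr; lra.
have [z hz] : exists z, converges xs z.
  apply: cauchy_converges => e e0; have [N hN] := rsmall e e0.
  exists N => m n Nm Nn.
  rewrite -(subrK (xs N) (xs m)) -addrA (le_trans _ hN)// mulr_natr mulr2n.
  rewrite -(subnKC Nm) -(subnKC Nn); apply: le_rnormD; first exact: far'.
  by rewrite rnorm_distC; exact: far'.
have near n : rnorm (z - xs n.+1) <= r n / 2.
  apply: (@converges_le R X (fun d => xs (n.+1 + d)%N - xs n.+1)).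
    move=> e e0; have [N hN] := hz e e0; exists N => d Nd.
    rewrite opprB addrA subrK; apply: hN; exact: leq_trans Nd (leq_addl _ _).
  by move=> d; apply: (le_trans (far' n.+1 d)); rewrite rS; lra.
have [K hK] := hp z.
pose n := (Num.truncn K).+1.
have [Ai _ hn] := hf (n, xs n).
have := le_trans (hn z (near n)) (hK _ Ai).
by apply/negP; rewrite -ltNge truncnS_gt.
Qed.

(** * Resolvent sums of a semigroup *)

(** The Riemann sum of the integral of exp(-ct) over the half-line, which is 1/c. *)
Lemma geometric_bound (R : realType) (c h : R) N : 0 < c -> 0 < h ->
  \sum_(m < N) h * expR (- (c * (m%:R * h))) <= c^-1 + h.
Proof.
move=> c0 h0.
have A0 : 0 < c^-1 + h by rewrite addr_gt0// invr_gt0.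
have step : h <= (c^-1 + h) * (1 - expR (- (c * h))).
  have : (c^-1 + h) * expR (- (c * h)) <= c^-1.
    rewrite expRN ler_pdivrMr ?expR_gt0//.
    have -> : c^-1 + h = c^-1 * (1 + c * h) by field; rewrite gt_eqF.
    by rewrite ler_pM2l ?invr_gt0// expR_ge1Dx.
  by lra.
suff : \sum_(m < N) h * expR (- (c * (m%:R * h))) <=
    (c^-1 + h) * (1 - expR (- (c * (N%:R * h)))).
  move/le_trans; apply; rewrite ler_piMr ?(ltW A0)// gerBl expR_ge0 //.
elim: N => [|N IH].
  by rewrite big_ord0 mul0r mulr0 oppr0 expR0 subrr mulr0.
rewrite big_ord_recr /=.
have -> : - (c * (N.+1%:R * h)) = - (c * (N%:R * h)) + - (c * h).
  by rewrite -natr1; ring.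
rewrite expRD; set e := expR (- (c * (N%:R * h))) in IH *; set r := expR _ in step *.
have : e * h <= e * ((c^-1 + h) * (1 - r)) by rewrite ler_wpM2l// expR_ge0.
by move: IH; lra.
Qed.

Section ResolventSum.
Context (R : realType) (X : normedModType R[i]) (U : R -> {linear X -> X}).
Local Notation C := R[i].
Hypotheses (U0 : forall x, U 0 x = x)
  (UD : forall (s t : R) x, 0 <= s -> 0 <= t -> U (s + t) x = U s (U t x)).

Definition resolvent_term (h : R) (z : C) (u : X) (m : nat) : X :=
  ((h%:C)%C * cexp (z * ((m%:R * h)%:C)%C)) *: U (m%:R * h) u.

(** A finite Riemann sum of the integral of exp(zt) U(t)u over the half-line, that
    is of the resolvent of the generator of U at -z, applied to u. Finite sums of
    exponentials are entire functions of z with explicit primitives. *)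
Definition resolvent_sum h N z u := \sum_(m < N) resolvent_term h z u m.

Lemma resolvent_sumB h N z u v :
  resolvent_sum h N z (u - v) = resolvent_sum h N z u - resolvent_sum h N z v.
Proof.
by rewrite -sumrB; apply: eq_bigr => m _; rewrite /resolvent_term linearB scalerBr.
Qed.

Lemma resolvent_sum_U h N z u t : 0 <= h -> 0 <= t ->
  resolvent_sum h N z (U t u) = U t (resolvent_sum h N z u).
Proof.
move=> h0 t0; rewrite /resolvent_sum linear_sum; apply: eq_bigr => m _.
by rewrite /resolvent_term linearZ -!UD ?mulr_ge0// addrC.
Qed.

(** Multiplication by exp(z t) U(t), t = jh, moves the summation range from 0, ..., N - 1
    to j, ..., N + j - 1; only boundary terms appear. *)
Lemma resolvent_shift h N j z u : 0 <= h ->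
  cexp (z * ((j%:R * h)%:C)%C) *: U (j%:R * h) (resolvent_sum h N z u) =
  resolvent_sum h N z u - \sum_(m < j) resolvent_term h z u m
   + \sum_(m < j) resolvent_term h z u (N + m)%N.
Proof.
move=> h0.
pose f := resolvent_term h z u.
have E : cexp (z * ((j%:R * h)%:C)%C) *: U (j%:R * h) (resolvent_sum h N z u) =
    \sum_(m < N) f (j + m)%N.
  rewrite linear_sum scaler_sumr; apply: eq_bigr => m _.
  rewrite /f /resolvent_term linearZ scalerA -UD ?mulr_ge0//.
  have -> : (j + m)%:R * h = j%:R * h + m%:R * h by rewrite natrD mulrDl.
  by rewrite mulrCA -cexpD -mulrDr -rmorphD.
have split (i k : nat) : \sum_(m < i + k) f m = \sum_(m < i) f m + \sum_(m < k) f (i + m)%N.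
  exact: big_split_ord.
apply: (addrI (\sum_(m < j) f m)); rewrite E -split addnC split.
by rewrite [RHS]addrA [in RHS]addrCA subrr addr0.
Qed.

Context (L D0 : R).
Hypotheses (L0 : 0 <= L) (D00 : 0 <= D0)
  (decay : forall u (S : R), 0 <= S -> (forall t : R, 0 <= t -> rnorm (U t u) <= S) ->
     forall t : R, 0 <= t -> rnorm (U t u) <= D0 * expR (- ((L + 1) * t)) * S).

Lemma cabs_resolvent_coef h z (m : nat) : 0 <= h -> cabs z <= L ->
  cabs ((h%:C)%C * cexp (z * ((m%:R * h)%:C)%C)) <= h * expR (L * (m%:R * h)).
Proof.
move=> h0 zL; rewrite cabsM cabsR (ger0_norm h0); apply: ler_wpM2l => //.
have mh : 0 <= m%:R * h by rewrite mulr_ge0.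
by apply: cabs_cexp_le; rewrite cabsM cabsR (ger0_norm mh) ler_wpM2r.
Qed.

Section Bounds.
Context (u : X) (S : R).
Hypotheses (S0 : 0 <= S) (hS : forall t : R, 0 <= t -> rnorm (U t u) <= S).
Context (h : R) (z : C).
Hypotheses (h0 : 0 < h) (zL : cabs z <= L).

Lemma resolvent_term_le m : rnorm (resolvent_term h z u m) <= h * expR (L * (m%:R * h)) * S.
Proof.
apply: le_rnormZ; first by apply: cabs_resolvent_coef => //; exact: ltW.
by apply: hS; rewrite mulr_ge0// ltW.
Qed.

(** The orbit decays at a rate exceeding |z| by 1, which beats the exponential
    factor. *)
Lemma resolvent_term_decay m :
  rnorm (resolvent_term h z u m) <= D0 * S * (h * expR (- (1 * (m%:R * h)))).
Proof.
have mh : 0 <= m%:R * h by rewrite mulr_ge0// ltW.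
have := le_rnormZ (cabs_resolvent_coef m (ltW h0) zL) (decay S0 hS mh).
move/le_trans; apply; rewrite -/(resolvent_term h z u m).
have -> : - ((L + 1) * (m%:R * h)) = - (L * (m%:R * h)) + - (1 * (m%:R * h)) by ring.
rewrite expRD expRN; set e := expR (L * _); set e' := expR _.
have e0 : e != 0 by rewrite gt_eqF// expR_gt0.
by rewrite (_ : h * e * _ = D0 * S * (h * e'))//; field.
Qed.

Lemma resolvent_sum_le N : rnorm (resolvent_sum h N z u) <= D0 * S * (1 + h).
Proof.
apply: (le_trans (rnorm_sum _ _ _)).
apply: (@le_trans _ _ (\sum_(m < N) D0 * S * (h * expR (- (1 * (m%:R * h)))))).
  by apply: ler_sum => m _; exact: resolvent_term_decay.
rewrite -mulr_sumr ler_wpM2l ?mulr_ge0//.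
by have := geometric_bound N ltr01 h0; rewrite invr1.
Qed.

(** In a left half-plane the sum converges absolutely on bounded orbits, with a bound
    that does not involve the decay constant D0. *)
Lemma resolvent_sum_left N (k : R) : 0 < k -> k <= - complex.Re z ->
  rnorm (resolvent_sum h N z u) <= S * (k^-1 + h).
Proof.
move=> k0 kz; apply: (le_trans (rnorm_sum _ _ _)).
apply: (@le_trans _ _ (\sum_(m < N) S * (h * expR (- (k * (m%:R * h)))))); last first.
  by rewrite -mulr_sumr ler_wpM2l// geometric_bound.
apply: ler_sum => m _; have mh : 0 <= m%:R * h by rewrite mulr_ge0// ltW.
rewrite [S * _]mulrC; apply: le_rnormZ; last exact: hS.
rewrite cabsM cabsR gtr0_norm// ler_wpM2l ?(ltW h0)// cabs_cexp ler_expR.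
have -> : complex.Re (z * ((m%:R * h)%:C)%C) = complex.Re z * (m%:R * h).
  by case: (z) => x y /=; rewrite mulr0 subr0.
by rewrite -mulNr ler_wpM2r//; lra.
Qed.

End Bounds.

(** Up to a multiple of the bound S of the orbit, U(t) multiplies the resolvent sum
    by exp(-zt). The constant in front of S does not involve D0, which depends on
    the time scale of the semigroup; all the terms in D0 can be made small by the
    choice of h and N. They come, in order, from rounding t to a multiple of
    h in U(t), from the same rounding in exp(-zt), and from the upper end of the
    sum. *)
Lemma resolvent_sum_eigen (b w h : R) N (z : C) u (S t : R) : 0 <= S ->
  (forall r : R, 0 <= r -> rnorm (U r u) <= S) ->
  0 < h -> h <= 1 -> L * h <= 1 -> cabs z <= L -> 0 <= t <= b -> 0 <= w ->
  (forall r s : R, 0 <= r -> 0 <= s <= h -> rnorm (U (r + s) u - U r u) <= w) ->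
  rnorm (U t (resolvent_sum h N z u) - cexp (- z * (t%:C)%C) *: resolvent_sum h N z u) <=
  expR (L * b) * (b * expR (L * b)) * S +
  (2 * D0 * w + expR (L * b) * ((1 + 4 * expR 1) * (L * h)) * (2 * D0 * S)
   + expR (L * b) * (b * D0 * S * expR (- (N%:R * h)))).
Proof.
move=> S0 hS h0 h1 Lh zL /andP[t0 tb] w0 hw.
set Y := resolvent_sum h N z u.
have b0 : 0 <= b by exact: le_trans tb.
pose j := Num.truncn (t / h).
have th0 : 0 <= t / h by rewrite divr_ge0// ltW.
have /andP[jt tj] : j%:R <= t / h < j.+1%:R.
  by rewrite truncn_le th0 truncnS_gt.
have {}jt : j%:R * h <= t by rewrite -ler_pdivlMr.
have {}tj : t < j.+1%:R * h by rewrite -ltr_pdivrMr.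
have jh0 : 0 <= j%:R * h by rewrite mulr_ge0// ltW.
pose r := t - j%:R * h.
have r0 : 0 <= r by rewrite subr_ge0.
have rh : r <= h by move: tj; rewrite -natr1 /r; lra.
have tE : t = j%:R * h + r by rewrite /r; ring.
have jb : j%:R * h <= b by exact: le_trans tb.
pose ej := cexp (- z * ((j%:R * h)%:C)%C).
have ejb : cabs ej <= expR (L * b).
  apply: cabs_cexp_le; rewrite cabsM rnormN cabsR ger0_norm//.
  by apply: ler_pM; rewrite ?rnorm_ge0.
pose er := cexp (- z * ((r)%:C)%C).
have etE : cexp (- z * (t%:C)%C) = ej * er.
  by rewrite -cexpD -mulrDr -rmorphD -tE.
have YD : rnorm Y <= 2 * D0 * S.
  apply: (le_trans (resolvent_sum_le S0 hS h0 zL N)).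
  rewrite (_ : 2 * D0 * S = D0 * S * 2); last by ring.
  by rewrite ler_wpM2l ?mulr_ge0//; lra.
have split : U t Y - cexp (- z * (t%:C)%C) *: Y =
  ej *: (\sum_(m < j) resolvent_term h z u (N + m)%N) +
  (- (ej *: (\sum_(m < j) resolvent_term h z u m)) +
  (resolvent_sum h N z (U (j%:R * h) (U r u - u)) + (ej * (1 - er)) *: Y)).
  rewrite etE.
  have sh := resolvent_shift N j z u (ltW h0); rewrite -/Y in sh.
  have -> : resolvent_sum h N z (U (j%:R * h) (U r u - u)) = U t Y - U (j%:R * h) Y.
    by rewrite resolvent_sum_U ?(ltW h0)// resolvent_sumB resolvent_sum_U ?(ltW h0)//
       linearB -UD// -tE.
  have ejE : ej * cexp (z * ((j%:R * h)%:C)%C) = 1 by rewrite -cexpD mulNr addNr cexp0.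
  have -> : U (j%:R * h) Y = ej *: (Y - \sum_(m < j) resolvent_term h z u m
      + \sum_(m < j) resolvent_term h z u (N + m)%N).
    by rewrite -sh scalerA ejE scale1r.
  set A := \sum_(m < j) _; set B := \sum_(m < j) _.
  lin_eq [:: A; B; U t Y; Y].
have e1 : rnorm (ej *: (\sum_(m < j) resolvent_term h z u (N + m)%N)) <=
    expR (L * b) * (b * D0 * S * expR (- (N%:R * h))).
  apply: le_rnormZ => //; apply: (le_trans (rnorm_sum _ _ _)).
  apply: (@le_trans _ _ (\sum_(m < j) h * (D0 * S * expR (- (N%:R * h))))).
    apply: ler_sum => m _; apply: (le_trans (resolvent_term_decay S0 hS h0 zL _)).
    rewrite [leRHS]mulrCA ler_wpM2l ?mulr_ge0// ler_wpM2l ?(ltW h0)// ler_expR mul1r lerN2.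
    by rewrite ler_wpM2r ?(ltW h0)// ler_nat leq_addr.
  rewrite sumr_const card_ord -(mulr_natl _ j) [leLHS]mulrA -(mulrA b) -(mulrA b).
  by apply: ler_wpM2r => //; rewrite !mulr_ge0 ?expR_ge0.
have e2 : rnorm (- (ej *: (\sum_(m < j) resolvent_term h z u m))) <=
    expR (L * b) * (b * expR (L * b)) * S.
  rewrite rnormN -mulrA; apply: le_rnormZ => //; apply: (le_trans (rnorm_sum _ _ _)).
  apply: (@le_trans _ _ (\sum_(m < j) h * (expR (L * b) * S))).
    apply: ler_sum => m _; apply: (le_trans (resolvent_term_le hS h0 zL _)).
    rewrite -mulrA ler_wpM2l ?(ltW h0)// ler_wpM2r// ler_expR ler_wpM2l//.
    by apply: le_trans jb; rewrite ler_wpM2r ?(ltW h0)// ler_nat ltnW.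
  rewrite sumr_const card_ord -(mulr_natl _ j) [leLHS]mulrA -(mulrA b).
  by apply: ler_wpM2r => //; rewrite mulr_ge0 ?expR_ge0.
have e3 : rnorm (resolvent_sum h N z (U (j%:R * h) (U r u - u))) <= 2 * D0 * w.
  have ow s : 0 <= s -> rnorm (U s (U (j%:R * h) (U r u - u))) <= w.
    move=> s0; have sj : 0 <= s + j%:R * h by exact: addr_ge0.
    by rewrite -UD// linearB -UD//; apply: hw => //; rewrite r0.
  apply: (le_trans (resolvent_sum_le w0 ow h0 zL N)).
  rewrite (_ : 2 * D0 * w = D0 * w * 2); last by ring.
  by rewrite ler_wpM2l ?mulr_ge0//; lra.
have e4 : rnorm ((ej * (1 - er)) *: Y) <=
    expR (L * b) * ((1 + 4 * expR 1) * (L * h)) * (2 * D0 * S).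
  apply: le_rnormZ => //; rewrite cabsM; apply: ler_pM; rewrite ?rnorm_ge0//.
  have zr : cabs (- z * (r%:C)%C) <= L * h.
    by rewrite cabsM rnormN cabsR ger0_norm// ler_pM ?rnorm_ge0.
  have zr1 := le_trans zr Lh.
  rewrite rnorm_distC.
  apply: (@le_trans _ _ ((1 + 4 * expR 1) * cabs (- z * (r%:C)%C))); last first.
    by rewrite ler_wpM2l// addr_ge0// mulr_ge0// expR_ge0.
  have := cexp_taylor1 zr1; have := @rnorm_lerB R C^o (er - 1) (- z * (r%:C)%C).
  set c := cabs (- z * (r%:C)%C) in zr1 *; rewrite -/er => g1 g2.
  have : c ^+ 2 <= c by rewrite expr2 ler_piMr// rnorm_ge0.
  have := expR_ge0 (1 : R) => e0 cc.
  have : 4 * expR 1 * c ^+ 2 <= 4 * expR 1 * c by rewrite ler_wpM2l// mulr_ge0.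
  by move: g1 g2; lra.
rewrite split.
have := le_rnormD e1 (le_rnormD e2 (le_rnormD e3 e4)); move/le_trans; apply.
by lra.
Qed.

End ResolventSum.

(** * Resolvent sums are small where the transform is large *)

Lemma expRN_small (R : realType) (c h e : R) : 0 <= c -> 0 < h -> 0 < e ->
  exists N0 : nat, forall N, (N0 <= N)%N -> c * expR (- (N%:R * h)) <= e.
Proof.
move=> c0 h0 e0; exists (Num.truncn (c / e / h)).+1 => N N0N.
have hN : c / e / h <= N%:R.
  by apply: (le_trans (ltW (truncnS_gt _))); rewrite ler_nat.
rewrite expRN ler_pdivrMr ?expR_gt0//.
have := expR_ge1Dx (N%:R * h); move: hN.
rewrite ler_pdivrMr// ler_pdivrMr// => h1 h2.
apply: (le_trans h1); rewrite mulrC ler_wpM2l ?(ltW e0)//.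
by rewrite (le_trans _ h2)// lerDr.
Qed.

Section ResolventBound.
Context (R : realType) (X : normedModType R[i]) (U : R -> {linear X -> X}).
Local Notation C := R[i].
Hypotheses (U0 : forall x, U 0 x = x)
  (UD : forall (s t : R) x, 0 <= s -> 0 <= t -> U (s + t) x = U s (U t x)).
Context (L D0 : R).
Hypotheses (L0 : 0 <= L) (D00 : 0 <= D0)
  (decay : forall u (S : R), 0 <= S -> (forall t : R, 0 <= t -> rnorm (U t u) <= S) ->
     forall t : R, 0 <= t -> rnorm (U t u) <= D0 * expR (- ((L + 1) * t)) * S).
Context (a b V : R) (q : quadrature a b V) (F : C -> C) (B : X -> X) (M : R).
Hypotheses (a0 : 0 <= a) (ab : a <= b) (V0 : 0 <= V)
  (FP : forall z, converges (X := C^o) (qsum q (X := C^o) (laplace_kernel 0 z)) (F z))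
  (BP : forall v, converges (qsum q (fun t => U t v)) (B v))
  (BM : forall v, rnorm (B v) <= M * rnorm v).

(** If Y is almost a common eigenvector of all U(t), with eigenvalues exp(-zt), then
    integration against the measure makes it almost an eigenvector of B for F(z).
    When |F(z)| exceeds the norm of B, this forces Y to be small. *)
Lemma eigen_bound (z : C) (Y : X) (e : R) : 0 <= e ->
  (forall t, a <= t <= b -> rnorm (U t Y - cexp (- z * (t%:C)%C) *: Y) <= e) ->
  (cabs (F z) - M) * rnorm Y <= V * e.
Proof.
move=> e0 he.
have hl : converges (qsum q (fun t => U t Y - laplace_kernel 0 z t *: Y)) (B Y - F z *: Y).
  apply: converges_ext (convergesB (BP Y) _) => [n|]; first by rewrite qsumB.
  move=> d d0.
  have Y1 : 0 < rnorm Y + 1 by rewrite ltr_wpDl// rnorm_ge0.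
  have [N hN] := FP z (divr_gt0 d0 Y1); exists N => n Nn.
  rewrite qsum_scale -scalerBl rnormZ.
  apply: (@le_trans _ _ (d / (rnorm Y + 1) * rnorm Y)).
    by rewrite ler_wpM2r ?rnorm_ge0// hN.
  by rewrite mulrAC -mulrA ler_piMr ?(ltW d0)// ler_pdivrMr// mul1r lerDl.
have h1 : rnorm (B Y - F z *: Y) <= V * e.
  apply: (qlim_le e0 _ hl) => t tab.
  by rewrite /laplace_kernel expr0 mul1r; exact: he.
have := rnorm_lerB (F z *: Y) (B Y); rewrite rnorm_distC rnormZ.
by have := BM Y; move: h1; lra.
Qed.

Context (x0 k : R) (n : nat).
Hypotheses (x00 : 0 < x0) (k0 : 0 < k).

(** The points z at which resolvent sums can be bounded: see [tame]. *)
Definition expands (z : C) := cabs z <= L /\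
  (k * cabs (z - (x0%:C)%C) ^+ n <= cabs (F z) - M \/ k <= - complex.Re z).

Definition orbit_continuous (u : X) := forall w : R, 0 < w ->
  exists2 d : R, 0 < d & forall r s : R, 0 <= r -> 0 <= s <= d ->
    rnorm (U (r + s) u - U r u) <= w.

Definition resolvent_constant :=
  V * (expR (L * b) * (b * expR (L * b)) + 1) / k + (L + x0) ^+ n * (k^-1 + 1).

Lemma expands_dist z : cabs z <= L -> cabs (z - (x0%:C)%C) ^+ n <= (L + x0) ^+ n.
Proof.
move=> zL; rewrite lerXn2r ?nnegrE ?rnorm_ge0//; first by rewrite addr_ge0// ltW.
by rewrite (le_trans (rnormB _ _))// cabsR (gtr0_norm x00) lerD2r.
Qed.

Lemma resolvent_constant_ge0 : 0 <= resolvent_constant.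
Proof.
have b0 : 0 <= b by exact: le_trans ab.
rewrite /resolvent_constant; apply: addr_ge0.
  apply: divr_ge0; last exact: ltW.
  by apply: mulr_ge0 => //; rewrite addr_ge0// !mulr_ge0 ?expR_ge0.
apply: mulr_ge0; first by rewrite exprn_ge0// addr_ge0// ltW.
by rewrite addr_ge0// invr_ge0 ltW.
Qed.

(** The constant is independent of the semigroup: it depends on the measure
    and on the data of [expands] only. This uniformity in the time scale s is
    what the final contradiction rests upon. *)
Lemma resolvent_bound u (S e : R) : 0 <= S -> (forall t : R, 0 <= t -> rnorm (U t u) <= S) ->
  orbit_continuous u -> 0 < e ->
  exists2 h0 : R, 0 < h0 & forall h : R, 0 < h <= h0 -> exists N0 : nat, forall N, (N0 <= N)%N ->
    forall z, expands z ->
    cabs (z - (x0%:C)%C) ^+ n * rnorm (resolvent_sum U h N z u) <= resolvent_constant * (S + e).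
Proof.
move=> S0 hS hu e0.
have b0 : 0 <= b by exact: le_trans ab.
have e30 : 0 < e / 3 by exact: divr_gt0.
have D1 : 0 < 2 * D0 + 1 by rewrite ltr_wpDl// mulr_ge0.
(* each of the three terms in D0 of [resolvent_sum_eigen] gets a third of e *)
pose w := e / 3 / (2 * D0 + 1).
have w0 : 0 < w by exact: divr_gt0.
have wD : 2 * D0 * w <= e / 3.
  by rewrite /w mulrCA ler_piMr ?(ltW e30)// ler_pdivrMr// mul1r lerDl.
have [d d0 hd] := hu w w0.
pose A := expR (L * b) * (1 + 4 * expR 1) * L * (2 * D0 * S).
have A0 : 0 <= A by rewrite !mulr_ge0 ?expR_ge0// addr_ge0// mulr_ge0 ?expR_ge0.
have A10 : 0 < A + 1 by rewrite ltr_wpDl.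
have L10 : 0 < L + 1 by rewrite ltr_wpDl.
exists (Num.min (Num.min 1 (L + 1)^-1) (Num.min d (e / 3 / (A + 1)))).
  by rewrite !lt_min ltr01 invr_gt0 L10 d0 divr_gt0.
move=> h; rewrite !le_min => /andP[h0 /andP[/andP[h1 hL] /andP[hhd hA]]].
have Lh : L * h <= 1.
  apply: (@le_trans _ _ ((L + 1) * h)); first by rewrite ler_wpM2r ?(ltW h0)// lerDl.
  by rewrite mulrC -ler_pdivlMr// mul1r.
have Ah : A * h <= e / 3.
  apply: (@le_trans _ _ ((A + 1) * h)); first by rewrite ler_wpM2r ?(ltW h0)// lerDl.
  by rewrite mulrC -ler_pdivlMr.
have G0 : 0 <= expR (L * b) * (b * D0 * S) by rewrite !mulr_ge0 ?expR_ge0.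
have [N0 hN0] := expRN_small G0 h0 e30.
exists N0 => N NN z [zL hz].
have c0 : 0 <= cabs (z - (x0%:C)%C) ^+ n by rewrite exprn_ge0// rnorm_ge0.
have Q0 : 0 <= (L + x0) ^+ n by rewrite exprn_ge0// addr_ge0// ltW.
have k1 : 0 <= k^-1 by rewrite invr_ge0 ltW.
have Y0 := rnorm_ge0 (resolvent_sum U h N z u).
pose C1 := expR (L * b) * (b * expR (L * b)).
have C10 : 0 <= C1 by rewrite !mulr_ge0 ?expR_ge0.
have Se : 0 <= S + e by rewrite addr_ge0// ltW.
case: hz => hz; last first.
  have := resolvent_sum_left S0 hS h0 N k0 hz => hl.
  apply: (@le_trans _ _ ((L + x0) ^+ n * (k^-1 + 1) * (S + e))); last first.
    rewrite ler_wpM2r// lerDr; apply: divr_ge0; last exact: ltW.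
    by rewrite mulr_ge0// addr_ge0.
  rewrite -mulrA; apply: ler_pM => //; first exact: expands_dist.
  apply: (le_trans hl); rewrite mulrC; apply: ler_pM => //.
  - by rewrite addr_ge0// ltW.
  - by rewrite lerD2l.
  - by rewrite lerDl ltW.
have err t : a <= t <= b -> rnorm (U t (resolvent_sum U h N z u) -
    cexp (- z * (t%:C)%C) *: resolvent_sum U h N z u) <= (C1 + 1) * (S + e).
  move=> /andP[at_ tb].
  have tb' : 0 <= t <= b by rewrite tb (le_trans a0).
  have hd' r s : 0 <= r -> 0 <= s <= h -> rnorm (U (r + s) u - U r u) <= w.
    by move=> r0 /andP[s0 sh]; apply: hd => //; rewrite s0 (le_trans sh).
  apply: (le_trans (resolvent_sum_eigen UD L0 D00 decay N S0 hS h0 h1 Lh zL tb' (ltW w0) hd')).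
  have := hN0 N NN; have := mulr_ge0 C10 (ltW e0).
  have -> : expR (L * b) * ((1 + 4 * expR 1) * (L * h)) * (2 * D0 * S) = A * h.
    by rewrite /A; ring.
  rewrite [expR (L * b) * (b * D0 * S * _)]mulrA -/C1.
  move: Ah wD; set g := expR (L * b) * _ * _.
  lra.
have err0 : 0 <= (C1 + 1) * (S + e) by rewrite mulr_ge0// addr_ge0.
have := eigen_bound err0 err => hE.
have : k * cabs (z - (x0%:C)%C) ^+ n * rnorm (resolvent_sum U h N z u) <=
    V * ((C1 + 1) * (S + e)).
  by apply: le_trans hE; rewrite ler_wpM2r.
rewrite -mulrA -ler_pdivlMl// => /le_trans; apply.
rewrite /resolvent_constant -/C1.
have -> : k^-1 * (V * ((C1 + 1) * (S + e))) = V * (C1 + 1) / k * (S + e) by ring.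
by rewrite ler_wpM2r// lerDl mulr_ge0// addr_ge0.
Qed.

Section AlmostInverse.
Context (x : X) (S xi d : R).
Hypotheses (S0 : 0 <= S) (hS : forall t : R, 0 <= t -> rnorm (U t x) <= S)
  (hx : orbit_continuous x) (xi0 : 0 < xi) (xiL : 8 * expR 1 * (L * xi) <= 1)
  (hd : forall r s : R, 0 <= r -> 0 <= s <= xi -> rnorm (U (r + s) x - U r x) <= d).

Let Lxi : L * xi <= 1.
Proof.
apply: le_trans xiL; apply: ler_peMl; first by rewrite mulr_ge0// ltW.
by have := @expR_ge1 R 1 ler01; lra.
Qed.

Let d0 : 0 <= d.
Proof.
apply: le_trans (rnorm_ge0 _) (hd (r := 0) (s := 0) _ _) => //.
by rewrite lexx ltW.
Qed.

Let e1 := expR (1 : R).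
Let e10 : 0 < e1. Proof. exact: expR_gt0. Qed.

(** 8 e L xi <= 1 keeps the quadratic error below half of the linear term. *)
Lemma cexp_sub1_lower z : cabs z <= L ->
  cabs z * xi / 2 <= cabs (1 - cexp (z * (xi%:C)%C)).
Proof.
move=> zL; set y := z * (xi%:C)%C.
have cy : cabs y = cabs z * xi by rewrite cabsM cabsR gtr0_norm.
have yL : cabs y <= L * xi by rewrite cy ler_wpM2r// ltW.
have y1 : cabs y <= 1 by exact: le_trans yL Lxi.
have := cexp_taylor1 y1; have := @rnorm_lerB R C^o y (y - (cexp y - 1)).
have -> : y - (y - (cexp y - 1)) = - (1 - cexp y) by ring.
rewrite rnormN (@rnorm_distC R C^o y).
rewrite -cy; have c0 := rnorm_ge0 (y : C^o); set c := cabs y in c0 y1 yL *.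
have : 8 * e1 * c * c <= 1 * c.
  rewrite ler_wpM2r//; apply: le_trans xiL; rewrite ler_wpM2l// mulr_ge0// ltW//.
by rewrite expr2 -/e1; lra.
Qed.

(** Up to the factor z, the sum is a Riemann sum of the integral of exp(zt) over
    [0, xi]. *)
Lemma riemann_exp_error z (h : R) (j : nat) : cabs z <= L -> 0 < h -> j%:R * h = xi ->
  cabs (z * (\sum_(m < j) (h%:C)%C * cexp (z * ((m%:R * h)%:C)%C)) -
    (cexp (z * (xi%:C)%C) - 1)) <= 4 * e1 ^+ 2 * cabs z * L * xi * h.
Proof.
move=> zL h0 jh.
have E : cexp (z * (xi%:C)%C) - 1 =
    \sum_(m < j) cexp (z * ((m%:R * h)%:C)%C) * (cexp (z * (h%:C)%C) - 1).
  rewrite -jh; elim: (j) => [|i IH].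
    by rewrite big_ord0 mul0r rmorph0 mulr0 cexp0 subrr.
  rewrite big_ord_recr /= -IH -natr1 mulrDl mul1r rmorphD mulrDr cexpD; ring.
rewrite E mulr_sumr -sumrB; apply: (le_trans (@rnorm_sum R C^o _ _ _ _)).
apply: (@le_trans _ _ (\sum_(m < j) e1 * (4 * e1 * (cabs z * h) ^+ 2))).
  apply: ler_sum => m _.
  have -> : z * ((h%:C)%C * cexp (z * ((m%:R * h)%:C)%C)) -
     cexp (z * ((m%:R * h)%:C)%C) * (cexp (z * (h%:C)%C) - 1) =
     - (cexp (z * ((m%:R * h)%:C)%C) * (cexp (z * (h%:C)%C) - 1 - z * (h%:C)%C)) by ring.
  have mh : m%:R * h <= xi by rewrite -jh ler_wpM2r ?(ltW h0)// ler_nat ltnW.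
  have hxi : h <= xi.
    rewrite -jh ler_peMl ?(ltW h0)// ler1n.
    by apply: leq_ltn_trans (ltn_ord m).
  have mh0 : 0 <= m%:R * h by rewrite mulr_ge0// ltW.
  have ch : cabs (z * (h%:C)%C) = cabs z * h by rewrite cabsM cabsR gtr0_norm.
  rewrite rnormN cabsM; apply: ler_pM; rewrite ?rnorm_ge0//.
    apply: cabs_cexp_le; rewrite cabsM cabsR ger0_norm//; apply: le_trans Lxi.
    by apply: ler_pM; rewrite ?rnorm_ge0.
  rewrite -ch; apply: cexp_taylor1; rewrite ch; apply: le_trans Lxi.
  by apply: ler_pM; rewrite ?rnorm_ge0// ltW.
rewrite sumr_const card_ord -(mulr_natl _ j) -jh.
have -> : j%:R * (e1 * (4 * e1 * (cabs z * h) ^+ 2)) =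
  4 * e1 ^+ 2 * cabs z * cabs z * (j%:R * h) * h by ring.
have H : 0 <= 4 * e1 ^+ 2 * cabs z.
  by apply: mulr_ge0; [rewrite mulr_ge0// exprn_ge0// ltW|exact: rnorm_ge0].
apply: ler_wpM2r; first exact: ltW.
by apply: ler_wpM2r; [rewrite mulr_ge0// ltW|rewrite ler_wpM2l].
Qed.

(** With u = U(xi)x - x the shift identity reads
    (1 - exp(z xi)) Y(x) = exp(z xi) Y(u) + P - T, where P is close to
    ((exp(z xi) - 1) / z) x. Hence zY(x) + x is small as soon as Y(u) is. Dividing
    by z costs nothing near 0, since 1 - exp(z xi) is of order |z| xi. *)
Lemma almost_inverse z (h : R) (j N : nat) : cabs z <= L -> z != 0 -> 0 < h -> j%:R * h = xi ->
  rnorm (z *: resolvent_sum U h N z x + x) <=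
  2 * e1 / xi * rnorm (resolvent_sum U h N z (U xi x - x)) +
  (2 * e1 * d + (2 * D0 * S * expR (- (N%:R * h)) + 8 * e1 ^+ 2 * L * S * h)).
Proof.
move=> zL z0 h0 jh.
have cz : 0 < cabs z by exact: cabs_gt0.
set Y := resolvent_sum U h N z x; set Y2 := resolvent_sum U h N z _.
set e := cexp (z * (xi%:C)%C).
have eb : cabs e <= e1.
  apply: cabs_cexp_le; rewrite cabsM cabsR gtr0_norm//; apply: le_trans Lxi.
  by rewrite ler_wpM2r// ltW.
pose p := \sum_(m < j) (h%:C)%C * cexp (z * ((m%:R * h)%:C)%C).
pose P := \sum_(m < j) resolvent_term U h z x m.
pose T := \sum_(m < j) resolvent_term U h z x (N + m)%N.
have Y2E : Y2 = U xi Y - Y.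
  by rewrite /Y2 resolvent_sumB resolvent_sum_U// ltW.
have sh : e *: U xi Y = Y - P + T.
  by have := resolvent_shift UD N j z x (ltW h0); rewrite jh.
have key : (1 - e) *: (z *: Y + x) =
    (z * e) *: Y2 + (z *: (P - p *: x) + (- (z *: T) + (z * p - (e - 1)) *: x)).
  have -> : (z * e) *: Y2 = z *: (Y - P + T) - (z * e) *: Y.
    by rewrite -sh Y2E; lin_eq [:: U xi Y; Y].
  lin_eq [:: Y; P; T; x].
have b1 : rnorm ((z * e) *: Y2) <= cabs z * e1 * rnorm Y2.
  by apply: le_rnormZ => //; rewrite cabsM ler_wpM2l// rnorm_ge0.
have coef m : (m < j)%N -> cabs ((h%:C)%C * cexp (z * ((m%:R * h)%:C)%C)) <= h * e1.
  move=> mj; apply: (le_trans (cabs_resolvent_coef m (ltW h0) zL)).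
  rewrite ler_wpM2l ?(ltW h0)// ler_expR; apply: le_trans Lxi.
  by rewrite ler_wpM2l// -jh ler_wpM2r ?(ltW h0)// ler_nat ltnW.
have b2 : rnorm (z *: (P - p *: x)) <= cabs z * (xi * (e1 * d)).
  apply: le_rnormZ => //.
  have -> : P - p *: x = \sum_(m < j)
      ((h%:C)%C * cexp (z * ((m%:R * h)%:C)%C)) *: (U (m%:R * h) x - x).
    by rewrite scaler_suml -sumrB; apply: eq_bigr => m _; rewrite scalerBr.
  apply: (le_trans (rnorm_sum _ _ _)).
  apply: (@le_trans _ _ (\sum_(m < j) h * e1 * d)).
    apply: ler_sum => m _; apply: le_rnormZ; first exact: coef.
    have := hd (r := 0) (s := m%:R * h) (lexx 0); rewrite add0r U0; apply.
    by rewrite mulr_ge0 ?(ltW h0)//= -jh ler_wpM2r ?(ltW h0)// ler_nat ltnW.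
  by rewrite sumr_const card_ord -(mulr_natl _ j) -!mulrA [leLHS]mulrA jh.
have b3 : rnorm (- (z *: T)) <= cabs z * (xi * (D0 * S * expR (- (N%:R * h)))).
  rewrite rnormN; apply: le_rnormZ => //; apply: (le_trans (rnorm_sum _ _ _)).
  apply: (@le_trans _ _ (\sum_(m < j) h * (D0 * S * expR (- (N%:R * h))))).
    apply: ler_sum => m _; apply: (le_trans (resolvent_term_decay decay S0 hS h0 zL _)).
    rewrite [leRHS]mulrCA ler_wpM2l ?mulr_ge0// ler_wpM2l ?(ltW h0)// ler_expR mul1r lerN2.
    by rewrite ler_wpM2r ?(ltW h0)// ler_nat leq_addr.
  by rewrite sumr_const card_ord -(mulr_natl _ j) [leLHS]mulrA jh.
have xS : rnorm x <= S by have := hS (lexx 0); rewrite U0.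
have b4 : rnorm ((z * p - (e - 1)) *: x) <= 4 * e1 ^+ 2 * cabs z * L * xi * h * S.
  by apply: le_rnormZ => //; exact: riemann_exp_error.
have := le_rnormD b1 (le_rnormD b2 (le_rnormD b3 b4)).
rewrite -key rnormZ => tot.
have low := ler_wpM2r (rnorm_ge0 (z *: Y + x)) (cexp_sub1_lower zL).
have := le_trans low tot; set n1 := rnorm (z *: Y + x).
have c2 : 0 < cabs z * xi / 2 by rewrite divr_gt0// mulr_gt0.
move=> hh; rewrite -(ler_pM2l c2); apply: (le_trans hh).
rewrite le_eqVlt; apply/orP; left; apply/eqP.
by field; rewrite gt_eqF.
Qed.

Lemma orbit_continuous_increment : orbit_continuous (U xi x - x).
Proof.
move=> w w0; have w20 : 0 < w / 2 by exact: divr_gt0.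
have [c c0 hc] := hx w20; exists c => // r s r0 hs.
have s0 : 0 <= s by case/andP: hs.
have xi_ge0 := ltW xi0.
have rs : 0 <= r + s by exact: addr_ge0.
have rx : 0 <= r + xi by exact: addr_ge0.
have E t : U t (U xi x - x) = U t (U xi x) - U t x by exact: linearB.
rewrite !E -!UD//.
have -> : r + s + xi = r + xi + s by ring.
have -> : U (r + xi + s) x - U (r + s) x - (U (r + xi) x - U r x) =
  (U (r + xi + s) x - U (r + xi) x) + - (U (r + s) x - U r x).
  by lin_eq [:: U (r + xi + s) x; U (r + s) x; U (r + xi) x; U r x].
rewrite (splitr w); apply: le_rnormD; first exact: hc.
by rewrite rnormN; exact: hc.
Qed.

(** The increment U(xi)x - x has an orbit bounded by d, so [resolvent_bound] makes
    its resolvent sum small. The number d is small for slow semigroups U(t) = T(st),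
    whereas the constant in front of it does not depend on U. *)
Lemma almost_inverse_expands (e : R) : 0 < e -> exists (h : R) (N : nat), forall z : C,
  z != 0 -> expands z ->
  cabs (z - (x0%:C)%C) ^+ n * rnorm (z *: resolvent_sum U h N z x + x) <=
  (2 * e1 / xi * resolvent_constant + 2 * e1 * (L + x0) ^+ n) * d + e.
Proof.
move=> e0; pose Q := (L + x0) ^+ n.
have Q0 : 0 <= Q by rewrite exprn_ge0// addr_ge0// ltW.
have e30 : 0 < e / 3 by exact: divr_gt0.
pose K := 2 * e1 / xi * resolvent_constant.
have x20 : 0 <= 2 * e1 / xi by rewrite divr_ge0 ?(ltW xi0)// mulr_ge0// ltW.
have K0 : 0 <= K by exact: (mulr_ge0 x20 resolvent_constant_ge0).
pose e2 := e / 3 / (K + 1).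
have e20 : 0 < e2 by rewrite divr_gt0// ltr_wpDl.
have Ke2 : K * e2 <= e / 3.
  by rewrite /e2 mulrCA ler_piMr ?(ltW e30)// ler_pdivrMr ?ltr_wpDl// mul1r lerDl.
have hS2 t : 0 <= t -> rnorm (U t (U xi x - x)) <= d.
  move=> t0; rewrite linearB -UD ?(ltW xi0)//; apply: hd => //.
  by rewrite lexx ltW.
have [h0 h00 hh0] := resolvent_bound d0 hS2 orbit_continuous_increment e20.
pose A := Q * (8 * e1 ^+ 2 * L * S).
have e12 : 0 <= e1 ^+ 2 by rewrite exprn_ge0// ltW.
have A0 : 0 <= A by apply: mulr_ge0 => //; apply: mulr_ge0 => //; apply: mulr_ge0 => //; rewrite mulr_ge0.
pose j := (Num.truncn (xi / h0 + xi * (A / (e / 3)))).+1.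
have hj : xi / h0 + xi * (A / (e / 3)) < j%:R by exact: truncnS_gt.
have t1 : 0 <= xi / h0 by apply: divr_ge0; exact: ltW.
have t2 : 0 <= xi * (A / (e / 3)).
  by rewrite mulr_ge0 ?(ltW xi0)//; apply: divr_ge0 => //; exact: ltW.
have j0 : 0 < j%:R :> R by rewrite ltr0n.
pose h := xi / j%:R.
have hp : 0 < h by exact: divr_gt0.
have jh : j%:R * h = xi by rewrite /h mulrC divfK// gt_eqF.
have hh : h <= h0.
  rewrite /h ler_pdivrMr// mulrC -ler_pdivrMr//; move: hj t2; lra.
have hA : A * h <= e / 3.
  rewrite /h mulrA ler_pdivrMr// mulrC [leRHS]mulrC -ler_pdivrMr// -mulrA.
  by move: hj t1; lra.
have [N0 hN0] := hh0 h (introT andP (conj hp hh)).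
have G0 : 0 <= Q * (2 * D0 * S) by rewrite !mulr_ge0.
have [N1 hN1] := expRN_small G0 hp e30.
exists h, (maxn N0 N1) => z z0 ez.
have zL : cabs z <= L by case: ez.
have := almost_inverse (maxn N0 N1) zL z0 hp jh.
have := hN0 (maxn N0 N1) (leq_maxl _ _) z ez.
have := hN1 (maxn N0 N1) (leq_maxr _ _).
set Y2 := rnorm (resolvent_sum U h _ z (U xi x - x)).
set c := cabs (z - _) ^+ n; set Z := rnorm _; set ex := expR (- _).
move=> g1 g2 g3.
have c0 : 0 <= c by rewrite exprn_ge0// rnorm_ge0.
have cQ : c <= Q by exact: expands_dist.
have T0 : 0 <= 2 * e1 * d + (2 * D0 * S * ex + 8 * e1 ^+ 2 * L * S * h).
  have ed : 0 <= e1 * d by rewrite mulr_ge0// ltW.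
  have eh : 0 <= e1 ^+ 2 * L * S * h by apply: mulr_ge0 (ltW hp); apply: mulr_ge0 => //; exact: mulr_ge0.
  have Dx : 0 <= D0 * S * ex by rewrite !mulr_ge0 ?expR_ge0.
  by move: ed eh Dx; rewrite -!mulrA; lra.
apply: (le_trans (ler_wpM2l c0 g3)); rewrite mulrDr.
have p1 : c * (2 * e1 / xi * Y2) <= K * (d + e2).
  rewrite mulrCA /K -[leRHS]mulrA; exact: ler_wpM2l.
have p2 := ler_wpM2r T0 cQ.
apply: (le_trans (lerD p1 p2)).
have -> : Q * (2 * e1 * d + (2 * D0 * S * ex + 8 * e1 ^+ 2 * L * S * h)) =
  2 * e1 * Q * d + (Q * (2 * D0 * S) * ex + A * h) by rewrite /A; ring.
rewrite -/K -/Q.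
by move: g1 hA Ke2; lra.
Qed.

End AlmostInverse.
End ResolventBound.

(** * Quasinilpotent semigroups *)

(** Uniform continuity gives steps of fixed length along which f moves by at most 1. *)
Lemma eps_continuous_bounded (R : realType) (X : normedModType R[i]) (f : R -> X) (a b : R) :
  0 < a -> a < b -> eps_continuous f ->
  exists2 K : R, 0 <= K & forall t, a <= t <= b -> rnorm (f t) <= K.
Proof.
move=> a0 ab fc; have [d d0 hd] := uniformly_continuous a0 ab fc ltr01.
have key k t : a <= t <= b -> t <= a + k%:R * (d / 2) -> rnorm (f t) <= rnorm (f a) + k%:R.
  elim: k t => [|k IH] t /andP[at_ tb] tk.
    by rewrite mul0r addr0 in tk; rewrite addr0 (_ : t = a)//; apply/eqP; rewrite eq_le tk.
  have d20 : 0 < d / 2 by exact: divr_gt0.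
  have [tk'|tk'] := leP t (a + k%:R * (d / 2)).
    by apply: (le_trans (IH t _ tk')); rewrite ?at_// lerD2l ler_nat.
  pose s := a + k%:R * (d / 2).
  have sb : a <= s <= b.
    by rewrite /s lerDl mulr_ge0 ?(ltW d20)//= (le_trans (ltW tk')).
  have h1 := IH s sb (lexx s).
  have h2 : rnorm (f t - f s) <= 1.
    rewrite rnorm_distC; apply: hd => //.
    rewrite distrC gtr0_norm ?subr_gt0//.
    by move: tk; rewrite -natr1 mulrDl mul1r /s; lra.
  rewrite -natr1 addrA addrC -(subrK (f s) (f t)); exact: le_rnormD.
exists (rnorm (f a) + (Num.truncn ((b - a) / (d / 2))).+1%:R).
  by rewrite addr_ge0// rnorm_ge0.
move=> t /andP[at_ tb]; apply: key; first by rewrite at_.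
rewrite -lerBlDl -ler_pdivrMr ?divr_gt0//.
apply: le_trans (ltW (truncnS_gt _)); rewrite ler_pM2r ?invr_gt0 ?divr_gt0//.
by rewrite lerD2r.
Qed.

Section Semigroup.
Context (R : realType) (X : completeNormedModType R[i]) (T : R -> {linear X -> X}).
Hypotheses (hT : operator_semigroup T) (cT : strongly_continuous T)
  (qT : quasinilpotent_semigroup T).

Lemma orbit_eps_continuous v : eps_continuous (fun t => T t v).
Proof.
move=> x x0 e e0; have := @cT v.
have oH : open (@half_line R) by exact: open_gt.
rewrite continuous_open_subspace// => /(_ x).
rewrite inE => /(_ x0) /cvgrPdist_le /(_ ((e%:C)%C)).
rewrite ltcR => /(_ e0) /nbhs_ballP[d /= d0 hd]; exists d => // t td.
have := hd t; rewrite /ball /= distrC => /(_ td).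
by rewrite normE lecR rnorm_distC.
Qed.

(** The identity is put at time 0 so that sums may start there; the result need not
    be continuous at 0. *)
Definition extended (t : R) : {linear X -> X} := if 0 < t then T t else idfun.
Local Notation E := extended.

Lemma extended_pos t : 0 < t -> E t = T t.
Proof. by rewrite /E => ->. Qed.

Lemma extended0 x : E 0 x = x.
Proof. by rewrite /E ltxx. Qed.

Lemma extendedD (s t : R) x : 0 <= s -> 0 <= t -> E (s + t) x = E s (E t x).
Proof.
rewrite !le_eqVlt => /orP[/eqP <-|s0]; first by rewrite add0r extended0.
move=> /orP[/eqP <-|t0]; first by rewrite addr0 extended0.
by rewrite !extended_pos ?addr_gt0//; case: hT => _; apply.
Qed.

Lemma iter_extended n v : iter n (T 1) v = E n%:R v.
Proof.
elim: n => [|n IH]; first by rewrite extended0.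
by rewrite iterS IH -natr1 addrC extendedD// (extended_pos ltr01).
Qed.

(** The spectral radius of T(1) is 0. *)
Lemma quasinilpotent_decay (c : R) : 0 < c ->
  exists N : nat, forall n v, (N <= n)%N -> rnorm (E n%:R v) <= c ^+ n * rnorm v.
Proof.
move=> c0; have := qT ltr01.
move/cvgrPdist_le => /(_ c c0) [N _ hN]; exists N.+1 => n v Nn.
have n0 : (0 < n)%N by exact: leq_ltn_trans Nn.
have := hN n (ltnW Nn); rewrite /= sub0r normrN => h.
rewrite -iter_extended.
have [K hK] : bounded_operator (T n%:R) by case: hT => + _; apply; rewrite ltr0n.
have iterE w : iter n (T 1) w = T n%:R w by rewrite iter_extended extended_pos ?ltr0n.
have hb w : rnorm (iter n (T 1) w) <= K * rnorm w by rewrite iterE.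
have hZ (l : R[i]) w : iter n (T 1) (l *: w) = l *: iter n (T 1) w by rewrite !iterE linearZ.
apply: (le_trans (opnorm_bound hZ hb v)); rewrite ler_wpM2r ?rnorm_ge0//.
have o0 := opnorm_ge0 (iter n (T 1)).
have -> : opnorm (iter n (T 1)) = (opnorm (iter n (T 1)) `^ n%:R^-1) ^+ n.
  by rewrite -powR_mulrn ?powR_ge0// -powRrM mulVf ?pnatr_eq0 -?lt0n// powRr1.
by rewrite lerXn2r ?nnegrE ?powR_ge0 ?(ltW c0)// (le_trans (ler_norm _)).
Qed.

Lemma nat_part (t : R) : 0 <= t -> exists n : nat, n%:R <= t < n.+1%:R.
Proof.
by move=> t0; exists (Num.truncn t); rewrite truncn_le t0 truncnS_gt.
Qed.

(** The constant D does not depend on the vector, only on the rate c. *)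
Lemma extended_decay (c : R) : 0 <= c -> exists2 D : R, 0 <= D &
  forall u (S : R), 0 <= S -> (forall t : R, 0 <= t -> rnorm (E t u) <= S) ->
  forall t : R, 0 <= t -> rnorm (E t u) <= D * expR (- (c * t)) * S.
Proof.
move=> c0; have [N hN] := quasinilpotent_decay (expR_gt0 (- c)).
exists (expR (c * N.+1%:R)) => [|u S S0 hS t t0]; first exact: expR_ge0.
have [n /andP[nt tn]] := nat_part t0.
have r0 : 0 <= t - n%:R by rewrite subr_ge0.
rewrite -expRD.
have [Nn|nN] := leqP N n.
  have -> : E t u = E n%:R (E (t - n%:R) u).
    by rewrite -extendedD// addrC subrK.
  apply: (le_trans (hN n _ Nn)); apply: ler_pM; rewrite ?exprn_ge0 ?expR_ge0 ?rnorm_ge0//.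
    rewrite -expRM_natl ler_expR.
    have := ler_wpM2l c0 (ltW tn); have cN : 0 <= c * N%:R by rewrite mulr_ge0.
    by rewrite -!natr1 !mulrDr !mulr1; move: cN; lra.
  exact: hS.
apply: (le_trans (hS t t0)); apply: ler_peMl => //; apply: expR_ge1.
have : t <= N.+1%:R.
  by apply: (le_trans (ltW tn)); rewrite ler_nat; exact: leqW.
by move=> /(ler_wpM2l c0); lra.
Qed.

(** Vectors of the form T(t0)y have an orbit that is a piece of the orbit of y away
    from time 0, where strong continuity holds, and which tends to 0. *)
Lemma image_orbit_bounded t0 y : 0 < t0 -> exists2 S : R, 0 <= S &
  forall t : R, 0 <= t -> rnorm (E t (T t0 y)) <= S.
Proof.
move=> t00; have [N hN] := quasinilpotent_decay (@ltr01 R).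
have EE t : 0 <= t -> E t (T t0 y) = T (t0 + t) y.
  by move=> tp; rewrite -(extended_pos t00) -extendedD ?(ltW t00)// addrC extended_pos// ltr_wpDr.
have lt1 : t0 < t0 + N.+1%:R by rewrite ltrDl ltr0n.
have [K K0 hK] := eps_continuous_bounded t00 lt1 (@orbit_eps_continuous y).
exists K => // t tp; have [n /andP[nt tn]] := nat_part tp.
have [nN|Nn] := ltnP n N.
  rewrite EE//; apply: hK; rewrite lerDl tp lerD2l.
  by apply: (le_trans (ltW tn)); rewrite ler_nat; exact: leqW.
have r0 : 0 <= t - n%:R by rewrite subr_ge0.
have -> : E t (T t0 y) = E n%:R (E (t - n%:R) (T t0 y)).
  by rewrite -extendedD// addrC subrK.
apply: (le_trans (hN n _ Nn)); rewrite expr1n mul1r EE//; apply: hK.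
rewrite lerDl r0 lerD2l; apply: (@le_trans _ _ 1); last by rewrite ler1n.
by move: tn; rewrite -natr1; lra.
Qed.

(** Continuity is uniform on compact intervals, and the orbit tends to 0. *)
Lemma image_orbit_continuous t0 y : 0 < t0 -> orbit_continuous E (T t0 y).
Proof.
move=> t00 w w0; have [S S0 hS] := image_orbit_bounded y t00.
have [D D0 hD] := extended_decay ler01.
have DS : 0 <= D * S by exact: mulr_ge0.
have w20 : 0 < w / 2 by exact: divr_gt0.
have [K hK] := expRN_small DS ltr01 w20.
have EE t : 0 <= t -> E t (T t0 y) = T (t0 + t) y.
  by move=> tp; rewrite -(extended_pos t00) -extendedD ?(ltW t00)// addrC extended_pos// ltr_wpDr.
have lt1 : t0 < t0 + K.+1%:R by rewrite ltrDl ltr0n.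
have [d d0 hd] := uniformly_continuous t00 lt1 (@orbit_eps_continuous y) w0.
exists (d / 2); first exact: divr_gt0.
move=> r s r0 /andP[s0 sd]; have rs : 0 <= r + s by exact: addr_ge0.
have [rK|Kr] := leP r K.+1%:R.
  rewrite rnorm_distC !EE//; apply: hd; first by rewrite lerDl r0 lerD2l.
  rewrite (_ : t0 + r - (t0 + (r + s)) = - s); last by ring.
  by rewrite normrN ger0_norm// (le_lt_trans sd)// ltr_pdivrMr// ltr_pMr// ltr1n.
have small t : K%:R <= t -> rnorm (E t (T t0 y)) <= w / 2.
  move=> Kt; have tp : 0 <= t by exact: le_trans Kt.
  apply: (le_trans (hD _ _ S0 hS t tp)); apply: le_trans (hK K (leqnn _)).
  by rewrite mulrAC ler_wpM2l// ler_expR lerN2 mul1r mulr1.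
have Kr' : K%:R <= r by apply: le_trans (ltW Kr); rewrite ler_nat.
rewrite (splitr w); apply: le_rnormD; last by rewrite rnormN; exact: small.
by apply: small; rewrite (le_trans Kr')// lerDl.
Qed.

(** By uniform boundedness T is bounded on the compact interval [sa, sb] of the open
    half-line, so the functional calculus is a bounded operator. *)
Lemma quadrature_bounded (a b V s : R) (q : quadrature a b V) (B : X -> X) :
  0 < a -> a < b -> 0 <= V -> 0 < s ->
  (forall v, converges (qsum q (fun t => T (s * t) v)) (B v)) ->
  forall v, rnorm (B v) <= opnorm B * rnorm v.
Proof.
move=> a0 ab V0 s0 hB.
have [K hK] : exists K : R, forall t, s * a <= t <= s * b -> forall v,
    rnorm (T t v) <= K * rnorm v.
  apply: (uniform_boundedness (A := [set t | s * a <= t <= s * b])) => [t /andP[at_ _]|v].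
    by case: hT => + _; apply; apply: lt_le_trans at_; exact: mulr_gt0.
  have sa0 : 0 < s * a by exact: mulr_gt0.
  have sab : s * a < s * b by rewrite ltr_pM2l.
  have [K _ hK] := eps_continuous_bounded sa0 sab (@orbit_eps_continuous v).
  by exists K.
have BZ (c : R[i]) v : B (c *: v) = c *: B v.
  apply: converges_unique (hB (c *: v)) _; apply: converges_ext (convergesZ c (hB v)) => n.
  by rewrite -qsumZ; congr (qsum _ _ _); apply/funext => t; rewrite linearZ.
apply: (@opnorm_bound _ _ _ (V * `|K|)) => // v.
rewrite -mulrA; apply: (qlim_le _ _ (hB v)); first by rewrite mulr_ge0// rnorm_ge0.
move=> t /andP[at_ tb]; apply: (le_trans (hK _ _ v)).
  by rewrite !ler_pM2l// at_.
by rewrite ler_wpM2r ?rnorm_ge0// ler_norm.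
Qed.

End Semigroup.

(** * Residues through primitives *)

Section Primitives.
Context (R : realType).
Local Notation C := R[i].

Lemma has_deriv_shiftX (w : C) n :
  has_deriv (E := C^o) (fun z => (z - w) ^+ n) (fun z => n%:R * (z - w) ^+ n.-1).
Proof.
have h : has_deriv (E := C^o) (fun z => z - w) (fun=> 1).
  have H := has_derivD (@has_deriv_id R) (has_deriv_cst (E := C^o) (- w)).
  apply: has_deriv_eq H => // z.
  by rewrite addr0.
by apply: has_deriv_eq (has_derivX n h) => // z; rewrite mulr1.
Qed.

Lemma has_deriv_cexpM (c : C) :
  has_deriv (E := C^o) (fun z => cexp (z * c)) (fun z => c * cexp (z * c)).
Proof.
have h : has_deriv (E := C^o) (fun z => z * c) (fun=> c).
  apply: has_deriv_eq (has_derivM (@has_deriv_id R) (has_deriv_cst (E := C^o) c)) => // z.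
  by rewrite mul1r mulr0 addr0.
exact: (has_deriv_comp (E := C^o) (@has_deriv_cexp R) h).
Qed.

Lemma has_deriv_cmul (c : C) (f f1 : C -> C) : has_deriv (E := C^o) f f1 ->
  has_deriv (E := C^o) (fun z => c * f z) (fun z => c * f1 z).
Proof.
move=> h; apply: has_deriv_eq (has_derivM (has_deriv_cst (E := C^o) c) h) => // z.
by rewrite mul0r add0r.
Qed.

(** Integration by parts in n when the exponent is nonzero; c = 0 is apart. *)
Lemma primitive_shiftX_cexp (w c : C) n : exists f : C -> C,
  has_deriv (E := C^o) f (fun z => (z - w) ^+ n * cexp (z * c)).
Proof.
have [->|c0] := eqVneq c 0.
  exists (fun z => n.+1%:R^-1 * (z - w) ^+ n.+1).
  apply: has_deriv_eq (has_deriv_cmul (n.+1%:R^-1) (has_deriv_shiftX w n.+1)) => // z.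
  by rewrite mulr0 cexp0 mulr1 mulrA mulVf ?mul1r// pnatr_eq0.
elim: n => [|n [f hf]].
  exists (fun z => c^-1 * cexp (z * c)).
  apply: has_deriv_eq (has_deriv_cmul (c^-1) (has_deriv_cexpM c)) => // z.
  by rewrite mulrA mulVf// expr0.
exists (fun z => c^-1 * ((z - w) ^+ n.+1 * cexp (z * c) + - n.+1%:R * f z)).
apply: has_deriv_eq (has_deriv_cmul (c^-1) (has_derivD
  (has_derivM (has_deriv_shiftX w n.+1) (has_deriv_cexpM c))
  (has_deriv_cmul (- n.+1%:R) hf))) => // z /=.
rewrite -[RHS]mul1r -(mulVf c0) -[RHS]mulrA exprS; congr (_ * _); ring.
Qed.

(** The quotient of (z - w)^n - (-w)^n by z is a polynomial; it is given together
    with a primitive. *)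
Lemma primitive_shift_quotient (w : C) n : exists p p1 : C -> C,
  has_deriv (E := C^o) p p1 /\ forall z, z * p1 z = (z - w) ^+ n - (- w) ^+ n.
Proof.
elim: n => [|n [p [p1 [hp E]]]].
  exists (fun=> 0), (fun=> 0); split; first exact: has_deriv_cst.
  by move=> z; rewrite mulr0 !expr0 subrr.
exists (fun z => n.+1%:R^-1 * (z - w) ^+ n.+1 + - w * p z), (fun z => (z - w) ^+ n + - w * p1 z).
split.
  apply: has_deriv_eq (has_derivD (has_deriv_cmul (n.+1%:R^-1) (has_deriv_shiftX w n.+1))
    (has_deriv_cmul (- w) hp)) => // z.
  by rewrite mulrA mulVf ?mul1r// pnatr_eq0.
by move=> z; rewrite mulrDr mulrCA E !exprS; ring.
Qed.

End Primitives.

Section Monodromy.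
Context (R : realType) (X : normedModType R[i]) (U : R -> {linear X -> X}).
Local Notation C := R[i].

(** As a function of l, (e^l - x0)^n (e^l Y(e^l) + x) has a primitive whose only term
    that is not periodic under 2 pi i is (-x0)^n l x, the residue of
    (z - x0)^n x / z at 0. A bound for the function along a path from l0 to l1 and
    along the conjugate path therefore bounds x itself. *)
Lemma monodromy_bound (h : R) (N n : nat) (x0 : R) (x : X) (sigma P : R) (l0 l1 : C)
    (G : C -> Prop) : 0 < x0 ->
  (forall l, G l -> cabs (cexp l - (x0%:C)%C) ^+ n *
     rnorm (cexp l *: resolvent_sum U h N (cexp l) x + x) <= sigma) ->
  joined G l0 P l1 -> joined G l0 P (l1^*)%C -> `|complex.Im l1| = pi ->
  2 * pi * x0 ^+ n * rnorm x <= 2 * (sigma * P).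
Proof.
move=> x00 hG j1 j2 Il1.
set w : C := (x0%:C)%C.
have [f hf] := choice (fun m : nat => primitive_shiftX_cexp w (((m%:R * h)%:C)%C) n).
have [p [p1 [hp pE]]] := primitive_shift_quotient w n.
pose Phi z := \sum_(m < N) f m z *: ((h%:C)%C *: U (m%:R * h) x).
have hPhi : has_deriv Phi (fun z => (z - w) ^+ n *: resolvent_sum U h N z x).
  apply: has_deriv_eq (has_deriv_sum (index_enum 'I_N)
    (fun m : 'I_N => has_deriv_scale ((h%:C)%C *: U (m%:R * h) x) (hf m))) => // z.
  rewrite /resolvent_sum scaler_sumr; apply: eq_bigr => m _.
  by rewrite /resolvent_term !scalerA mulrAC mulrA.
have hexp := @has_deriv_cexp R.
(* the three terms are periodic, periodic and linear in l *)
pose Psi l := Phi (cexp l) + (p (cexp l) *: x + ((- w) ^+ n * l) *: x).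
have hPsi : has_deriv Psi
    (fun l => (cexp l - w) ^+ n *: (cexp l *: resolvent_sum U h N (cexp l) x + x)).
  apply: has_deriv_eq (has_derivD (has_deriv_comp hPhi hexp)
    (has_derivD (has_deriv_scale x (has_deriv_comp (E := C^o) hp hexp))
      (has_deriv_scale x (has_deriv_cmul ((- w) ^+ n) (@has_deriv_id R))))) => // l.
  rewrite -[cexp l *: p1 (cexp l)]/(cexp l * p1 (cexp l)) pE.
  set Y := resolvent_sum _ _ _ _ _; set c := cexp l; set cn := (c - w) ^+ n.
  set wn := (- w) ^+ n.
  lin_eq [:: Y; x].
have hb l : G l -> rnorm ((cexp l - w) ^+ n *: (cexp l *: resolvent_sum U h N (cexp l) x + x))
   <= sigma by move=> Gl; rewrite rnormZ cabsX; exact: hG.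
have b1 := joined_mvt hPsi hb j1; have b2 := joined_mvt hPsi hb j2.
have eE : cexp (l1^*)%C = cexp l1.
  have : sin (complex.Im l1) = 0.
    have s0 : sin `|complex.Im l1| = 0 by rewrite Il1 sinpi.
    have [h0|h0] := leP 0 (complex.Im l1); first by rewrite -{1}(ger0_norm h0).
    by rewrite -(opprK (complex.Im l1)) -(ltr0_norm h0) sinN s0 oppr0.
  case: (l1) => u v /= sv; rewrite /cexp /= cosN sinN sv oppr0 //.
have dE : Psi l1 - Psi (l1^*)%C = ((- w) ^+ n * (l1 - (l1^*)%C)) *: x.
  rewrite /Psi eE; set A := Phi _; set c := p _; set wn := (- w) ^+ n.
  lin_eq [:: A; x].
have dN : cabs (l1 - (l1^*)%C) = 2 * pi.
  rewrite -Il1; have -> : l1 - (l1^*)%C = ((2 * complex.Im l1)%:C)%C * 'i%C.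
    case: (l1) => u v; apply/eqP; rewrite eq_complex /=; apply/andP; split; apply/eqP; ring.
  rewrite cabsM cabsR normrM ger0_norm// cabs_def /= expr0n expr1n add0r sqrtr1 mulr1 //.
have : rnorm (Psi l1 - Psi (l1^*)%C) <= sigma * P + sigma * P.
  rewrite -(subrK (Psi l0) (Psi l1)) -addrA; apply: le_rnormD => //.
  by rewrite rnorm_distC.
rewrite dE rnormZ cabsM dN cabsX rnormN cabsR gtr0_norm//.
by rewrite [x0 ^+ n * _]mulrC => bound; apply: (le_trans bound); lra.
Qed.

End Monodromy.

(** * The theorem *)

Theorem theorem2p5 (R : realType) (X : completeNormedModType R[i])
    (mu : {charge set (measurableTypeR R) -> \bar R})
    (T : R -> {linear X -> X}) :
  compact_support_measure mu ->
  nontrivial_charge mu ->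
  mu (@half_line R) = 0%E ->
  operator_semigroup T ->
  strongly_continuous T ->
  quasinilpotent_semigroup T ->
  nontrivial_semigroup T ->
  exists M : R,
    is_maximum [set `|laplace mu x| | x in [set x : R | 0 <= x]] M /\
    exists eta : R, 0 < eta /\
      forall s : R, 0 < s <= eta -> M < opnorm (functional_calculus T mu s).
Proof.
move=> hmu nmu muD hT cT qT [t0 [y [t00 ynz]]].
have [a [b [a0 ab np nn]]] := compact_support_bounds hmu.
have V0 := total_variation_ge0 mu; set V := total_variation mu in V0.
pose q := charge_quad a0 ab np nn.
have FP := ctransform_converges a0 ab np nn.
have [x0 [M [x00 M0 LM hM]]] := laplace_max a0 ab np nn muD nmu.
exists M; split.
  split; first by exists x0 => //=; exact: ltW.
  by move=> _ [z /= z0 <-]; exact: hM.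
pose F := ctransform mu.
have FM : cabs (F 0%N ((x0%:C)%C)) = M.
  by rewrite /F (ctransform_real a0 ab np nn) cabsR.
have Fnz : F 0%N ((x0%:C)%C) != 0.
  by apply/eqP => h; move: M0; rewrite -FM h rnorm0 ltxx.
have [n [k [rho [P [l1 [k0 j1 Il1]]]]]] := winding_path a0 V0
  (has_deriv_ctransform a0 ab np nn) (ctransform_decay a0 ab np nn)
  (ctransform0 a0 ab np nn muD) x00 M0 FM (fun j => ctransform_Im a0 ab np nn j x0)
  (ctransform_nonflat a0 ab np nn muD Fnz (ltW x00)).
have P0 := joined_ge0 j1.
pose L := expR rho; have L0 : 0 <= L by exact: expR_ge0.
pose e1 := expR (1 : R); have e10 : 0 < e1 by exact: expR_gt0.
(* xi satisfies the hypothesis of [cexp_sub1_lower] and does not depend on s *)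
pose xi := (8 * e1 * (L + 1))^-1.
have x80 : 0 < 8 * e1 * (L + 1) by rewrite !mulr_gt0// ltr_wpDl.
have xi0 : 0 < xi by rewrite invr_gt0.
have xiL : 8 * e1 * (L * xi) <= 1.
  rewrite mulrA ler_pdivrMr// mul1r -!mulrA ler_pM2l// ler_pM2l// lerDl //.
pose x := T t0 y.
have xp : 0 < rnorm x by exact: rnorm_gt0.
have [S S0 hS] := image_orbit_bounded hT cT qT y t00.
have hx := image_orbit_continuous hT cT qT y t00.
pose K := 2 * e1 / xi * resolvent_constant L b V x0 k n + 2 * e1 * (L + x0) ^+ n.
have K0 : 0 <= K.
  apply: addr_ge0; last by rewrite !mulr_ge0 ?exprn_ge0 ?addr_ge0 ?(ltW e10)// ltW.
  apply: mulr_ge0; first by rewrite divr_ge0 ?(ltW xi0)// mulr_ge0// ltW.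
  exact: (resolvent_constant_ge0 L0 (ltW a0) (ltW ab)).
pose B := pi * x0 ^+ n * rnorm x.
have B0 : 0 < B by rewrite !mulr_gt0 ?pi_gt0// exprn_gt0.
(* with this e the final bound reads B <= B / 2 *)
pose e := B / (4 * (P + 1)).
have e0 : 0 < e by rewrite divr_gt0// mulr_gt0// ltr_wpDl.
have d0 : 0 < e / (K + 1) by rewrite divr_gt0// ltr_wpDl.
have [d dp hd] := hx _ d0.
exists (d / xi); split; first exact: divr_gt0.
move=> s /andP[s0 sd]; rewrite ltNge; apply/negP => opM.
have sxi : s * xi <= d by rewrite -ler_pdivlMr.
(* in this time scale F(-sA) is an integral over the support of mu *)
pose U t := extended T (s * t).
have U0 v : U 0 v = v by rewrite /U mulr0 extended0.
have UD (r t : R) v : 0 <= r -> 0 <= t -> U (r + t) v = U r (U t v).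
  by move=> r0 t0'; rewrite /U mulrDr (extendedD hT)// mulr_ge0// ltW.
have c0 : 0 <= (L + 1) / s by rewrite divr_ge0 ?addr_ge0 ?(ltW s0).
have [D D0 hD] := extended_decay hT qT c0.
have decay u (S1 : R) : 0 <= S1 -> (forall t : R, 0 <= t -> rnorm (U t u) <= S1) ->
    forall t : R, 0 <= t -> rnorm (U t u) <= D * expR (- ((L + 1) * t)) * S1.
  move=> S10 hS1 t tp; have st : 0 <= s * t by rewrite mulr_ge0// ltW.
  have hS1' r : 0 <= r -> rnorm (extended T r u) <= S1.
    move=> r0; have := hS1 (r / s); rewrite /U mulrCA divff ?gt_eqF// mulr1; apply.
    by rewrite divr_ge0// ltW.
  by have := hD u S1 S10 hS1' (s * t) st; rewrite mulrA divfK ?gt_eqF.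
have TsC v : eps_continuous (fun t => T (s * t) v).
  move=> t tp w w0; have [c cp hc] := orbit_eps_continuous cT v (mulr_gt0 s0 tp) w0.
  exists (c / s); first exact: divr_gt0.
  move=> r; rewrite ltr_pdivlMr// => hr; apply: hc.
  by rewrite -mulrBr normrM gtr0_norm// mulrC.
have BP0 v : converges (qsum q (fun t => T (s * t) v)) (functional_calculus T mu s v).
  exact: charge_bochner_converges.
have BP v : converges (qsum q (fun t => U t v)) (functional_calculus T mu s v).
  apply: converges_ext (BP0 v) => m; apply: eq_qsum => t /andP[at_ _].
  by rewrite /U extended_pos// mulr_gt0// (lt_le_trans a0).
have BM v : rnorm (functional_calculus T mu s v) <= M * rnorm v.
  apply: (le_trans (quadrature_bounded hT cT a0 ab V0 s0 BP0 v)).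
  by rewrite ler_wpM2r// rnorm_ge0.
have hSU (t : R) : 0 <= t -> rnorm (U t x) <= S.
  by move=> tp; apply: hS; rewrite mulr_ge0// ltW.
have hxU : orbit_continuous U x.
  move=> w w0; have [c cp hc] := hx w w0.
  exists (c / s); first exact: divr_gt0.
  move=> r t r0 /andP[tp tc]; rewrite /U mulrDr; apply: hc.
    by rewrite mulr_ge0// ltW.
  by rewrite mulr_ge0 ?(ltW s0)//= mulrC -ler_pdivlMr.
have hdU (r t : R) : 0 <= r -> 0 <= t <= xi -> rnorm (U (r + t) x - U r x) <= e / (K + 1).
  move=> r0 /andP[tp tx]; rewrite /U mulrDr; apply: hd.
    by rewrite mulr_ge0// ltW.
  by rewrite mulr_ge0 ?(ltW s0)//= (le_trans _ sxi)// ler_pM2l.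
have [h [N hhN]] := almost_inverse_expands U0 UD L0 D0 decay (ltW a0) (ltW ab) V0
  (FP 0%N) BP BM n x00 k0 S0 hSU hxU xi0 xiL hdU e0.
pose G l := expands L (F 0%N) M x0 k n (cexp l).
have Gtame l : tame F x0 M n k rho l -> G l.
  by move=> [lr h']; split=> //; exact: cabs_cexp_le.
have GtameJ l : tame F x0 M n k rho l -> G ((l^*)%C).
  move=> [lr h']; split; first by apply: cabs_cexp_le; rewrite cabsJ.
  rewrite /expands cexp_conj /F (laplace_conj FP) cabsJ.
  have -> : (cexp l)^*%C - (x0%:C)%C = ((cexp l - (x0%:C)%C)^*)%C.
    by rewrite rmorphB /= oppr0.
  by rewrite cabsJ; case: (cexp l) h'.
have hG l : G l -> cabs (cexp l - (x0%:C)%C) ^+ n *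
    rnorm (cexp l *: resolvent_sum U h N (cexp l) x + x) <= e + e.
  move=> Gl; apply: (le_trans (hhN _ (cexp_neq0 l) Gl)); rewrite lerD2r -/K.
  by rewrite mulrCA ler_piMr ?(ltW e0)// ler_pdivrMr ?ltr_wpDl// mul1r lerDl.
have l0J : ((((ln x0)%:C)%C : R[i])^*)%C = ((ln x0)%:C)%C by rewrite /= oppr0.
have j1' := joined_sub Gtame j1.
have j2' := joined_conj GtameJ j1; rewrite l0J in j2'.
have := monodromy_bound x00 hG j1' j2' Il1.
have -> : 2 * pi * x0 ^+ n * rnorm x = 2 * B by rewrite /B; ring.
apply/negP; rewrite -ltNge ltr_pM2l//.
have -> : (e + e) * P = B / 2 * (P / (P + 1)).
  by rewrite /e; field; rewrite gt_eqF// ltr_wpDl.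
apply: (@le_lt_trans _ _ (B / 2)); last by rewrite ltr_pdivrMr// ltr_pMr// ltr1n.
by apply: ler_piMr; [rewrite divr_ge0// ltW|rewrite ler_pdivrMr ?ltr_wpDl// mul1r lerDl].
Qed.
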